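(* Let $b\geq 3$, $\ell\geq 2$, and $2\leq r\leq 6$ be integers with $r<\frac{3}{2}\ell$. Then $K_{3,b}^\ell$ is $(r,1-\frac{2}{3\ell})$-nice. In particular, letting $s:=|V(K_{3,b}^{\ell})|=3+b+3(\ell-1)b$ (and noting $|E(K_{3,b}^{\ell})|=3b\ell$), we have \[ f\left(n,rs,\binom{rs}{2}-3(r-1)b\ell+1\right)=\Omega\left(n^{\frac{r}{r-1}\left(1-\frac{2}{3\ell}\right)}\right). \]
   Context: For positive integers $p,q$ with $1\le q\le\binom p2$, a $(p,q)$-coloring of $K_n$ is an edge-coloring of $K_n$ in which every $p$ vertices span a clique with at least $q$ distinct colors; $f(n,p,q)$ is the minimum number of colors in a $(p,q)$-coloring of $K_n$. $\mathrm{ex}(n,F)$ is the Turán number of $F$. Asymptotics are in $n$ with all other parameters constant. For a bipartite graph $F$ and constants $r\ge 2$, $\alpha>0$, $F$ is called $(r,\alpha)$-nice if $\mathrm{ex}(n,F)=O(n^{2-\alpha})$ and \[ f\left(n,r|V(F)|,\binom{r|V(F)|}{2}-(r-1)|E(F)|+1\right)=\Omega\left(n^{\frac{\alpha r}{r-1}}\right). \] For $a\le b$ and $\ell\ge1$, $K_{a,b}^{\ell}$ denotes the graph obtained from the complete bipartite graph $K_{a,b}$ by replacing each edge with a path with $\ell$ edges. *)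

(* Defs.v *)
From HB Require Import structures.
From mathcomp Require Import all_boot all_order all_algebra.
From mathcomp Require Import all_classical all_reals all_analysis.

Set Implicit Arguments.
Unset Strict Implicit.
Unset Printing Implicit Defensive.

Import Order.TTheory GRing.Theory Num.Theory.
Import numFieldNormedType.Exports.

Local Open Scope nat_scope.

Definition edge_set (V : finType) (E : {set {set V}}) : bool :=
  [forall e in E, #|e| == 2].

Record sgraph := SGraph {
  vert : finType;
  edges : {set {set vert}};
  edgesP : edge_set edges }.

Definition bipartite (F : sgraph) : Prop :=
  exists A : {set vert F}, forall e, e \in edges F -> #|e :&: A| = 1.

(* Subgraphs are not required to be induced. *)
Definition contains_copy (F : sgraph) (V : finType) (E : {set {set V}}) : bool :=
  [exists g : {ffun vert F -> V},
     injectiveb g && [forall e in edges F, g @: e \in E]].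

(* The Turan number ex(n, F). *)
Definition ex (n : nat) (F : sgraph) : nat :=
  \max_(E : {set {set 'I_n}} | edge_set E && ~~ contains_copy F E) #|E|.

Definition Kedge (n : nat) := {e : {set 'I_n} | #|e| == 2}.

Definition pq_coloring (n p q k : nat) (c : {ffun Kedge n -> 'I_k}) : bool :=
  [forall S : {set 'I_n}, (#|S| == p) ==>
     (q <= #|[set c e | e : Kedge n & val e \subset S]|)].

Definition pq_colorable (n p q k : nat) : bool :=
  [exists c : {ffun Kedge n -> 'I_k}, pq_coloring p q c].

(* f(n, p, q): the least k such that K_n has a (p,q)-coloring with k colors.
   Since q <= 'C(p, 2), giving the 'C(n, 2) edges pairwise distinct colors is a
   (p,q)-coloring, so the search may be bounded by 'C(n, 2); see f_pqP.
   The value is meaningless when q > 'C(p, 2). *)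
Definition f_pq (n p q : nat) : nat :=
  [arg min_(k < @ord_max 'C(n, 2) | pq_colorable n p q k) (k : nat)].

Lemma card_Kedge n : #|{: Kedge n}| = 'C(n, 2).
Proof.
by rewrite card_sig -[in RHS](card_ord n) -card_draws cardsE; apply: eq_card.
Qed.

Lemma pq_colorable_bin2 n p q : q <= 'C(p, 2) -> pq_colorable n p q 'C(n, 2).
Proof.
move=> qp; apply/existsP.
exists [ffun e => cast_ord (card_Kedge n) (enum_rank e)].
apply/forallP => S; apply/implyP => /eqP Sp.
rewrite card_imset; last first.
  by move=> x y; rewrite !ffunE => /cast_ord_inj /enum_rank_inj.
apply: leq_trans qp _; rewrite -Sp -cards_draws -[leqRHS](card_imset _ val_inj).
apply: subset_leq_card; apply/fintype.subsetP => e; rewrite inE => /andP[eS e2].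
by apply/imsetP; exists (Sub e e2 : Kedge n); rewrite ?inE.
Qed.

Lemma f_pqP n p q : q <= 'C(p, 2) ->
  pq_colorable n p q (f_pq n p q) /\
  (forall k, pq_colorable n p q k -> f_pq n p q <= k).
Proof.
move=> qp; rewrite /f_pq; case: arg_minnP => [|i iP imin].
  exact: pq_colorable_bin2.
split=> // k kP; have [kn|nk] := leqP k 'C(n, 2).
  exact: (imin (Ordinal (kn : k < 'C(n, 2).+1))).
by apply: leq_trans (ltnW nk); rewrite -ltnS.
Qed.

(* Vertices of K_{a,b}^l: the vertices of K_{a,b}, together with the l - 1 inner
   vertices of each of the a * b paths. *)
Definition Ksub_vert (a b l : nat) : finType :=
  ('I_a + 'I_b + 'I_a * 'I_b * 'I_l.-1)%type.

(* The t-th vertex, 0 <= t <= l, of the path that replaces the edge ij. *)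
Definition Ksub_path (a b l : nat) (i : 'I_a) (j : 'I_b) (t : nat) :
    Ksub_vert a b l :=
  if t == 0 then inl (inl i)
  else if (insub t.-1 : option 'I_l.-1) is Some u then inr (i, j, u)
  else inl (inr j).

Definition Ksub_edges (a b l : nat) : {set {set Ksub_vert a b l}} :=
  [set [set Ksub_path l x.1.1 x.1.2 x.2; Ksub_path l x.1.1 x.1.2 x.2.+1]
     | x : 'I_a * 'I_b * 'I_l].

Lemma Ksub_edgesP a b l : edge_set (Ksub_edges a b l).
Proof.
apply/forallP => e; apply/implyP => /imsetP[[[i j] t] _ ->] /=.
rewrite cards2; suff -> : Ksub_path l i j t != Ksub_path l i j t.+1 by [].
rewrite /Ksub_path /=; case: t => -[|t] tl /=; first by case: insubP.
case: insubP => [u _ ut|]; last by rewrite -ltnS (ltn_predK tl) tl.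
case: insubP => [v _ vt|//]; apply/eqP => -[uv].
by move: ut; rewrite uv vt => /eqP; rewrite eqn_leq ltnn.
Qed.

Definition Ksub (a b l : nat) : sgraph := SGraph (Ksub_edgesP a b l).

Local Open Scope classical_set_scope.
Local Open Scope ring_scope.

(* The natural-number subtraction does not truncate: #|edges F| <= 'C(v, 2). *)
Definition nice (R : realType) (r : nat) (alpha : R) (F : sgraph) : Prop :=
  let v := #|vert F| in
  [/\ bipartite F, (2 <= r)%N, 0 < alpha,
      (fun n => (ex n F)%:R : R) =O_\oo (fun n => n%:R `^ (2 - alpha)) &
      (fun n => (f_pq n (r * v) ('C(r * v, 2) - (r - 1) * #|edges F| + 1))%:R : R)
        =Omega_\oo (fun n => n%:R `^ (alpha * r%:R / (r%:R - 1)))].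

(* Main.v *)
(* The Turan bound rests on the following statement: if a graph on [n] vertices has
   more than [C * n ^ (1 + 2 / (3 l))] edges, then it contains three vertices [u i]
   such that, whatever bounded set is to be avoided, some vertex is joined to the
   [u i] by three disjoint paths with [l] edges; [b] such spiders form a copy of
   [Ksub 3 b l].  To prove it, pass to an almost regular subgraph, in which spiders
   with legs of length [l] are so numerous that many share the same three leaves.
   A sunflower argument gives a proper set [K] of positions containing the leaves such
   that, in a dense subfamily, a spider can be changed off [K] almost freely while
   being kept on [K].  If [K] leaves out the centre and at least two of its
   neighbours, the three legs are cut at their first position in [K] and bounced to
   the required length; otherwise a leg or a pair of legs meets [K] in the two ends
   of a path only, and such a flexible path gives the three vertices.

   For the lower bound on [f_pq], few colours force the energy graph to be dense: its
   vertices are [r]-tuples, and two tuples are adjacent if their [r] coordinate pairs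
   are edges of one colour, taken from a maximal matching in that colour.  The
   statement above, in a version where tuples sharing a coordinate are in conflict,
   yields spiders of tuples with the same three leaves.  In each coordinate, a new
   spider whose neighbours of the leaves are new vertices adds at least two more edges
   than vertices.  So [b] spiders, padded by pendant edges up to [s] vertices per
   coordinate, span [#|edges (Ksub 3 b l)|] edges in each coordinate, and every colour
   occurs in every coordinate: too many repetitions on [r * s] vertices. *)

From HB Require Import structures.
Require Import Defs.
From mathcomp Require Import all_boot all_order all_algebra zify ring lra.

Set Implicit Arguments.
Unset Strict Implicit.
Unset Printing Implicit Defensive.

(** * Sunflowers and cleaning of families of functions *)

(** The exponent comes from one count. In a nearly regular graph of degree [d] on [n] vertices there
    are about [n * d ^ (3 * l)] spiders with legs of length [l], against [n ^ 3] triples of leaves,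
    so they pile up on some triple once [d ^ (3 * l)] is a large multiple of [n ^ 2]. Piling up is
    not enough: all spiders over a triple may run through the same few inner vertices, and then a
    bounded set blocks them. New legs must be built from whatever freedom is left between the fixed
    positions. Walking back and forth through a free vertex lengthens a leg by two, so the parity of
    the missing length decides many cases. The energy graph of a coloring with [k] colours has
    [n ^ r] vertices and, by convexity, at least of order [n ^ (2 * r) / k ^ (r - 1)] edges; the
    same count applied to it bounds [k] from below. The hypothesis [2 * r < 3 * l] makes a
    monochromatic star on [r * s] vertices repeat a colour too often, so colour degrees are bounded
    and the maximal matchings hold a constant proportion of all edges. *)

Lemma card_le_fibers (T : finType) (X : finType) (h : T -> X) (A B : {set T}) c :
  (forall f, f \in A ->
     #|[set g in A | h g == h f]| <= c * #|[set g in B | h g == h f]|) ->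
  #|A| <= c * #|B|.
Proof.
move=> hAB; rewrite -!sum1_card.
rewrite (partition_big h predT) //= [X in _ <= _ * X](partition_big h predT) //=.
rewrite big_distrr /=; apply: leq_sum => x _.
case: (pickP [pred f in A | h f == x]) => [f /andP[fA /eqP <-]|no].
  move: (hAB f fA); rewrite -!sum1_card.
  by under eq_bigl do rewrite inE; under [X in _ <= _ * X -> _]eq_bigl do rewrite inE.
by rewrite big_pred0 // => f; have := no f; rewrite inE.
Qed.

Lemma card_bigcup_le (I T : finType) (p : pred I) (F : I -> {set T}) :
  #|\bigcup_(i | p i) F i| <= \sum_(i | p i) #|F i|.
Proof.
elim/big_rec2: _ => [|i n A _ hA]; first by rewrite cards0.
by apply: leq_trans (leq_card_setU _ _) _; rewrite leq_add2l.
Qed.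

Section Sunflower.
Variables (P V : finType).
Implicit Types (S Q : {set {ffun P -> V}}) (K D : {set P}) (f g : {ffun P -> V}).

(** Total functions into an option type put the restrictions to all sets [K] into one finite type,
    so that they can serve as keys for partitions and counts. *)
Definition restr K f : {ffun P -> option V} :=
  [ffun p => if p \in K then Some (f p) else None].

Lemma restrP K f g : reflect {in K, f =1 g} (restr K f == restr K g).
Proof.
apply: (iffP eqP) => [/ffunP fg p pK|fg].
  by have := fg p; rewrite !ffunE pK => -[].
by apply/ffunP => p; rewrite !ffunE; case: ifP => // pK; rewrite fg.
Qed.

Definition agree_class S K f := [set g in S | restr K g == restr K f].

(** The quantitative form of freedom off [K]: a random member of the class of [f] takes a given
    value at a given position outside [K] with probability at most [1 / c], which is what a union
    bound needs. *)
Definition spread c K S f :=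
  [forall p, (p \notin K) ==> [forall a,
     c * #|[set g in agree_class S K f | g p == a]| <= #|agree_class S K f|]].

Lemma agree_class_eq S K f g :
  restr K g == restr K f -> agree_class S K g = agree_class S K f.
Proof. by move=> /eqP gf; apply/setP => h; rewrite !inE gf. Qed.

Lemma agree_class_setU1 S K p f :
  [set g in agree_class S K f | g p == f p] = agree_class S (p |: K) f.
Proof.
apply/setP => g; rewrite !inE -andbA; congr andb.
apply/andP/restrP => [[/restrP gf /eqP gp] q|gf].
  by rewrite in_setU1 => /orP[/eqP ->|/gf].
split; last by rewrite gf // setU11.
by apply/restrP => q qK; rewrite gf // in_setU1 qK orbT.
Qed.

Variable G : nat -> nat.
Hypothesis G_gt0 : forall w, 0 < G w.

(** Both recursions follow the induction of [sunflower], with [m] the number of positions outside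
    [K] and [W] the factor lost so far. The final value 2 cannot be met once [K] contains all
    positions, because a class is then a single function. The required spread [G] is a function of
    the loss, since later constants depend on it. *)
Fixpoint class_bound m W :=
  if m is m'.+1 then G (2 * W) * class_bound m' (2 * #|P| * G (2 * W) * W) else 2.

Fixpoint loss_bound m W :=
  if m is m'.+1 then
    maxn (2 * W) (loss_bound m' (2 * #|P| * G (2 * W) * W))
  else 2 * W.

(** If half of [S] is spread over [K], that half is the family. Otherwise, by pigeonhole, one
    position [p] carries popular values for a constant proportion of [S]; [p] joins [K], and classes
    shrink by at most the factor [c]. Large initial classes stop this before [K] is everything. *)
Lemma sunflower m K S W N :
  #|~: K| = m -> 0 < N -> N <= W * #|S| ->
  (forall f, f \in S -> class_bound m W <= #|agree_class S K f|) ->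
  exists K' Q W', [/\ K \subset K', K' != setT & Q \subset S] /\
    [/\ N <= W' * #|Q|, W' <= loss_bound m W &
     forall f, f \in Q -> spread (G W') K' Q f].
Proof.
elim: m K S W => [|m IH] K S W cK N0 NS hS.
  have /set0Pn[f fS] : S != set0.
    by apply/eqP => S0; move: NS; rewrite S0 cards0 muln0; lia.
  have := hS f fS; rewrite /= => c2; exfalso.
  have /setP KT : ~: K = set0 by apply: cards0_eq.
  suff /(leq_trans c2) : #|agree_class S K f| <= 1 by [].
  apply/card_le1_eqP => g h; rewrite !inE => /andP[_ /restrP gf] /andP[_ /restrP hf].
  apply/ffunP => p; have := KT p; rewrite !inE => /negbFE pK.
  by rewrite gf // hf.
set c := G (2 * W); have c0 : 0 < c by exact: G_gt0.
have [p0 p0K] : exists p, p \notin K.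
  have /set0Pn[p] : ~: K != set0 by rewrite -card_gt0 cK.
  by rewrite inE => pK; exists p.
set Sp := [set f in S | spread c K S f].
have spE f g : restr K g == restr K f -> spread c K S g = spread c K S f.
  by move=> gf; rewrite /spread (agree_class_eq _ gf).
have [SSp|SSp] := leqP #|S| (2 * #|Sp|).
  exists K, Sp, (2 * W); split; split=> //=.
  - by apply: contra p0K => /eqP ->; rewrite inE.
  - by apply/subsetP => f; rewrite inE => /andP[].
  - by apply: leq_trans NS _; rewrite -mulnA mulnCA leq_mul2l SSp orbT.
  - by rewrite leq_maxl.
  move=> f; rewrite inE => /andP[fS fsp].
  (* Being spread depends only on the agreement class, so passing to [Sp] removes whole classes and
     leaves the others intact. *)
  suff E : agree_class Sp K f = agree_class S K f by rewrite /spread E.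
  apply/setP => g; rewrite !inE; case: (boolP (_ == _)) => gf; rewrite ?andbF //.
  by rewrite (spE _ _ gf) fsp andbT.
(* [S' p] collects the members whose own value at [p] is popular in their class, [Np p] those whose
   class has some popular value. Class by class the former fill more than a fraction [1 / c] of the
   latter. *)
pose S' p := [set g in S | #|agree_class S K g| < c * #|agree_class S (p |: K) g|].
pose Np p := [set f in S | [exists a,
  #|agree_class S K f| < c * #|[set g in agree_class S K f | g p == a]|]].
have NpS' p : #|Np p| <= c * #|S' p|.
  apply: (card_le_fibers (h := restr K)) => f; rewrite inE => /andP[fS /existsP[a fa]].
  apply: leq_trans (leq_trans (ltnW fa) _).
    by apply: subset_leq_card; apply/subsetP => g; rewrite !inE => /andP[/andP[-> _] ->].
  rewrite leq_mul2l; apply/orP; right; apply: subset_leq_card.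
  apply/subsetP => g; rewrite !inE -andbA => /and3P[gS gf /eqP ga].
  by rewrite gS gf -agree_class_setU1 (agree_class_eq _ gf) ga fa.
have [p pK Sp'] : exists2 p, p \notin K & #|S| <= 2 * #|P| * c * #|S' p|.
  have [p /andP[pK hp]|no] :=
    pickP [pred p | (p \notin K) && (#|S| <= 2 * #|P| * c * #|S' p|)].
    by exists p.
  exfalso.
  have hcov : #|S :\: Sp| <= \sum_(p | p \notin K) #|Np p|.
    apply: leq_trans (card_bigcup_le _ _); apply: subset_leq_card.
    apply/subsetP => f; rewrite !inE => /andP[/nandP[/negP //|nsp] fS].
    move: nsp; rewrite /spread negb_forall => /existsP[p].
    rewrite negb_imply => /andP[pK]; rewrite negb_forall => /existsP[a fa].
    apply/bigcupP; exists p => //; rewrite inE fS /=.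
    by apply/existsP; exists a; rewrite ltnNge.
  have hSSp : #|S| < 2 * #|S :\: Sp|.
    have := cardsID Sp S; rewrite (setIidPr _); first by move: SSp; clear; lia.
    by apply/subsetP => f; rewrite inE => /andP[].
  have hle : \sum_(p | p \notin K) (2 * #|P|) * #|Np p| <= \sum_(p | p \notin K) #|S|.
    apply: leq_sum => p pK; have := no p; rewrite /= pK /= => /negbT.
    rewrite -ltnNge => /ltnW; apply: leq_trans; rewrite -(mulnA (2 * #|P|)).
    by rewrite leq_mul2l NpS' orbT.
  move: hle; rewrite -big_distrr /= sum_nat_const => hle.
  have hc : #|[pred p | p \notin K]| * #|S| <= #|P| * #|S|.
    by rewrite leq_mul2r max_card orbT.
  have P0 : 0 < #|P| by apply/card_gt0P; exists p0.
  have h1 : 2 * \sum_(p | p \notin K) #|Np p| <= #|S|.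
    by rewrite -(leq_pmul2l P0) mulnA [#|P| * 2]mulnC (leq_trans hle).
  by move: hcov hSSp h1; clear; lia.
have S'E g : g \in S' p -> agree_class (S' p) (p |: K) g = agree_class S (p |: K) g.
  rewrite inE => /andP[gS gc]; apply/setP => h; rewrite !inE.
  case: (boolP (_ == _)) => hg; rewrite ?andbF // !andbT.
  have hgK : restr K h == restr K g.
    by move/restrP: hg => hg; apply/restrP => q qK; rewrite hg // in_setU1 qK orbT.
  by rewrite (agree_class_eq _ hg) (agree_class_eq _ hgK) gc andbT.
have [||g gS'|K' [Q [W' [[KK' KT QS] [NQ WW sp]]]]] :=
  IH (p |: K) (S' p) (2 * #|P| * c * W) _ N0.
- have := cardsC K; have := cardsC (p |: K); rewrite cK cardsU1 pK.
  by move=> h1 h2; move: (etrans h1 (esym h2)); clear; lia.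
- apply: leq_trans NS _; rewrite mulnAC [X in _ <= X]mulnC leq_mul2l Sp' orbT //.
- rewrite S'E //; move: gS'; rewrite inE => /andP[gS gc].
  have := leq_ltn_trans (hS g gS) gc; rewrite /= -/c ltn_mul2l c0 /=.
  exact: ltnW.
exists K', Q, W'; split; split=> //.
- by apply: subset_trans KK'; apply: subsetUr.
- by apply: subset_trans QS _; apply/subsetP => f; rewrite inE => /andP[].
- by apply: leq_trans WW _; rewrite /= leq_maxr.
Qed.

(** Union bound: each of the at most [#|P| * #|X|] pairs of a free position and a forbidden value
    rules out at most a fraction [1 / c] of the class of [f]. *)
Lemma spread_avoid c K S f (X : {set V}) :
  f \in S -> spread c K S f -> #|P| * #|X| < c ->
  exists g, [/\ g \in S, {in K, g =1 f} & forall p, p \notin K -> g p \notin X].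
Proof.
move=> fS /forallP sp Xc.
pose U := \bigcup_(q : P * V | (q.1 \notin K) && (q.2 \in X))
            [set g in agree_class S K f | g q.1 == q.2].
have f_cls : f \in agree_class S K f by rewrite inE fS eqxx.
have cU : c * #|U| <= #|P| * #|X| * #|agree_class S K f|.
  apply: leq_trans (_ : c * \sum_(q : P * V | (q.1 \notin K) && (q.2 \in X)) 
     #|[set g in agree_class S K f | g q.1 == q.2]| <= _).
    by rewrite leq_mul2l card_bigcup_le orbT.
  rewrite big_distrr /=.
  apply: leq_trans (_ : \sum_(q : P * V | (q.1 \notin K) && (q.2 \in X))
     #|agree_class S K f| <= _).
    apply: leq_sum => q /andP[qK _]; have := sp q.1; rewrite qK /= => /forallP.
    exact.
  rewrite sum_nat_const leq_mul2r; apply/orP; right.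
  rewrite -cardsT -cardsX; apply: subset_leq_card.
  by apply/subsetP => q; rewrite !inE => /andP[].
have [g gU] : exists g, g \in agree_class S K f :\: U.
  apply/set0Pn; rewrite -card_gt0 cardsD subn_gt0.
  apply: leq_ltn_trans (subset_leq_card (subsetIr _ _)) _.
  have a0 : 0 < #|agree_class S K f| by apply/card_gt0P; exists f.
  have : c * #|U| < c * #|agree_class S K f|.
    by apply: leq_ltn_trans cU _; rewrite ltn_pmul2r.
  by rewrite ltn_mul2l => /andP[].
move: gU; rewrite inE => /andP[gU]; rewrite inE => /andP[gS gf].
exists g; split=> //; first by apply/restrP.
move=> p pK; apply: contra gU => gX; apply/bigcupP; exists (p, g p) => /=.
  by rewrite pK.
by rewrite !inE gS gf eqxx.
Qed.

End Sunflower.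

(** * Discarding members of a family until every class and every group is large *)

Section Cleaning.
Variables (T X J Y Z : finType) (cl : T -> X) (key : J -> T -> Y) (val : J -> T -> Z).
Implicit Types (Q R : {set T}).

(* Discarding a class that has lost more than half of its members, or a group
   with fewer than [theta] values, preserves the hypothesis on [R]. *)
Lemma cleaning_step Q R theta (m : J -> nat) n :
  #|R| <= n -> R \subset Q ->
  (forall j y z, #|[set f in Q | (key j f == y) && (val j f == z)]| <= m j) ->
  (forall j, 0 < m j) ->
  #|[set f in Q | cl f \in cl @: R]| + 2 * theta * (\sum_j m j * #|key j @: R|)
    < 2 * #|R| ->
  exists R' : {set T}, [/\ R' \subset Q, R' != set0,
    (forall f, f \in R' ->
      #|[set g in Q | cl g == cl f]| <= 2 * #|[set g in R' | cl g == cl f]|) &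
    (forall f j, f \in R' ->
      theta <= #|val j @: [set g in R' | key j g == key j f]|)].
Proof.
elim: n R => [|n IH] R Rn RQ hm m0 hR.
  by move: Rn hR; rewrite leqn0 => /eqP ->; rewrite muln0.
have [f /andP[fR hf]|no1] := pickP [pred f in R |
  2 * #|[set g in R | cl g == cl f]| < #|[set g in Q | cl g == cl f]|].
  set Rf := [set g in R | cl g == cl f] in hf.
  have RfR : Rf \subset R by apply/subsetP => g; rewrite inE => /andP[].
  have Rf0 : 0 < #|Rf| by apply/card_gt0P; exists f; rewrite inE fR eqxx.
  have cR : #|R :\: Rf| = #|R| - #|Rf| by rewrite cardsD (setIidPr RfR).
  have RfleR := subset_leq_card RfR.
  apply: (IH (R :\: Rf)) => //; first by rewrite cR; move: Rn Rf0 RfleR; clear; lia.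
    by apply: subset_trans RQ; apply: subsetDl.
  (* The class leaves as a whole: the first term of the invariant drops by its size in [Q], which
     exceeds twice the number of members lost. *)
  have h1 : #|[set g in Q | cl g \in cl @: (R :\: Rf)]| +
       #|[set g in Q | cl g == cl f]| <= #|[set g in Q | cl g \in cl @: R]|.
    rewrite -cardsUI [X in _ + X](_ : _ = 0); last first.
      apply/eqP; rewrite cards_eq0; apply/eqP/setP => g; rewrite !inE.
      apply/negP => /andP[/andP[gQ /imsetP[h]]]; rewrite !inE => /andP[hf' hR'] E.
      by move=> /andP[_ /eqP E2]; move: hf'; rewrite hR' -E E2 eqxx.
    rewrite addn0; apply: subset_leq_card; apply/subsetP => g; rewrite !inE.
    case/orP => /andP[-> /=]; last by move=> /eqP ->; apply: imset_f.
    by move=> /imsetP[h]; rewrite inE => /andP[_ hR'] ->; apply: imset_f.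
  have h2 : \sum_j m j * #|key j @: (R :\: Rf)| <= \sum_j m j * #|key j @: R|.
    apply: leq_sum => j _; rewrite leq_mul2l; apply/orP; right.
    by apply: subset_leq_card; apply: imsetS; apply: subsetDl.
  rewrite cR; have := leq_mul (leqnn (2 * theta)) h2.
  by move: h1 hf hR RfleR; clear; lia.
have [[f j] /andP[/= fR hf]|no2] := pickP [pred fj : T * J | (fj.1 \in R) &&
  (#|val fj.2 @: [set g in R | key fj.2 g == key fj.2 fj.1]| < theta)].
  set Rf := [set g in R | key j g == key j f] in hf.
  have RfR : Rf \subset R by apply/subsetP => g; rewrite inE => /andP[].
  have Rf0 : 0 < #|Rf| by apply/card_gt0P; exists f; rewrite inE fR eqxx.
  have cR : #|R :\: Rf| = #|R| - #|Rf| by rewrite cardsD (setIidPr RfR).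
  have RfleR := subset_leq_card RfR.
  apply: (IH (R :\: Rf)) => //; first by rewrite cR; move: Rn Rf0 RfleR; clear; lia.
    by apply: subset_trans RQ; apply: subsetDl.
  (* Fewer than [theta] values, each with multiplicity at most [m j]: the loss is paid for by the
     one key that disappears from [key j @: R]. *)
  have hRf : #|Rf| < theta * m j.
    apply: leq_ltn_trans (_ : m j * #|val j @: Rf| < _); last first.
      by rewrite mulnC ltn_pmul2r.
    rewrite -sum1_card (partition_big_imset (val j)) /= mulnC -sum_nat_const.
    apply: leq_sum => z _; rewrite sum1dep_card; apply: leq_trans (hm j (key j f) z).
    apply: subset_leq_card; apply/subsetP => g; rewrite !inE => /andP[/andP[gR ->] ->].
    by rewrite (subsetP RQ).
  have h1 : #|[set g in Q | cl g \in cl @: (R :\: Rf)]| <= #|[set g in Q | cl g \in cl @: R]|.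
    apply: subset_leq_card; apply/subsetP => g; rewrite !inE => /andP[-> /=].
    by move=> /imsetP[h]; rewrite inE => /andP[_ hR'] ->; apply: imset_f.
  have h2 : m j + \sum_i m i * #|key i @: (R :\: Rf)| <= \sum_i m i * #|key i @: R|.
    rewrite (bigD1 j) //= [X in _ <= X](bigD1 j) //= addnA -mulnS; apply: leq_add.
      rewrite leq_mul2l; apply/orP; right.
      apply: proper_card; apply/properP; split; first by apply: imsetS; apply: subsetDl.
      exists (key j f); first exact: imset_f.
      apply/negP => /imsetP[g]; rewrite !inE => /andP[gRf gR] E.
      by move: gRf; rewrite gR E eqxx.
    apply: leq_sum => i _; rewrite leq_mul2l; apply/orP; right.
    by apply: subset_leq_card; apply: imsetS; apply: subsetDl.
  rewrite cR; have := leq_mul (leqnn (2 * theta)) h2; rewrite mulnDr -mulnA.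
  by move: h1 hRf hR RfleR; clear; lia.
exists R; split=> //.
- by apply/eqP => R0; move: hR; rewrite R0 cards0.
- by move=> f fR; have := no1 f; rewrite /= fR /= => /negbT; rewrite -leqNgt.
- by move=> f j fR; have := no2 (f, j); rewrite /= fR /= => /negbT; rewrite -leqNgt.
Qed.

(** At [R = Q] the invariant of the step asks only that [Q] outweigh, with a factor 2, what all
    groups could ever lose: [a j] groups, each with fewer than [theta] values of multiplicity at
    most [m j]. *)
Lemma cleaning Q theta (m a : J -> nat) :
  (forall j, #|key j @: Q| <= a j) ->
  (forall j y z, #|[set f in Q | (key j f == y) && (val j f == z)]| <= m j) ->
  (forall j, 0 < m j) -> 2 * theta * (\sum_j m j * a j) < #|Q| ->
  exists R : {set T}, [/\ R \subset Q, R != set0,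
    (forall f, f \in R ->
      #|[set g in Q | cl g == cl f]| <= 2 * #|[set g in R | cl g == cl f]|) &
    (forall f j, f \in R ->
      theta <= #|val j @: [set g in R | key j g == key j f]|)].
Proof.
move=> ha hm m0 hQ; apply: (cleaning_step (leqnn #|Q|)) => //.
have h1 : 2 * theta * (\sum_j m j * #|key j @: Q|) < #|Q|.
  apply: leq_ltn_trans hQ; rewrite leq_mul2l; apply/orP; right.
  by apply: leq_sum => j _; rewrite leq_mul2l ha orbT.
have h2 : #|[set f in Q | cl f \in cl @: Q]| <= #|Q|.
  by apply: subset_leq_card; apply/subsetP => f; rewrite inE => /andP[].
by have := leq_add h2 h1; rewrite addnS addnn -mul2n.
Qed.

End Cleaning.

(** * Embeddings of trees in almost regular graphs *)

Lemma card_dep_pairs (T U : finType) (S : {set T}) (F : T -> {set U}) :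
  #|[set x : T * U | (x.1 \in S) && (x.2 \in F x.1)]| = \sum_(t in S) #|F t|.
Proof.
rewrite -sum1dep_card -(pair_big_dep (fun t => t \in S) (fun t u => u \in F t)
  (fun _ _ => 1)) /=.
by apply: eq_bigr => t _; rewrite sum1_card.
Qed.

Section TreeEmbeddings.
Variables (V P : finType) (e conf : rel V) (A : {set V}).
Variables (root : P) (par : P -> P) (dep : P -> nat).
Hypothesis dep_par : forall p, p != root -> dep (par p) < dep p.
Hypotheses (e_sym : symmetric e) (conf_sym : symmetric conf).

Definition nbhd x := [set y in A | e x y].

Variables (d D s0 : nat).
Hypothesis nbhd_ge : forall x, x \in A -> d <= #|nbhd x|.
Hypothesis nbhd_le : forall x, x \in A -> #|nbhd x| <= D.
Hypothesis conf_le : forall y z, y \in A -> #|[set w in nbhd y | conf w z]| <= s0.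

Definition emb (E : {set P}) (f : {ffun P -> V}) :=
  [&& [forall p in E, f p \in A],
      [forall p in E, ((p != root) && (par p \in E)) ==> e (f (par p)) (f p)] &
      [forall p in E, forall q in E, (p != q) ==> ~~ conf (f p) (f q)]].

(** The default value [v0] outside [E] gives each partial embedding exactly one total
    representative, so that cardinals count embeddings of [E]. *)
Definition embs E v0 :=
  [set f | emb E f && [forall p in ~: E, f p == v0]].

Lemma max_dep_in (E : {set P}) p0 : p0 \in E ->
  exists2 p, p \in E & forall q, q \in E -> dep q <= dep p.
Proof. by move=> Ep0; case: (arg_maxnP dep Ep0) => p pE hp; exists p. Qed.

Lemma min_dep_in (E : {set P}) p0 : p0 \in E ->
  exists2 p, p \in E & forall q, q \in E -> dep p <= dep q.
Proof. by move=> Ep0; case: (arg_minnP dep Ep0) => p pE hp; exists p. Qed.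

(** Remove a deepest position: no other position has it as parent, so it is a leaf of the tree. Its
    parent has at least [d] neighbours in [A], and each vertex already placed excludes at most [s0]
    of them by conflict. *)
Lemma embs_count v0 n (E : {set P}) :
  #|E| = n.+1 -> root \in E ->
  (forall p, p \in E -> p != root -> par p \in E) ->
  #|A| * (d - #|P| * s0) ^ n <= #|embs E v0|.
Proof.
elim: n E => [|n IH] E cE rE clE.
  rewrite expn0 muln1.
  have -> : E = [set root].
    by apply/esym/eqP; rewrite eqEcard sub1set rE cE cards1.
  rewrite -(card_imset (mem A) (f := fun a => [ffun p => if p == root then a else v0])).
    apply: subset_leq_card; apply/subsetP => _ /imsetP[a aA ->].
    rewrite inE; apply/andP; split; last first.
      by apply/forall_inP => p; rewrite !inE ffunE => /negPf ->.
    apply/and3P; split.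
    - by apply/forallP => p; apply/implyP; rewrite inE ffunE => ->.
    - apply/forallP => p; apply/implyP; rewrite inE => /eqP ->.
      by rewrite eqxx.
    - apply/forallP => p; apply/implyP; rewrite inE => /eqP ->.
      by apply/forallP => q; apply/implyP; rewrite inE => /eqP ->; rewrite eqxx.
  by move=> a b /ffunP/(_ root); rewrite !ffunE eqxx.
have [p1 p1E] : exists p, p \in E :\ root.
  apply/set0Pn; rewrite -card_gt0; have := cardsD1 root E; rewrite rE cE.
  by case: #|_|.
have [p pE hp] := max_dep_in p1E; move: pE; rewrite !inE => /andP[pr pE].
pose E' := E :\ p.
have cE' : #|E'| = n.+1 by have := cardsD1 p E; rewrite pE cE => -[].
have rE' : root \in E' by rewrite !inE rE eq_sym pr.
have clE' q : q \in E' -> q != root -> par q \in E'.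
  rewrite !inE => /andP[qp qE] qr; rewrite clE // andbT.
  apply/eqP => E1; have := dep_par qr; have := hp q; rewrite !inE qr qE E1 => /(_ isT).
  by rewrite leqNgt => /negbTE ->.
have parE' : par p \in E'.
  rewrite !inE clE // andbT; apply/eqP => E1; have := dep_par pr.
  by rewrite E1 ltnn.
pose good f := [set w in nbhd (f (par p)) | [forall q in E', ~~ conf w (f q)]].
pose phi (x : {ffun P -> V} * V) : {ffun P -> V} :=
  [ffun q => if q == p then x.2 else x.1 q].
pose Zs := [set x : {ffun P -> V} * V | (x.1 \in embs E' v0) && (x.2 \in good x.1)].
have goodge f : f \in embs E' v0 -> d - #|P| * s0 <= #|good f|.
  rewrite inE => /andP[/and3P[/forall_inP fA _ _] _].
  have := cardsID (good f) (nbhd (f (par p))).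
  have -> : nbhd (f (par p)) :&: good f = good f.
    by apply/setIidPr; apply/subsetP => w; rewrite inE => /andP[].
  have := nbhd_ge (fA _ parE').
  suff : #|nbhd (f (par p)) :\: good f| <= #|P| * s0 by lia.
  apply: leq_trans (_ : \sum_(q in E') #|[set w in nbhd (f (par p)) | conf w (f q)]| <= _).
    apply: leq_trans (card_bigcup_le _ _); apply: subset_leq_card.
    apply/subsetP => w; rewrite !inE => /andP[+ /andP[wA ew]].
    rewrite wA ew /= negb_forall => /existsP[q]; rewrite negb_imply negbK.
    move=> /andP[qE' cw]; apply/bigcupP; exists q => //.
    by rewrite !inE wA ew.
  apply: leq_trans (_ : \sum_(q in E') s0 <= _).
    by apply: leq_sum => q _; apply: conf_le; apply: fA.
  by rewrite sum_nat_const leq_mul2r max_card orbT.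
have cZ : #|A| * (d - #|P| * s0) ^ n.+1 <= #|Zs|.
  rewrite (card_dep_pairs (embs E' v0) good) expnSr mulnA.
  apply: leq_trans (_ : \sum_(f in embs E' v0) (d - #|P| * s0) <= _); last exact: leq_sum.
  by rewrite sum_nat_const leq_mul2r IH ?orbT.
apply: leq_trans cZ _; rewrite -(card_in_imset (f := phi)); last first.
  move=> [f w] [g z]; rewrite inE /= => /andP[]; rewrite inE => /andP[_ /forall_inP hf] _.
  rewrite inE /= => /andP[]; rewrite inE => /andP[_ /forall_inP hg] _ /ffunP E1.
  have wz : w = z by have := E1 p; rewrite !ffunE eqxx.
  rewrite wz; congr pair; apply/ffunP => q; have := E1 q; rewrite !ffunE.
  case: eqP => // -> _.
  by rewrite (eqP (hf p _)) ?(eqP (hg p _)) // !inE eqxx.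
apply: subset_leq_card; apply/subsetP => x /imsetP[[f w]]; rewrite inE /= => /andP[].
rewrite inE => /andP[/and3P[/forall_inP fA /forall_inP fe /forall_inP fc] /forall_inP fv].
rewrite inE => /andP[]; rewrite inE => /andP[wA ew] /forall_inP wc ->.
have inE' q : q \in E -> q != p -> q \in E' by rewrite !inE => -> ->.
rewrite inE; apply/andP; split; last first.
  apply/forall_inP => q qE; rewrite ffunE /=; have [Eq|_] := eqVneq q p.
    by move: qE; rewrite Eq inE pE.
  by apply: fv; move: qE; rewrite !inE => /negPf ->; rewrite andbF.
apply/and3P; split.
- by apply/forall_inP => q qE; rewrite ffunE /=; have [//|qp] := eqVneq q p; apply/fA/inE'.
- apply/forall_inP => q qE; apply/implyP => /andP[qr _]; rewrite !ffunE /=.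
  have [Eq|qp] := eqVneq q p.
    by rewrite Eq; case: eqP => // E2; move: parE'; rewrite E2 !inE eqxx.
  have q' := inE' q qE qp; have pq' := clE' q q' qr.
  rewrite ifN; last by move: pq'; rewrite !inE => /andP[].
  by apply: (implyP (fe q q')); rewrite qr.
- apply/forall_inP => q qE; apply/forall_inP => r rE1; apply/implyP => qr.
  rewrite !ffunE /=; have [Eq|qp] := eqVneq q p; have [Er|rp] := eqVneq r p.
  + by move: qr; rewrite Eq Er eqxx.
  + exact/wc/inE'.
  + by rewrite conf_sym; exact/wc/inE'.
  + by apply: (implyP (forall_inP (fc q (inE' q qE qp)) r _)) => //; apply: inE'.
Qed.

Lemma frontier (E : {set P}) : E != set0 -> E != setT ->
  exists p q, [/\ p \notin E, q \in E &
    (p != root) && (par p == q) || (q != root) && (par q == p)].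
Proof.
move=> E0 ET; have [rE|rE] := boolP (root \in E).
  have [p0 p0E] : exists p, p \in ~: E.
    by apply/set0Pn; apply: contra ET => /eqP h; rewrite -[E]setCK h setC0.
  have [p pE hp] := min_dep_in p0E; move: pE; rewrite inE => pE.
  have pr : p != root by apply: contraNneq pE => ->.
  exists p, (par p); split=> //; last by rewrite pr eqxx.
  by apply: contraT => h; have := hp (par p); rewrite inE leqNgt dep_par // => /(_ h).
have /set0Pn[p0 p0E] := E0; have [p pE hp] := min_dep_in p0E.
have pr : p != root by apply: contraNneq rE => <-.
exists (par p), p; split=> //; last by rewrite pr eqxx orbT.
by apply/negP => h; have := hp _ h; rewrite leqNgt dep_par.
Qed.

Lemma emb_nbhd f p q : emb setT f ->
  (p != root) && (par p == q) || (q != root) && (par q == p) -> f p \in nbhd (f q).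
Proof.
move=> /and3P[/forall_inP fA /forall_inP fe _]; rewrite inE fA ?inE //=.
case/orP => /andP[pr /eqP <-].
  by apply: (implyP (fe _ (in_setT p))); rewrite pr inE.
by rewrite e_sym; apply: (implyP (fe _ (in_setT q))); rewrite pr inE.
Qed.

(** By connectivity of the tree there is always a position outside [E] adjacent to one inside, and
    it has at most [D] possible images. [E] itself may be disconnected. *)
Lemma ext_count (E : {set P}) (g : {ffun P -> V}) : E != set0 ->
  #|[set f | emb setT f & restr E f == restr E g]| <= D ^ #|~: E|.
Proof.
move En: #|~: E| => n; elim: n E En g => [|n IH] E En g E0.
  have /setP hE : ~: E = set0 by apply: cards0_eq.
  apply/card_le1_eqP => f h; rewrite !inE => /andP[_ /restrP fg] /andP[_ /restrP hg].
  by apply/ffunP => p; have := hE p; rewrite !inE => /negbFE pE; rewrite fg // hg.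
have ET : E != setT.
  by apply/eqP => ET; move: En; rewrite ET setCT cards0.
have [p [q [pE qE pq]]] := frontier E0 ET.
pose g' w : {ffun P -> V} := [ffun r => if r == p then w else g r].
have [gA|gA] := boolP (g q \in A); last first.
  rewrite (_ : [set f | _ & _] = set0) ?cards0 //; apply/setP => f; rewrite !inE.
  apply/negP => /andP[/and3P[/forall_inP fA _ _] /restrP fg].
  by move: gA; rewrite -fg // fA ?inE.
apply: leq_trans (_ : \sum_(w in nbhd (g q))
   #|[set f | emb setT f & restr (p |: E) f == restr (p |: E) (g' w)]| <= _).
  apply: leq_trans (card_bigcup_le _ _); apply: subset_leq_card.
  apply/subsetP => f; rewrite inE => /andP[femb /restrP fg].
  apply/bigcupP; exists (f p); first by rewrite -fg //; apply: emb_nbhd.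
  rewrite inE femb /=; apply/restrP => r; rewrite !inE ffunE.
  by case: eqP => [->|_] //=; apply: fg.
rewrite expnS; apply: leq_trans (_ : \sum_(w in nbhd (g q)) D ^ n <= _).
  apply: leq_sum => w _; apply: IH; last by apply/set0Pn; exists p; rewrite setU11.
  have := cardsC E; have := cardsC (p |: E); rewrite En cardsU1 pE => <-.
  by clear; lia.
by rewrite sum_nat_const leq_mul2r nbhd_le ?orbT.
Qed.

(** A subtree with topmost position [r], which may differ from the root of the whole tree; then [r]
    has at most [#|A|] images and every further position at most [D]. *)
Definition rooted_at (r : P) (E : {set P}) :=
  r \in E /\ forall p, p \in E -> p != r -> p != root /\ par p \in E.

Lemma restr_count r n (E : {set P}) (S : {set {ffun P -> V}}) :
  #|E| = n.+1 -> rooted_at r E -> (forall f, f \in S -> emb setT f) ->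
  #|restr E @: S| <= #|A| * D ^ n.
Proof.
elim: n E => [|n IH] E cE [rE clE] hS.
  have -> : E = [set r].
    by apply/esym/eqP; rewrite eqEcard sub1set rE cE cards1.
  rewrite muln1.
  apply: leq_trans (leq_imset_card (fun a => [ffun p => if p == r then Some a else None]) _).
  apply: subset_leq_card; apply/subsetP => _ /imsetP[f fS ->].
  have /and3P[/forall_inP fA _ _] := hS f fS.
  apply/imsetP; exists (f r); first by apply: fA; rewrite inE.
  by apply/ffunP => p; rewrite !ffunE inE; case: eqP => // ->.
have [p1 p1E] : exists p, p \in E :\ r.
  apply/set0Pn; rewrite -card_gt0; have := cardsD1 r E; rewrite rE cE.
  by case: #|_|.
have [p pE hp] := max_dep_in p1E; move: pE; rewrite !inE => /andP[pr pE].
have [pro parE] := clE p pE pr.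
have parp : par p != p by apply: contraTneq (dep_par pro) => ->; rewrite ltnn.
have cE' : #|E :\ p| = n.+1 by have := cardsD1 p E; rewrite pE cE => -[].
have rE' : rooted_at r (E :\ p).
  split; first by rewrite !inE rE eq_sym pr.
  move=> q; rewrite !inE => /andP[qp qE] qr; have [qro pq] := clE q qE qr.
  rewrite qro pq andbT; split=> //; apply/eqP => E1; have := dep_par qro.
  by rewrite E1 ltnNge hp // !inE qr.
pose F (x : {ffun P -> option V}) := if x (par p) is Some y then
  if y \in A then nbhd y else set0 else set0.
pose phi (x : {ffun P -> option V} * V) : {ffun P -> option V} :=
  [ffun q => if q == p then Some x.2 else x.1 q].
pose Zs := [set x : {ffun P -> option V} * V |
  (x.1 \in restr (E :\ p) @: S) && (x.2 \in F x.1)].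
apply: leq_trans (_ : #|phi @: Zs| <= _).
  apply: subset_leq_card; apply/subsetP => _ /imsetP[f fS ->].
  have femb := hS f fS; have /and3P[/forall_inP fA _ _] := femb.
  apply/imsetP; exists (restr (E :\ p) f, f p); last first.
    apply/ffunP => q; rewrite !ffunE !inE.
    by case: eqP => // ->; rewrite pE.
  rewrite inE /= imset_f //= /F ffunE in_setD1 parp parE /= (fA (par p) (in_setT _)).
  by apply: emb_nbhd; rewrite // pro eqxx.
apply: leq_trans (leq_imset_card _ _) _.
rewrite (card_dep_pairs (restr (E :\ p) @: S) F) expnSr mulnA.
apply: leq_trans (_ : \sum_(x in restr (E :\ p) @: S) D <= _).
  apply: leq_sum => x _; rewrite /F; case: (x _) => [y|]; last by rewrite cards0.
  by case: ifP => yA; rewrite ?cards0 // nbhd_le.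
by rewrite sum_nat_const leq_mul2r IH ?orbT.
Qed.

End TreeEmbeddings.

(** * Spiders from paths *)

(* Whatever bounded set is to be avoided, there is a vertex joined to the three
   vertices [u i] by internally disjoint paths with [k] edges. *)
Definition spider_rich (V : finType) (e : rel V) (k Q : nat) (u : 'I_3 -> V) :=
  forall X : {set V}, #|X| <= Q -> exists v (w : 'I_3 -> seq V),
    [/\ forall i, size (w i) = k.-1,
        forall i, path e (u i) (rcons (w i) v),
        forall i, uniq (rcons (w i) v),
        forall i j x, i != j -> x \in w i -> x \notin w j &
        forall i x, x \in rcons (w i) v -> x \notin X /\ forall j, x != u j].

Lemma cardsU_le (T : finType) (A B : {set T}) : #|A :|: B| <= #|A| + #|B|.
Proof. by case: (leq_card_setU A B). Qed.

Lemma pick_avoid (T : finType) (S Y : {set T}) :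
  #|Y| < #|S| -> exists2 x, x \in S & x \notin Y.
Proof.
move=> YS; have /set0Pn[x] : S :\: Y != set0.
  rewrite -card_gt0 cardsD subn_gt0.
  exact: leq_ltn_trans (subset_leq_card (subsetIr _ _)) YS.
by rewrite inE => /andP[xY xS]; exists x.
Qed.

Lemma card_set_of_seq_le (T : finType) (s : seq T) : #|[set x in s]| <= size s.
Proof. by rewrite cardsE; apply: card_size. Qed.

Lemma path_rev_sym (T : eqType) (e : rel T) x p y : symmetric e ->
  path e x (rcons p y) -> path e y (rcons (rev p) x).
Proof.
move=> e_sym; have := rev_path e x (rcons p y); rewrite last_rcons belast_rcons rev_cons => ->.
by rewrite (eq_path (e' := e)) // => a b; rewrite e_sym.
Qed.

Lemma three_avoiding (T : finType) (Pr : 'I_3 -> seq T -> Prop) (k Q : nat) (X : {set T}) :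
  (forall i (Y : {set T}), #|Y| <= Q + 2 * k ->
     exists p, [/\ Pr i p, size p <= k & forall x, x \in p -> x \notin Y]) ->
  #|X| <= Q -> exists w : 'I_3 -> seq T,
    [/\ forall i, Pr i (w i), forall i x, x \in w i -> x \notin X &
        forall i j x, i != j -> x \in w i -> x \notin w j].
Proof.
move=> h XQ; pose o1 : 'I_3 := inord 1; pose o2 : 'I_3 := inord 2.
have [p0 [P0 s0 a0]] := h ord0 X (leq_trans XQ (leq_addr _ _)).
have c0 := card_set_of_seq_le p0.
have [|p1 [P1 s1 a1]] := h o1 (X :|: [set x in p0]).
  by apply: leq_trans (cardsU_le _ _) _; lia.
have c1 := card_set_of_seq_le p1.
have [|p2 [P2 s2 a2]] := h o2 (X :|: [set x in p0] :|: [set x in p1]).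
  apply: leq_trans (cardsU_le _ _) _.
  by have := cardsU_le X [set x in p0]; lia.
have n0 x : x \in p1 -> x \notin p0.
  by move/a1; rewrite !inE negb_or => /andP[].
have n1 x : x \in p2 -> (x \notin p0) && (x \notin p1).
  by move/a2; rewrite !inE !negb_or -andbA => /and3P[_ -> ->].
exists (fun i : 'I_3 => nth [::] [:: p0; p1; p2] i); split.
- case=> [[|[|[|//]]] hi] /=.
  + by rewrite (_ : Ordinal hi = ord0) //; apply: val_inj.
  + by rewrite (_ : Ordinal hi = o1) //; apply: val_inj; rewrite /= inordK.
  + by rewrite (_ : Ordinal hi = o2) //; apply: val_inj; rewrite /= inordK.
- case=> [[|[|[|//]]] hi] /= x; first exact: a0.
  + by move/a1; rewrite !inE negb_or => /andP[].
  + by move/a2; rewrite !inE !negb_or -andbA => /and3P[].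
- case=> [[|[|[|//]]] hi]; case=> [[|[|[|//]]] hj] x //= _.
  + by apply: contraTN => /n0.
  + by apply: contraTN => /n1 /andP[].
  + by move=> /n0.
  + by apply: contraTN => /n1 /andP[].
  + by move=> /n1 /andP[].
  + by move=> /n1 /andP[].
Qed.

(** * Three leaves from a flexible family of paths *)

Section PathCase.
Variables (V : finType) (e conf : rel V) (A : {set V}).
Hypotheses (e_sym : symmetric e) (conf_sym : symmetric conf) (conf_refl : reflexive conf).
Variables (D s0 : nat).
Hypothesis nbhd_le : forall x, x \in A -> #|nbhd e A x| <= D.
Hypothesis conf_le : forall y z, y \in A -> #|[set w in nbhd e A y | conf w z]| <= s0.

(** The centre is chosen in [C] outside [X] and the three leaves, which explains [Q + 3]; the legs
    are then chosen one after the other, each avoiding the earlier ones. They come from the centre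
    outwards and are reversed. *)
Lemma legs_spider_rich k Q u (C : {set V}) : 0 < k ->
  #|C| > Q + 3 ->
  (forall v i (X : {set V}), v \in C -> #|X| <= Q + 4 + 2 * k ->
     exists p, [/\ size p = k.-1, path e v (rcons p (u i)),
                   uniq (v :: rcons p (u i)) & forall x, x \in p -> x \notin X]) ->
  spider_rich e k Q u.
Proof.
move=> k0 hC hp X XQ; pose U := [set u i | i : 'I_3].
have cU : #|U| <= 3 by apply: leq_trans (leq_imset_card _ _) _; rewrite card_ord.
have [|v vC vX] := pick_avoid (Y := X :|: U) (S := C).
  by apply: leq_ltn_trans (cardsU_le _ _) _; lia.
pose Pr i p := [/\ size p = k.-1, path e v (rcons p (u i)) & uniq (v :: rcons p (u i))].
have [i Y hY||w [hw wX wd]] := three_avoiding (Pr := Pr) (k := k) (Q := Q + 4)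
   (X := v |: (X :|: U)).
- have [p [sp pp up aX]] := hp v i Y vC hY; exists p; split=> //.
  by rewrite sp leq_pred.
- rewrite cardsU1; have := cardsU_le X U; case: (_ \notin _); lia.
exists v, (fun i => rev (w i)); split.
- by move=> i; rewrite size_rev; case: (hw i).
- by move=> i; apply: path_rev_sym => //; case: (hw i).
- move=> i; rewrite rcons_uniq mem_rev rev_uniq; have [_ _ /=] := hw i.
  by rewrite mem_rcons inE negb_or rcons_uniq => /andP[/andP[_ ->] /andP[_ ->]].
- by move=> i j x; rewrite !mem_rev; apply: wd.
- move=> i x; rewrite mem_rcons inE mem_rev => /orP[/eqP ->|/wX].
    move: vX; rewrite !inE negb_or => /andP[vX vU]; split=> // j.
    by apply: contraNneq vU => ->; apply: imset_f.
  rewrite !inE !negb_or => /and3P[_ xX xU]; split=> // j.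
  by apply: contraNneq xU => ->; apply: imset_f.
Qed.

(** Averaging, repeated [s] times. The vertices already chosen exclude by conflict at most [s * s0]
    candidates, at most half of [theta], so each surviving [v] keeps [theta / 2] of the at most [D]
    elements of [As], and some [w] retains a fraction [1 / c] of the survivors. *)
Lemma common_neighbours (W : V -> V -> bool) (As B : {set V}) (theta c s : nat) :
  #|As| <= D -> (forall z, #|[set w in As | conf w z]| <= s0) ->
  (forall v, v \in B -> theta <= #|[set w in As | W w v]|) ->
  2 * (s * s0) <= theta -> 2 * D <= c * theta -> 0 < D -> 0 < #|B| ->
  exists ws : seq V, [/\ size ws = s, pairwise (fun a b => ~~ conf a b) ws,
    {subset ws <= As} & #|B| <= c ^ s * #|[set v in B | all (W^~ v) ws]|].
Proof.
move=> AsD hconf hW; elim: s => [|s IH] hs hc D0 B0.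
  exists [::]; split=> //; rewrite expn0 mul1n; apply: subset_leq_card.
  by apply/subsetP => v vB; rewrite inE vB.
have [|ws [sws pws wsA hB]] := IH _ hc D0 B0; first by lia.
set B1 := [set v in B | _] in hB.
pose ok := [set w in As | all (fun a => ~~ conf w a) ws].
have okge v : v \in B1 -> theta <= 2 * #|[set w in ok | W w v]|.
  rewrite inE => /andP[vB _]; have := hW v vB.
  have : #|[set w in As | W w v]| <= #|[set w in ok | W w v]| + s * s0.
    apply: leq_trans (_ : #|[set w in ok | W w v] :|: 
        \bigcup_(a in [set a in ws]) [set w in As | conf w a]| <= _).
      apply: subset_leq_card; apply/subsetP => w; rewrite !inE => /andP[wA Wv].
      rewrite wA Wv !andbT /=; case: allP => //= /allP; rewrite -has_predC.
      move=> /hasP[a aws /=]; rewrite negbK => cwa.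
      by apply/bigcupP; exists a; rewrite !inE ?wA.
    apply: leq_trans (cardsU_le _ _) _; rewrite leq_add2l.
    apply: leq_trans (card_bigcup_le _ _) _.
    apply: leq_trans (_ : \sum_(a in [set a in ws]) s0 <= _); first exact: leq_sum.
    by rewrite sum_nat_const leq_mul2r -[X in _ <= X]sws card_set_of_seq_le orbT.
  by lia.
have B10 : 0 < #|B1|.
  by rewrite lt0n; apply: contraTneq hB => ->; rewrite muln0 -ltnNge.
have [w wok hw] : exists2 w, w \in ok & #|B1| <= c * #|[set v in B1 | W w v]|.
  have [w /andP[wok hw]|no] :=
    pickP [pred w in ok | #|B1| <= c * #|[set v in B1 | W w v]|]; first by exists w.
  exfalso.
  have h1 : \sum_(w in ok) #|[set v in B1 | W w v]| = \sum_(v in B1) #|[set w in ok | W w v]|.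
    under eq_bigr => w _ do rewrite -sum1dep_card.
    under [RHS]eq_bigr => v _ do rewrite -sum1dep_card.
    by rewrite !pair_big_dep /= (reindex_inj (h := fun x => (x.2, x.1))) /=;
      [apply: eq_bigl => -[a b] /=; rewrite andbCA | case=> a b [a' b'] [-> ->]].
  have h2 : theta * #|B1| <= 2 * \sum_(w in ok) #|[set v in B1 | W w v]|.
    rewrite h1 mulnC -sum_nat_const big_distrr /=; exact: leq_sum.
  have h3 : c * (\sum_(w in ok) #|[set v in B1 | W w v]|) <= \sum_(w in ok) #|B1|.-1.
    rewrite big_distrr /=; apply: leq_sum => w wok; have := no w.
    by rewrite inE wok /= => /negbT; rewrite -ltnNge; case: #|B1|.
  have h4 : #|ok| <= D.
    by apply: leq_trans AsD; apply: subset_leq_card; apply/subsetP => w; rewrite inE => /andP[].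
  move: h3; rewrite sum_nat_const => h3.
  have h5 := leq_mul (leqnn c) h2.
  have h6 := leq_mul h4 (leqnn #|B1|.-1).
  have h7 := leq_mul hc (leqnn #|B1|).
  have h8 : D * #|B1|.-1 < D * #|B1| by rewrite ltn_pmul2l // ltn_predL.
  by move: h3 h5 h6 h7 h8; clear; nia.
exists (w :: ws); split=> /=.
- by rewrite sws.
- by rewrite pws andbT; move: wok; rewrite inE => /andP[].
- by move=> x; rewrite inE => /orP[/eqP ->|/wsA //]; move: wok; rewrite inE => /andP[].
- apply: leq_trans hB _; rewrite expnSr -mulnA leq_mul2l; apply/orP; right.
  apply: leq_trans hw _; rewrite leq_mul2l; apply/orP; right.
  apply: subset_leq_card; apply/subsetP => v; rewrite !inE => /andP[/andP[-> ->] ->].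
  by [].
Qed.

Variables (ell Qn theta : nat) (Pf : V -> seq V -> V -> bool).
Hypothesis ell_gt1 : 1 < ell.
Hypothesis Pf_path : forall w m v, Pf w m v ->
  [/\ size m = ell.-1, path e w (rcons m v), uniq (w :: rcons m v) &
      forall x, x \in w :: rcons m v -> x \in A].
Hypothesis Pf_avoid : forall w m v (X : {set V}), Pf w m v -> #|X| <= Qn ->
  exists2 m', Pf w m' v & forall x, x \in m' -> x \notin X.
Hypothesis Pf_last : forall w m v, Pf w m v -> theta <= #|[set v' | Pf w m v']|.
Hypothesis Pf_first : forall w m v, Pf w m v -> theta <= #|[set w' | Pf w' m v]|.

Lemma Pf_rcons w m v : Pf w m v -> exists m0 y, m = rcons m0 y.
Proof.
move=> /Pf_path[sm _ _ _]; case: (lastP m) sm => [|m0 y _]; last by exists m0, y.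
by case: ell ell_gt1 => [|[]].
Qed.

(** A bounce adds two edges: reroute the path, step from its end [v] to the last inner vertex [y],
    and leave [y] towards another end [v'] of the same path. The vertices [v] and [y] become
    forbidden for the rest. *)
Lemma even_path n w m v (X : {set V}) : Pf w m v ->
  #|X| + 3 * n + 3 <= Qn -> #|X| + 3 * n + 3 <= theta ->
  exists p, [/\ size p = ell.-1 + 2 * n, path e v (rcons p w),
                uniq (v :: rcons p w) & forall x, x \in p -> x \notin X].
Proof.
elim: n m v X => [|n IH] m v X Pm hQ ht.
  have [|m' Pm' aX] := Pf_avoid (X := X) Pm; first by lia.
  have [sm pm um _] := Pf_path Pm'.
  exists (rev m'); split.
  - by rewrite size_rev sm muln0 addn0.
  - exact: path_rev_sym.
  - move: um; rewrite /= !rcons_uniq !mem_rcons !inE !mem_rev rev_uniq !negb_or eq_sym.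
    by move=> /andP[/andP[-> ->] /andP[-> ->]].
  - by move=> x; rewrite mem_rev; apply: aX.
have [|m' Pm' aX] := Pf_avoid (X := v |: X) Pm; first by rewrite cardsU1; case: (_ \notin _); lia.
have [m0 [y Em]] := Pf_rcons Pm'.
have [|v' Pv' av'] := @pick_avoid _ [set v' | Pf w m' v'] (v |: X).
  by apply: leq_trans (Pf_last Pm'); rewrite cardsU1; case: (_ \notin _); lia.
rewrite inE in Pv'.
have c2 : #|v |: (y |: X)| <= #|X| + 2.
  by rewrite cardsU1 cardsU1; case: (_ \notin _); case: (_ \notin _); lia.
have [||p [sp pp up pX]] := IH m' v' (v |: (y |: X)) Pv'; [by lia|by lia|].
have [_ pm um _] := Pf_path Pm'; have [_ pv' uv' _] := Pf_path Pv'.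
have ym' : y \in m' by rewrite Em mem_rcons inE eqxx.
have e1 : e y v by move: pm; rewrite Em !rcons_path !last_rcons => /andP[_ ->].
have e2 : e y v' by move: pv'; rewrite Em !rcons_path !last_rcons => /andP[_ ->].
move: um uv'; rewrite /= !rcons_uniq !mem_rcons !inE !negb_or.
move=> /andP[/andP[wv wm'] /andP[vm' _]] /andP[/andP[wv' _] /andP[v'm' _]].
have := aX y ym'; rewrite !inE negb_or => /andP[yv yX].
move: av'; rewrite !inE negb_or => /andP[v'v v'X].
have pXE x : x \in p -> [/\ x != v, x != y & x \notin X].
  by move=> /pX; rewrite !inE !negb_or => /and3P.
exists [:: y, v' & p]; split.
- by rewrite /= sp; clear; lia.
- by rewrite /= e_sym e1 e2.
- rewrite /= in up *; rewrite up andbT !inE !negb_or !mem_rcons !inE !negb_or.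
  rewrite [v == y]eq_sym yv [v == v']eq_sym v'v [v == w]eq_sym wv /=.
  have -> /= : v \notin p by apply/negP => /pXE[]; rewrite eqxx.
  have -> /= : y \notin p by apply/negP => /pXE[_]; rewrite eqxx.
  rewrite andbT; apply/andP; split.
    by apply: contraNneq v'm' => <-.
  by apply: contraNneq wm' => <-.
- by move=> x; rewrite !inE => /or3P[/eqP ->|/eqP ->|/pXE[]].
Qed.

(** Starting at the last inner vertex instead of at the end adds one edge and so changes the
    parity. *)
Lemma odd_path n w m y v (X : {set V}) : Pf w (rcons m y) v ->
  #|X| + 3 * n + 4 <= Qn -> #|X| + 3 * n + 4 <= theta ->
  exists p, [/\ size p = ell + 2 * n, path e y (rcons p w),
                uniq (y :: rcons p w) & forall x, x \in p -> x \notin X].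
Proof.
move=> Pm hQ ht.
have [|v' Pv' av'] := @pick_avoid _ [set v' | Pf w (rcons m y) v'] X.
  by apply: leq_trans (Pf_last Pm); lia.
rewrite inE in Pv'.
have [||p [sp pp up pX]] := even_path (n := n) (X := y |: X) Pv'.
- by rewrite cardsU1; case: (_ \notin _); lia.
- by rewrite cardsU1; case: (_ \notin _); lia.
have [_ pv' uv' _] := Pf_path Pv'.
have e2 : e y v' by move: pv'; rewrite !rcons_path !last_rcons => /andP[_ ->].
have pXE x : x \in p -> x != y /\ x \notin X.
  by move=> /pX; rewrite !inE !negb_or => /andP.
exists (v' :: p); split.
- by rewrite /= sp; move: ell_gt1; clear; lia.
- by rewrite /= e2.
- rewrite /= in up *; rewrite up andbT !inE !mem_rcons !inE !negb_or.
  have -> /= : y \notin p by apply/negP => /pXE[]; rewrite eqxx.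
  move: uv'; rewrite /= !rcons_uniq !(mem_rcons, inE) !negb_or.
  move=> /andP[/and3P[_ wy _] /andP[/andP[v'y _] _]].
  by rewrite [y == v']eq_sym v'y [y == w]eq_sym wy.
- by move=> x; rewrite !inE => /orP[/eqP ->|/pXE[]].
Qed.


(** All partners lie in the neighbourhood of the single vertex [o], of size at most [D], so three of
    them are shared by a fraction [1 / c ^ 3] of [B]. Those three become the leaves and the members
    of [B] sharing them the possible centres. *)
Lemma dense_case k Q c (W : V -> V -> bool) (B : {set V}) o : 0 < k -> o \in A ->
  (forall v, v \in B -> theta <= #|[set w in nbhd e A o | W w v]|) ->
  theta <= #|B| -> 2 * (3 * s0) <= theta -> 2 * D <= c * theta -> 0 < theta ->
  c ^ 3 * (Q + 4) <= theta ->
  (forall w v (X : {set V}), W w v -> #|X| <= Q + 4 + 2 * k ->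
     exists p, [/\ size p = k.-1, path e v (rcons p w),
                   uniq (v :: rcons p w) & forall x, x \in p -> x \notin X]) ->
  exists u : 'I_3 -> V, (forall i j, i != j -> ~~ conf (u i) (u j)) /\ spider_rich e k Q u.
Proof.
move=> k0 oA hB thB hs hc th0 hcQ hleg.
have B0 : 0 < #|B| by exact: leq_trans thB.
have [v1 v1B] : exists v, v \in B by apply/card_gt0P.
have D0 : 0 < D.
  apply: leq_trans (leq_trans th0 (hB v1 v1B)) _; apply: leq_trans (nbhd_le oA).
  by apply: subset_leq_card; apply/subsetP => w; rewrite inE => /andP[].
have [|ws [sws pws wsA hC]] :=
  common_neighbours (s := 3) (nbhd_le oA) _ hB hs hc D0 B0.
  by move=> z; apply: conf_le.
case: ws sws pws wsA hC => [|a [|b [|a' [|//]]]] //= _.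
rewrite !andbT => /andP[/andP[ab aa'] ba'] _; set C := [set v in B | _] => hC.
pose u (i : 'I_3) := nth a [:: a; b; a'] i.
have c0 : 0 < c by case: (posnP c) hc D0 => [->|//]; rewrite mul0n; lia.
exists u; split.
  by case=> [[|[|[|//]]] hi]; case=> [[|[|[|//]]] hj] //= _; rewrite /u /= // conf_sym.
apply: (legs_spider_rich (C := C)) => //.
  have : c ^ 3 * (Q + 4) <= c ^ 3 * #|C| by apply: leq_trans hcQ (leq_trans thB hC).
  by rewrite leq_pmul2l ?expn_gt0 ?c0 //; lia.
move=> v i X; rewrite inE ?andbT => /andP[vB /and3P[Wa Wb Wc]] hX.
by apply: hleg hX; case: i => [[|[|[|//]]] hi]; rewrite /u /=.
Qed.

Lemma path_case_even k Q c n w m v : Pf w m v -> k = ell + 2 * n ->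
  Q + 5 * k + 7 <= Qn -> Q + 5 * k + 7 <= theta ->
  2 * (3 * s0) <= theta -> 2 * D <= c * theta -> c ^ 3 * (Q + 4) <= theta ->
  exists u : 'I_3 -> V, (forall i j, i != j -> ~~ conf (u i) (u j)) /\ spider_rich e k Q u.
Proof.
move=> Pm Ek hQ ht hs hc hcQ; have [sm pm um Am] := Pf_path Pm.
(* [o] is the first inner vertex: with the inside [m] kept, every possible first end is a neighbour
   of [o]. *)
case Em: m sm => [|o m1] /= sm; first by case: ell ell_gt1 sm => [|[]].
have oA : o \in A by apply: Am; rewrite Em !inE eqxx orbT.
pose B := [set v | [exists w, Pf w m v]].
have BE x v' : Pf x m v' -> x \in nbhd e A o.
  move=> Px; have [_ + _ hA] := Pf_path Px; rewrite Em /= inE hA ?inE ?eqxx //=.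
  by rewrite e_sym => /andP[].
apply: (dense_case (c := c) (W := fun w v => Pf w m v) (B := B) (o := o)) => //.
- by move: ell_gt1; rewrite Ek; clear; lia.
- move=> v'; rewrite inE => /existsP[w' Pw']; apply: leq_trans (Pf_first Pw') _.
  by apply: subset_leq_card; apply/subsetP => x; rewrite !inE => Px; move: (BE _ _ Px); rewrite inE => ->.
- apply: leq_trans (Pf_last Pm) _; apply: subset_leq_card; apply/subsetP => x.
  by rewrite !inE => Px; apply/existsP; exists w.
- by move: ht; clear; lia.
- move=> w' v' X Pw' hX.
  have [||p [sp pp up aX]] := even_path (n := n) (X := X) Pw'.
  + by move: hX hQ Ek; clear; lia.
  + by move: hX ht Ek; clear; lia.
  by exists p; split=> //; rewrite sp Ek; move: ell_gt1; clear; lia.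
Qed.

(** The centres are now the possible last inner vertices. For [ell > 2] these differ from the first
    inner vertex [o], which can therefore stay fixed while they vary. *)
Lemma path_case_odd k Q c n w m v : Pf w m v -> k = ell + 1 + 2 * n -> 2 < ell ->
  (forall w m y v, Pf w (rcons m y) v ->
     theta <= #|[set y' | [exists v', Pf w (rcons m y') v']]|) ->
  Q + 5 * k + 7 <= Qn -> Q + 5 * k + 7 <= theta ->
  2 * (3 * s0) <= theta -> 2 * D <= c * theta -> c ^ 3 * (Q + 4) <= theta ->
  exists u : 'I_3 -> V, (forall i j, i != j -> ~~ conf (u i) (u j)) /\ spider_rich e k Q u.
Proof.
move=> Pm Ek ell2 Pf_mid hQ ht hs hc hcQ; have [sm pm um Am] := Pf_path Pm.
have [m0 [y Em]] := Pf_rcons Pm.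
case Em0: m0 => [|o m1].
  by move: sm; rewrite Em Em0 /=; case: ell ell2 => [|[|[]]].
have oA : o \in A by apply: Am; rewrite Em Em0 !inE eqxx orbT.
pose W w y := [exists v, Pf w (rcons m0 y) v].
pose B := [set y | [exists w, W w y]].
have BE x y' v' : Pf x (rcons m0 y') v' -> x \in nbhd e A o.
  move=> Px; have [_ + _ hA] := Pf_path Px; rewrite Em0 /= inE hA ?inE ?eqxx //=.
  by rewrite e_sym => /andP[].
apply: (dense_case (c := c) (W := W) (B := B) (o := o)) => //.
- by move: ell_gt1; rewrite Ek; clear; lia.
- move=> y'; rewrite inE => /existsP[w' /existsP[v' Pw']].
  apply: leq_trans (Pf_first Pw') _; apply: subset_leq_card; apply/subsetP => x.
  rewrite inE => Px; rewrite inE (BE _ _ _ Px) /=.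
  by apply/existsP; exists v'.
- rewrite Em in Pm; apply: leq_trans (Pf_mid _ _ _ _ Pm) _.
  by apply: subset_leq_card; apply/subsetP => x; rewrite !inE => Px; apply/existsP; exists w.
- by move: ht; clear; lia.
- move=> w' y' X /existsP[v' Pw'] hX.
  have [||p [sp pp up aX]] := odd_path (n := n) (X := X) Pw'.
  + by move: hX hQ Ek; clear; lia.
  + by move: hX ht Ek; clear; lia.
  by exists p; split=> //; rewrite sp Ek; move: ell_gt1; clear; lia.
Qed.


(* The [y] counted here have many neighbours in [C] although they are not forced
   to be equal to [o]: the pairs of a vertex of [C] and one of its partners in the
   neighbourhood of [o] have more than [Qn] common neighbours, which outweighs
   the contribution of the [y] with few neighbours in [C]. *)
Lemma heavy_neighbours c o (C : {set V}) S1 T M : ell = 2 -> o \in A -> 0 < #|C| ->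
  {subset C <= A} ->
  (forall v, v \in C -> theta <= #|[set w in nbhd e A o | Pf w [:: o] v]|) ->
  D <= c * theta -> theta <= c ^ S1 * #|C| -> 0 < theta ->
  M * c + T * c ^ S1.+2 <= Qn ->
  exists2 v, v \in C & M <= #|[set y in nbhd e A v | T <= #|nbhd e A y :&: C|]|.
Proof.
move=> ell2 oA C0 CA hC Dc thC th0 hQ.
have [v /andP[vC hv]|no] := pickP [pred v in C |
   M <= #|[set y in nbhd e A v | T <= #|nbhd e A y :&: C|]|]; first by exists v.
exfalso; set N := nbhd e A in no hC.
pose g y := #|N o :&: N y|.
have inN x y : (y \in N x) = (y \in A) && e x y by rewrite inE.
have gD y : g y <= D.
  by apply: leq_trans (nbhd_le oA); apply: subset_leq_card; apply: subsetIl.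
have h1 : #|C| * (theta * Qn.+1) <= \sum_(v in C) \sum_(y in N v) g y.
  rewrite -sum_nat_const; apply: leq_sum => v vC.
  apply: leq_trans (_ : \sum_(w in [set w in N o | Pf w [:: o] v]) Qn.+1 <= _).
    by rewrite sum_nat_const leq_mul2r hC ?orbT.
  apply: leq_trans (_ : \sum_(w in N o) \sum_(y in N v | w \in N y) 1 <= _); last first.
    rewrite (exchange_big_dep (fun y => y \in N v)) /=; last by move=> ? ? _ /andP[].
    apply: leq_sum => y yv; rewrite sum1dep_card; apply: subset_leq_card.
    by apply/subsetP => w; rewrite in_set => /and3P[wo _ wy]; rewrite in_setI wo wy.
  rewrite big_mkcond /= [X in _ <= X]big_mkcond /=; apply: leq_sum => w _.
  rewrite inE; case: ifP => [/andP[-> Pw]|//].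
  (* If [v] and [w] had at most [Qn] common neighbours, the path could be rerouted around all of
     them; but for [ell = 2] its inner vertex is one of them. *)
  rewrite sum1dep_card; rewrite ltnNge; apply/negP => hle.
  have [|m' Pm' aX] := Pf_avoid (X := [set y in N v | w \in N y]) Pw.
    by apply: leq_trans hle; apply: subset_leq_card; apply/subsetP => y; rewrite !inE.
  have [sm pm um Am] := Pf_path Pm'; rewrite ell2 in sm.
  case: m' sm pm um Am aX {Pm'} => [//|y [|//]] _ /= /and3P[e1 e2 _] _ Am aX.
  have := aX y; rewrite !inE eqxx e_sym e2 e_sym e1 !Am ?inE ?eqxx ?orbT //.
  by move=> /(_ isT).
(* Split at [T]. There are fewer than [M] heavy [y] for each [v], each contributing at most [D]; a
   light [y] is met from fewer than [T] vertices of [C], and the sum of [g] counts walks of two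
   edges from [o]. *)
have h2 : \sum_(v in C) \sum_(y in N v) g y <= #|C| * (M * D) + T * (D * D).
  apply: leq_trans (_ : \sum_(v in C)
     (\sum_(y in N v | T <= #|N y :&: C|) g y +
      \sum_(y in N v | ~~ (T <= #|N y :&: C|)) g y) <= _).
    by apply: leq_sum => v _; rewrite (bigID (fun y => T <= #|N y :&: C|)).
  rewrite big_split /=; apply: leq_add.
    rewrite -sum_nat_const; apply: leq_sum => v vC.
    apply: leq_trans (_ : \sum_(y in [set y in N v | T <= #|N y :&: C|]) D <= _).
      rewrite (eq_bigl (fun y => y \in [set y in N v | T <= #|N y :&: C|])).
        exact: leq_sum.
      by move=> y; rewrite in_set.
    rewrite sum_nat_const leq_mul2r; apply/orP; right; apply: ltnW.
    by have := no v; rewrite inE vC /= => /negbT; rewrite -ltnNge.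
  rewrite (exchange_big_dep (fun y => (y \in A) && ~~ (T <= #|N y :&: C|))) /=; last first.
    by move=> v y _; rewrite inN => /andP[/andP[-> _] ->].
  apply: leq_trans (_ : \sum_(y in A) T * g y <= _).
    rewrite big_mkcond /= [X in _ <= X]big_mkcond /=; apply: leq_sum => y _.
    case: ifP => [/andP[yA nT]|//]; rewrite yA sum_nat_const leq_mul2r; apply/orP; right.
    apply: leq_trans (_ : #|N y :&: C| <= _); last by rewrite ltnW // ltnNge.
    apply: subset_leq_card; apply/subsetP => v; rewrite unfold_in /= !inE => /and3P[vC vy _].
    by rewrite vC (CA _ vC) e_sym; case/andP: vy => _ ->.
  rewrite -big_distrr /= leq_mul2l; apply/orP; right.
  apply: leq_trans (_ : \sum_(y in A) \sum_(w in N o | w \in N y) 1 <= _).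
    by apply: leq_sum => y _; rewrite sum1dep_card; apply: subset_leq_card;
       apply/subsetP => w; rewrite !inE.
  rewrite (exchange_big_dep (fun w => w \in N o)) /=; last by move=> ? ? _ /andP[].
  apply: leq_trans (_ : \sum_(w in N o) D <= _).
    apply: leq_sum => w wo; rewrite sum1dep_card.
    have wA : w \in A by move: wo; rewrite inE => /andP[].
    apply: leq_trans (nbhd_le wA); apply: subset_leq_card; apply/subsetP => y.
    rewrite in_set => /and3P[yA _]; rewrite !inE yA e_sym => /andP[_ ->] //.
  by rewrite sum_nat_const leq_mul2r nbhd_le ?orbT.
have h3 := leq_trans h1 h2.
have h4 : #|C| * (M * D) <= #|C| * theta * (M * c).
  by rewrite -mulnA leq_mul2l mulnCA [theta * c]mulnC leq_mul2l Dc !orbT.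
have h5 : T * (D * D) <= #|C| * theta * (T * c ^ S1.+2).
  have -> : #|C| * theta * (T * c ^ S1.+2) = T * (c * theta * (c * (c ^ S1 * #|C|))).
    by rewrite !expnS; nia.
  rewrite leq_mul2l; apply/orP; right; apply: leq_mul => //.
  by apply: leq_trans Dc _; rewrite leq_mul2l thC orbT.
have h6 : #|C| * theta * Qn.+1 <= #|C| * theta * Qn.
  rewrite -mulnA; apply: leq_trans h3 _; apply: leq_trans (leq_add h4 h5) _.
  by rewrite -mulnDr leq_mul2l hQ orbT.
by move: h6; rewrite leq_pmul2l ?muln_gt0 ?C0 ?th0 // ltnn.
Qed.

(** With a single inner vertex the previous argument has nothing left to vary, so the roles are
    exchanged: the common partners [ws] are the possible centres, and the leaves are three
    neighbours of one [v1] that each have many neighbours in [C]. A leg goes from its leaf to some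
    [ci] in [C], then along an even path to the centre. *)
Lemma path_case_odd2 k Q c n w m v : Pf w m v -> ell = 2 -> k = 3 + 2 * n ->
  Q + 5 * k + 7 <= theta -> Q + 5 * k + 7 <= Qn ->
  2 * ((Q + 4) * s0) <= theta -> 2 * D <= c * theta ->
  (2 * s0 + Q + 5) * c + (Q + 2 * k + 7) * c ^ (Q + 4).+2 <= Qn ->
  exists u : 'I_3 -> V, (forall i j, i != j -> ~~ conf (u i) (u j)) /\ spider_rich e k Q u.
Proof.
move=> Pm ell2 Ek ht hQ0 hs hc hQ; have [sm pm um Am] := Pf_path Pm.
case Em: m sm => [|o [|//]] /= sm; [by rewrite ell2 in sm| |by rewrite ell2 in sm].
have oA : o \in A by apply: Am; rewrite Em !inE eqxx orbT.
pose B := [set v | [exists w, Pf w [:: o] v]].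
have BE x v' : Pf x [:: o] v' -> (x \in nbhd e A o) && (v' \in A).
  move=> Px; have [_ + _ hA] := Pf_path Px; rewrite /= inE !hA ?inE ?eqxx ?orbT //=.
  by move=> /andP[exo _]; rewrite e_sym exo.
have hB v' : v' \in B -> theta <= #|[set w in nbhd e A o | Pf w [:: o] v']|.
  rewrite inE => /existsP[w' Pw']; apply: leq_trans (Pf_first Pw') _.
  apply: subset_leq_card; apply/subsetP => x; rewrite inE => Px; rewrite inE Px andbT.
  by case/andP: (BE _ _ Px).
rewrite Em in Pm; have thB : theta <= #|B|.
  apply: leq_trans (Pf_last Pm) _; apply: subset_leq_card; apply/subsetP => x.
  by rewrite !inE => Px; apply/existsP; exists w.
have th0 : 0 < theta by move: ht; clear; lia.
have B0 : 0 < #|B| := leq_trans th0 thB.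
have D0 : 0 < D.
  have [v1 v1B] : exists v, v \in B by apply/card_gt0P.
  apply: leq_trans (leq_trans th0 (hB v1 v1B)) _; apply: leq_trans (nbhd_le oA).
  by apply: subset_leq_card; apply/subsetP => x; rewrite inE => /andP[].
have [|ws [sws pws wsA hC]] :=
  common_neighbours (s := Q + 4) (nbhd_le oA) _ hB hs hc D0 B0.
  by move=> z; apply: conf_le.
set C := [set v in B | _] in hC.
have CB v' : v' \in C -> v' \in B by rewrite inE => /andP[].
(* [2 * s0 + Q + 5] leaves room for three conflict-free leaves outside the [Q + 4] vertices of [ws];
   [Q + 2 * k + 7] leaves room for a [ci] outside [X], the leaf and the centre. *)
have [|||||||v1 v1C hv1] := @heavy_neighbours c o C (Q + 4) (Q + 2 * k + 7) (2 * s0 + Q + 5)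
  ell2 oA.
- by rewrite lt0n; apply: contraTneq hC => ->; rewrite muln0 -ltnNge.
- by move=> x /CB; rewrite inE => /existsP[w' /BE/andP[]].
- by move=> v' /CB /hB.
- by move: hc; clear; lia.
- exact: leq_trans thB hC.
- exact: th0.
- exact: hQ.
have v1A : v1 \in A by move: v1C => /CB; rewrite inE => /existsP[w' /BE/andP[]].
set Hs := [set y in nbhd e A v1 | _] in hv1.
have cws := card_set_of_seq_le ws; rewrite sws in cws.
pose cf z := [set w in nbhd e A v1 | conf w z].
have cfle z : #|cf z| <= s0 by apply: conf_le.
have pickH (Y : {set V}) : #|Y| <= 2 * s0 -> exists2 y, y \in Hs & (y \notin Y) && (y \notin ws).
  move=> hY; have [|y yH yY] := @pick_avoid _ Hs (Y :|: [set x in ws]).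
    by apply: leq_ltn_trans (cardsU_le _ _) _; move: hv1 hY cws; clear; lia.
  by exists y => //; move: yY; rewrite !inE negb_or.
have nbH y : y \in Hs -> y \in nbhd e A v1 by rewrite inE => /andP[].
have [|y0 y0H /andP[_ y0w]] := pickH set0; first by rewrite cards0.
have [|y1 y1H /andP[y1c y1w]] := pickH (cf y0); first by move: (cfle y0); clear; lia.
have [|y2 y2H /andP[y2c y2w]] := pickH (cf y0 :|: cf y1).
  apply: leq_trans (cardsU_le _ _) _; move: (cfle y0) (cfle y1); clear; lia.
pose u (i : 'I_3) := nth y0 [:: y0; y1; y2] i.
have uH i : u i \in Hs by case: i => [[|[|[|//]]] hi].
have uw i : u i \notin ws by case: i => [[|[|[|//]]] hi].
have cfE y z : y \in Hs -> (y \in cf z) = conf y z.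
  by move=> /nbH yN; rewrite in_set yN.
have c10 : ~~ conf y1 y0 by move: y1c; rewrite cfE.
have [c20 c21] : ~~ conf y2 y0 /\ ~~ conf y2 y1.
  by apply/andP; move: y2c; rewrite in_setU negb_or !cfE.
exists u; split.
  by case=> [[|[|[|//]]] hi]; case=> [[|[|[|//]]] hj] //= _; rewrite /u /= // conf_sym.
apply: (legs_spider_rich (C := [set x in ws])) => //.
- by rewrite Ek.
- suff -> : #|[set x in ws]| = Q + 4 by clear; lia.
  rewrite cardsE -sws; apply/card_uniqP.
  move: pws; clear -conf_refl; elim: ws => //= a ws IH /andP[/allP ha /IH ->].
  by rewrite andbT; apply/negP => /ha; rewrite conf_refl.
move=> w' i X; rewrite inE => w'ws hX.
have := uH i; rewrite inE => /andP[ui hui].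
have [|ci ciC ciX] := @pick_avoid _ (nbhd e A (u i) :&: C) (u i |: (w' |: X)).
  apply: leq_trans hui; rewrite !cardsU1 !inE.
  by move: hX; case: (~~ _); case: (~~ _); clear; lia.
move: ciC; rewrite inE => /andP[]; rewrite inE => /andP[ciA euci].
rewrite inE => /andP[_ /allP/(_ w' w'ws) /= Pw'].
have cX : #|u i |: (ci |: X)| <= Q + 2 * k + 6.
  by rewrite !cardsU1; move: hX; case: (_ \notin _); case: (_ \notin _); clear; lia.
have [||p [sp pp up aX]] := even_path (n := n) (X := u i |: (ci |: X)) Pw'.
- by move: cX hQ0 Ek; clear; lia.
- by move: cX ht Ek; clear; lia.
have aX' x : x \in p -> [/\ x != u i, x != ci & x \notin X].
  by move=> /aX; rewrite !inE !negb_or => /and3P.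
move: ciX; rewrite !inE !negb_or => /and3P[ciu ciw ciX].
exists (rev (ci :: p)); split.
- by rewrite size_rev /= sp ell2 Ek; clear; lia.
- by apply: path_rev_sym => //=; rewrite euci.
- suff : uniq (rev (u i :: rcons (ci :: p) w')) by rewrite rev_cons rev_rcons.
  rewrite rev_uniq cons_uniq rcons_cons up andbT inE mem_rcons inE !negb_or.
  rewrite eq_sym ciu /=; apply/andP; split.
    by apply: contraNneq (uw i) => ->.
  by apply/negP => /aX'[]; rewrite eqxx.
- move=> x; rewrite mem_rev inE => /orP[/eqP -> //|/aX'[]] //.
Qed.


Lemma path_case k Q c w m v : Pf w m v -> ell <= k ->
  (2 < ell -> forall w m y v, Pf w (rcons m y) v ->
     theta <= #|[set y' | [exists v', Pf w (rcons m y') v']]|) ->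
  Q + 5 * k + 7 <= Qn -> Q + 5 * k + 7 <= theta ->
  2 * ((Q + 4) * s0) <= theta -> 2 * D <= c * theta -> c ^ 3 * (Q + 4) <= theta ->
  (2 * s0 + Q + 5) * c + (Q + 2 * k + 7) * c ^ (Q + 4).+2 <= Qn ->
  exists u : 'I_3 -> V, (forall i j, i != j -> ~~ conf (u i) (u j)) /\ spider_rich e k Q u.
Proof.
move=> Pm ellk Pf_mid hQ ht hs hc hcQ hQ2.
have hs3 : 2 * (3 * s0) <= theta.
  by apply: leq_trans hs; rewrite leq_mul2l leq_mul2r; apply/orP; right; apply/orP; right; lia.
have Ek := odd_double_half (k - ell); rewrite -mul2n in Ek.
case: (odd _) Ek => /= Ek; last first.
  by apply: (path_case_even (c := c) (n := (k - ell)./2) Pm) => //; move: Ek ellk; clear; lia.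
have [ell2|ell2] := ltnP 2 ell.
  apply: (path_case_odd (c := c) (n := (k - ell)./2) Pm) => //; last exact: Pf_mid.
  by move: Ek ellk; clear; lia.
have ellE : ell = 2 by move: ell2 ell_gt1; clear; lia.
apply: (path_case_odd2 (c := c) (n := (k - ell)./2) Pm) => //.
by move: Ek ellk; rewrite {2}ellE; move: ell2 ell_gt1; clear; lia.
Qed.

End PathCase.

(** * Spiders from families of spiders *)

Section SpiderTree.
Variable k' : nat.
Local Notation k := k'.+1.

(* The subdivided star with three legs of [k] edges; [None] is its centre and
   [spos i t] the vertex at distance [t] from the centre on the leg [i]. *)
Definition spider_pos : finType := option ('I_3 * 'I_k).

Definition spos (i : 'I_3) (t : nat) : spider_pos :=
  if t is t'.+1 then Some (i, inord t') else None.

Definition spar (p : spider_pos) : spider_pos :=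
  if p is Some (i, a) then spos i a else None.

Definition sdep (p : spider_pos) := if p is Some (i, a) then (a : nat).+1 else 0.

Lemma sdep_spos i t : t <= k -> sdep (spos i t) = t.
Proof. by case: t => //= t tk; rewrite inordK. Qed.

Lemma sdep_par p : p != None -> sdep (spar p) < sdep p.
Proof. by case: p => // -[i a] _; rewrite /= sdep_spos // ltnW. Qed.

Lemma spar_spos i t : t < k -> spar (spos i t.+1) = spos i t.
Proof. by move=> tk; rewrite /= inordK. Qed.

Lemma sposP p : p != None -> exists i t, [/\ 0 < t, t <= k & p = spos i t].
Proof. by case: p => // -[i a] _; exists i, (a : nat).+1; split=> //=; rewrite inord_val. Qed.

Lemma spos_inj i j s t : s <= k -> t <= k -> 0 < s -> spos i s = spos j t -> i = j /\ s = t.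
Proof.
move=> sk tk s0 E; have := congr1 sdep E; rewrite !sdep_spos // => st; split=> //.
by move: E; rewrite st; case: t tk st s0 => [|t] tk -> //= _ [].
Qed.

Lemma spos_eq i s t : s <= k -> t <= k -> (spos i s == spos i t) = (s == t).
Proof.
move=> sk tk; apply/eqP/eqP => [E|->//].
by have := congr1 sdep E; rewrite !sdep_spos.
Qed.

Lemma card_spider_pos : #|spider_pos| = (3 * k).+1.
Proof. by rewrite card_option card_prod !card_ord. Qed.

(** * Spiders cut at their first fixed positions and bounced to full length *)

Section SpiderCase.
Variables (V : finType) (e conf : rel V) (A : {set V}).
Hypotheses (e_sym : symmetric e) (conf_sym : symmetric conf) (conf_refl : reflexive conf).
Variables (R : {set {ffun spider_pos -> V}}) (K : {set spider_pos}) (Qn theta Q : nat).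
Hypothesis R_emb : forall f, f \in R -> emb e conf A None spar setT f.
Variable tl : 'I_3 -> nat.
Hypothesis tl_bounds : forall i, 0 < tl i <= k.
Hypothesis tlK : forall i, spos i (tl i) \in K.
Hypothesis tl_min : forall i t, t < tl i -> spos i t \notin K.
Hypothesis tl_one : forall i j, tl i = 1 -> tl j = 1 -> i = j.

(** The spider cut on each leg at its first position in [K], minus the cut vertex of leg [i], which
    is the one to be varied. Since [Some (j, a)] is at distance [a.+1] from the centre, [a < tl j]
    includes the cut positions of the other legs. *)
Definition core_but (i : 'I_3) : {set spider_pos} :=
  [set p : spider_pos | (if p is Some (j, a) then a < tl j else true) && (p != spos i (tl i))].

Lemma core_butP i j t : t <= tl j -> spos j t != spos i (tl i) ->
  spos j t \in core_but i.
Proof.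
move=> tt ne; have /andP[_ tk] := tl_bounds j; rewrite inE ne andbT.
by case: t tt ne => //= t tt _; rewrite inordK // (leq_trans tt).
Qed.

Hypothesis R_avoid : forall f (X : {set V}), f \in R -> #|X| <= Qn ->
  exists g, [/\ g \in R, {in K, g =1 f} & forall p, p \notin K -> g p \notin X].
Hypothesis R_ext : forall f i, f \in R -> theta <=
  #|(fun g : {ffun spider_pos -> V} => g (spos i (tl i)))
      @: [set g in R | restr (core_but i) g == restr (core_but i) f]|.
Hypotheses (hQn : Q + 4 * k + 10 <= Qn) (htheta : Q + 4 * k + 10 <= theta).

Lemma R_adj f i t : f \in R -> t < k -> e (f (spos i t)) (f (spos i t.+1)).
Proof.
move=> /R_emb/and3P[_ /forall_inP fe _] tk.
have := fe (spos i t.+1) (in_setT _); rewrite in_setT andbT spar_spos //.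
Qed.

Lemma R_conf f p q : f \in R -> p != q -> ~~ conf (f p) (f q).
Proof.
move=> /R_emb/and3P[_ _ /forall_inP fc] pq.
by have /forall_inP/(_ q (in_setT _)) := fc p (in_setT _); rewrite pq.
Qed.

Lemma R_inj f : f \in R -> injective f.
Proof.
move=> fR p q E; apply/eqP; apply: contraT => pq.
by have := R_conf fR pq; rewrite E conf_refl.
Qed.

Lemma R_ext_avoid f i (Y : {set V}) : f \in R -> #|Y| < theta ->
  exists g, [/\ g \in R, {in core_but i, g =1 f} & g (spos i (tl i)) \notin Y].
Proof.
move=> fR hY; have [x] := pick_avoid (Y := Y) (leq_trans hY (R_ext i fR)).
move=> /imsetP[g]; rewrite inE => /andP[gR /restrP gf] -> hx.
by exists g; split.
Qed.

Variable f0 : {ffun spider_pos -> V}.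
Hypothesis f0R : f0 \in R.
Let par0 i := odd (k - tl i).
Let u i : V := f0 (spos i (tl i - par0 i)).

(** When the missing length is odd, the leaf is taken one step before the cut. Two legs cut at
    distance 1 could then both start at the centre, which [tl_one] forbids. *)
Lemma start_neq i j : i != j -> spos i (tl i - par0 i) != spos j (tl j - par0 j).
Proof.
move=> ij; apply/eqP => E.
have /andP[i0 ik] := tl_bounds i; have /andP[j0 jk] := tl_bounds j.
have sk : tl i - par0 i <= k by apply: leq_trans ik; rewrite leq_subr.
have tk : tl j - par0 j <= k by apply: leq_trans jk; rewrite leq_subr.
have [s0|s0] := posnP (tl i - par0 i); last first.
  by case: (spos_inj sk tk s0 E) => ii; rewrite ii eqxx in ij.
move: E; rewrite s0 => E; have := congr1 sdep E; rewrite !sdep_spos // => E2.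
have := tl_one (i := i) (j := j); case: (par0 i) s0 => /=; case: (par0 j) E2 => /=;
  move=> E2 s0 h; move: ij; rewrite h ?eqxx //; move: E2 s0 i0 j0; clear; lia.
Qed.

Variable X : {set V}.
Hypothesis XQ : #|X| <= Q.

Definition used (w : 'I_3 -> seq V) : {set V} :=
  X :|: [set u i | i : 'I_3] :|: \bigcup_(i : 'I_3) [set x in w i].

Lemma card_used w c : (forall i, size (w i) <= c i) -> (forall i, c i <= k) ->
  #|used w| <= Q + 3 * k + 3.
Proof.
move=> sw ck; apply: leq_trans (cardsU_le _ _) _.
have h1 : #|X :|: [set u i | i : 'I_3]| <= Q + 3.
  apply: leq_trans (cardsU_le _ _) _; apply: leq_add XQ _.
  by apply: leq_trans (leq_imset_card _ _) _; rewrite card_ord.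
have h2 : #|\bigcup_(i : 'I_3) [set x in w i]| <= 3 * k.
  apply: leq_trans (card_bigcup_le _ _) _.
  apply: leq_trans (_ : \sum_(i : 'I_3) k <= _); last by rewrite sum_nat_const card_ord.
  apply: leq_sum => i _; apply: leq_trans (card_set_of_seq_le _) _.
  exact: leq_trans (sw i) (ck i).
by move: (leq_add h1 h2); clear; lia.
Qed.

Lemma usedP w x : reflect [/\ x \notin X, forall j, x != u j & forall i, x \notin w i]
  (x \notin used w).
Proof.
apply: (iffP idP) => [|[xX xu xw]]; last first.
  rewrite !inE !negb_or xX /=; apply/andP; split.
    by apply/negP => /imsetP[j _ E]; move: (xu j); rewrite E eqxx.
  by apply/negP => /bigcupP[i _]; rewrite inE; apply/negP.
rewrite !inE !negb_or => /andP[/andP[xX xu] xw]; split=> //.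
  by move=> j; apply: contraNneq xu => ->; apply: imset_f.
by move=> i; apply: contra xw => xi; apply/bigcupP; exists i; rewrite ?inE.
Qed.

Definition fresh (w : 'I_3 -> seq V) :=
  [/\ forall i, uniq (w i), forall i j x, i != j -> x \in w i -> x \notin w j &
      forall i x, x \in w i -> x \notin X /\ forall j, x != u j].

Lemma fresh_extend w i s : fresh w -> uniq s -> (forall x, x \in s -> x \notin used w) ->
  fresh (fun j => if j == i then w j ++ s else w j).
Proof.
move=> [w1 w2 w3] us hs; split.
- move=> j; case: eqP => // _; rewrite cat_uniq w1 us andbT; apply/hasPn => x /hs.
  by case/usedP.
- move=> a b x ab; case: (eqVneq a i) => [ai|ai]; case: (eqVneq b i) => [bi|bi].
  + by move: ab; rewrite ai bi eqxx.
  + by rewrite mem_cat => /orP[/(w2 _ _ _ ab)//|/hs/usedP[]].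
  + move=> xa; rewrite mem_cat negb_or (w2 _ _ _ ab) //=; apply/negP => /hs/usedP[_ _].
    by move=> /(_ a); rewrite xa.
  + exact: w2.
- move=> a x; case: eqP => _; last exact: w3.
  by rewrite mem_cat => /orP[/w3//|/hs/usedP[]].
Qed.

(** Stages of the construction: on a leg in [S] the walk [w i] has left its leaf and stands at the
    cut vertex of the current spider [f]; on the others, [f] must still show the leaf itself at its
    starting position. *)
Definition spider_state (S : {set 'I_3}) (c : 'I_3 -> nat) :=
  exists f (w : 'I_3 -> seq V), [/\ f \in R, fresh w, forall i, size (w i) = c i,
    forall i, i \in S -> path e (u i) (w i) /\ last (u i) (w i) = f (spos i (tl i)) &
    forall i, i \notin S -> w i = [::] /\ f (spos i (tl i - par0 i)) = u i].

Lemma core_keep i j (f g : {ffun spider_pos -> V}) : {in core_but i, g =1 f} -> j != i ->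
  g (spos j (tl j)) = f (spos j (tl j)) /\
  g (spos j (tl j - par0 j)) = f (spos j (tl j - par0 j)).
Proof.
move=> gf ji; have /andP[i0 ik] := tl_bounds i; have /andP[j0 jk] := tl_bounds j.
split; apply: gf; apply: core_butP; rewrite ?leq_subr //; apply/eqP => E.
  by have [ij _] := spos_inj jk ik j0 E; move: ji; rewrite ij eqxx.
have [ij _] := spos_inj ik (leq_trans (leq_subr _ _) jk) i0 (esym E).
by move: ji; rewrite ij eqxx.
Qed.

Lemma core_keep_pred i (f g : {ffun spider_pos -> V}) t : {in core_but i, g =1 f} -> t < tl i -> g (spos i t) = f (spos i t).
Proof.
move=> gf tt; apply/gf/core_butP; first exact: ltnW.
have /andP[_ ik] := tl_bounds i.
by rewrite spos_eq ?(ltn_eqF tt) // ltnW // (leq_trans tt).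
Qed.

(** Only the cut vertex of leg [i] is varied here, so the leaves of inactive legs survive. All legs
    have to be activated before the first bounce, because a refresh off [K] would move a leaf placed
    one step before its cut. *)
Lemma spider_activate (S : {set 'I_3}) (c : 'I_3 -> nat) (i : 'I_3) : i \notin S -> spider_state S c ->
  (forall j, c j <= k) ->
  spider_state (i |: S) (fun j => if j == i then nat_of_bool (par0 i) else c j).
Proof.
move=> iS [f [w [fR fw sw hS hnS]]] ck.
have [wi fi] := hnS i iS; have /andP[i0 ik] := tl_bounds i.
case Ep: (par0 i) fi => fi; last first.
  exists f, w; split=> //.
  - by move=> j; case: eqP => // ->; rewrite wi.
  - move=> j; rewrite in_setU1 => /orP[/eqP ->|/hS//]; rewrite wi /=; split=> //.
    by rewrite -fi subn0.
  - by move=> j; rewrite in_setU1 negb_or => /andP[_ /hnS].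
have [|g [gR gf gx]] := R_ext_avoid i fR (Y := used w).
  apply: leq_ltn_trans (card_used (c := c) _ ck) _; first by move=> j; rewrite sw.
  by move: htheta; clear; lia.
exists g, (fun j => if j == i then w j ++ [:: g (spos i (tl i))] else w j); split=> //.
- by apply: fresh_extend => // x; rewrite inE => /eqP ->.
- by move=> j; case: eqP => [->|_] //; rewrite wi.
- move=> j; rewrite in_setU1; case: (eqVneq j i) => [->|ji] /= hj.
    rewrite wi /= -fi -(core_keep_pred gf) ?andbT; last by move: i0; clear; lia.
    split=> //; have := R_adj i gR (t := tl i - 1); rewrite subn1 prednK //.
    by apply; rewrite ?(leq_trans _ ik).
  by have [E _] := core_keep gf ji; rewrite E; apply: hS.
- move=> j; rewrite in_setU1 negb_or => /andP[ji jS]; rewrite (negPf ji).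
  by have [_ E] := core_keep gf ji; rewrite E; apply: hnS.
Qed.

(** A refresh off [K] gives a new vertex [y] just before the cut without moving the cut vertices;
    varying the cut vertex of leg [i] over it then gives a new [z], and the walk continues through
    [y] to [z]. *)
Lemma spider_bounce c i : spider_state setT c -> (forall j, c j <= k) ->
  spider_state setT (fun j => if j == i then c j + 2 else c j).
Proof.
move=> [f [w [fR fw sw hS _]]] ck; have /andP[i0 ik] := tl_bounds i.
have cu : #|used w| <= Q + 3 * k + 3 by apply: (card_used (c := c)) => // j; rewrite sw.
have [|g [gR gf ga]] := R_avoid (X := used w) fR.
  by apply: leq_trans cu _; move: hQn; clear; lia.
pose y := g (spos i (tl i).-1).
have yu : y \notin used w by apply: ga; apply: tl_min; rewrite prednK.
have [|h [hR hg hx]] := R_ext_avoid i gR (Y := y |: used w).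
  rewrite cardsU1; move: cu htheta; case: (_ \notin _); clear; lia.
pose z := h (spos i (tl i)).
have hy : h (spos i (tl i).-1) = y by apply: core_keep_pred hg _; rewrite prednK.
move: hx; rewrite in_setU1 negb_or -/z => /andP[zy zu].
exists h, (fun j => if j == i then w j ++ [:: y; z] else w j); split=> //.
- apply: fresh_extend => //; first by rewrite /= inE eq_sym zy.
  by move=> x; rewrite in_cons mem_seq1 => /orP[] /eqP ->.
- by move=> j; rewrite -sw; case: eqP => [->|_] //; rewrite size_cat.
- move=> j _; have [pj lj] := hS j (in_setT _); case: (eqVneq j i) => [Eji|ji].
    rewrite Eji cat_path last_cat /= -Eji pj lj /= Eji; split=> //.
    have a1 := R_adj i gR (t := (tl i).-1); have a2 := R_adj i hR (t := (tl i).-1).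
    rewrite prednK // in a1 a2; rewrite -/y (gf _ (tlK i)) in a1.
    by rewrite e_sym a1 //= -hy a2.
  have [E _] := core_keep hg ji; rewrite E (gf _ (tlK j)); split=> //.
- by move=> j; rewrite in_setT.
Qed.

Lemma spider_reach (n : 'I_3 -> nat) M : \sum_i n i = M ->
  (forall i, par0 i + 2 * n i <= k) ->
  spider_state setT (fun i => par0 i + 2 * n i).
Proof.
elim: M n => [|M IH] n sn nk.
  have st0 : spider_state set0 (fun _ => 0).
    exists f0, (fun _ => [::]); split=> //; last by move=> i; rewrite inE.
  have ck (c : 'I_3 -> nat) : (forall i, c i <= 1) -> forall i, c i <= k.
    by move=> h i; apply: leq_trans (h i) _.
  pose o1 : 'I_3 := inord 1; pose o2 : 'I_3 := inord 2.
  have v1 : nat_of_ord o1 = 1 by rewrite inordK.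
  have v2 : nat_of_ord o2 = 2 by rewrite inordK.
  have st1 := spider_activate (i := ord0) _ st0 (ck _ _).
  have {}st1 := st1 (negbT (in_set0 _)) (fun _ => leq0n _).
  have [|j|f [w [fR fw sw hS hnS]]] := spider_activate (i := o1) _ st1 (ck _ _).
  - by rewrite !inE -val_eqE /= v1.
  - by case: eqP => // _; case: par0.
  have st2 : spider_state (o1 |: (ord0 |: set0)) 
     (fun j => if j == o1 then nat_of_bool (par0 o1) else if j == ord0 then nat_of_bool (par0 ord0) else 0).
    by exists f, w.
  have [|j|g [w' [gR gw sw' gS gnS]]] := spider_activate (i := o2) _ st2 (ck _ _).
  - by rewrite !inE -!val_eqE /= v1 v2.
  - by case: eqP => // _; [case: par0|case: eqP => // _; case: par0].
  have allI (j : 'I_3) : [|| j == o2, j == o1 | j == ord0].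
    by rewrite -!val_eqE /= v1 v2; case: j => [[|[|[|//]]]].
  exists g, w'; split=> //.
  - move=> j; rewrite sw'; have -> : n j = 0.
      by apply/eqP; rewrite -leqn0 -[X in _ <= X]sn (bigD1 j) //= leq_addr.
    rewrite muln0 addn0; have := allI j.
    by case: eqP => [->|_] //=; case: eqP => [->|_] //= /eqP ->; rewrite eqxx.
  - by move=> j _; apply: gS; rewrite !inE orbF; apply: allI.
  - by move=> j; rewrite in_setT.
have [i ni] : exists i, 0 < n i.
  apply/existsP; apply: contraT; rewrite negb_exists => /forallP h.
  move: sn; rewrite big1 // => i _; apply/eqP; have := h i; rewrite -leqNgt leqn0 //.
pose n' j := if j == i then (n j).-1 else n j.
have sn' : \sum_j n' j = M.
  move: sn; rewrite (bigD1 i) //= [X in _ -> X = _](bigD1 i) //= /n' eqxx.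
  rewrite [X in _ -> _ + X = _](eq_bigr n) => [|j /negPf ->//].
  by move: ni; clear; lia.
have n'le j : n' j <= n j by rewrite /n'; case: eqP => // _; apply: leq_pred.
have n'k j : par0 j + 2 * n' j <= k.
  by apply: leq_trans (nk j); rewrite leq_add2l leq_mul2l n'le orbT.
have [f [w [fR fw sw hS hnS]]] := spider_bounce i (IH n' sn' n'k) n'k.
exists f, w; split=> // j; rewrite sw /n'; case: eqP => // ->.
by rewrite -addnA -[X in _ + X = _](mulnDr 2 _ 1) addn1 prednK.
Qed.

Fixpoint spider_mid (g : {ffun spider_pos -> V}) i t : seq V :=
  if t is t'.+1 then (if t' is _.+1 then g (spos i t') :: spider_mid g i t' else [::])
  else [::].

Lemma spider_midSS g i t : spider_mid g i t.+2 = g (spos i t.+1) :: spider_mid g i t.+1.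
Proof. by []. Qed.

Lemma size_spider_mid g i t : size (spider_mid g i t) = t.-1.
Proof. by elim: t => //= -[|t] //= ->. Qed.

Lemma mem_spider_mid g i t x : x \in spider_mid g i t ->
  exists2 j, 0 < j < t & x = g (spos i j).
Proof.
elim: t => //= -[|t] //= IH; rewrite inE => /orP[/eqP ->|/IH[j /andP[j0 jt] ->]].
  by exists t.+1; rewrite //= ltnS leqnn.
by exists j; rewrite // j0 /= ltnW // ltnS ltnW.
Qed.

Lemma uniq_spider_mid g i t : g \in R -> t <= k -> uniq (rcons (spider_mid g i t) (g None)).
Proof.
move=> gR tk; rewrite rcons_uniq; apply/andP; split.
  apply/negP => /mem_spider_mid[j /andP[j0 jt] /(R_inj gR) E].
  have := congr1 sdep E; rewrite sdep_spos /=; first by move: j0; clear; lia.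
  by rewrite ltnW // (leq_trans jt).
elim: t tk => // -[|t] // IH tk; rewrite spider_midSS cons_uniq IH ?andbT 1?ltnW //.
apply/negP => /mem_spider_mid[j /andP[j0 jt]] /(R_inj gR)/eqP.
by rewrite spos_eq ?(gtn_eqF jt) // ltnW // (leq_trans jt) // ltnW.
Qed.

Lemma path_spider_mid g i t : g \in R -> t < k ->
  path e (g (spos i t.+1)) (rcons (spider_mid g i t.+1) (g None)).
Proof.
move=> gR; elim: t => [|t IH] tk; first by rewrite /= e_sym andbT; apply: (R_adj i gR (t := 0)).
by rewrite /= e_sym (R_adj i gR tk) /=; apply: IH; apply: ltnW.
Qed.

Lemma spider_found : exists v (w : 'I_3 -> seq V),
    [/\ forall i, size (w i) = k.-1,
        forall i, path e (u i) (rcons (w i) v),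
        forall i, uniq (rcons (w i) v),
        forall i j x, i != j -> x \in w i -> x \notin w j &
        forall i x, x \in rcons (w i) v -> x \notin X /\ forall j, x != u j].
Proof.
pose n i := (k - tl i)./2.
have En i : par0 i + 2 * n i = k - tl i by rewrite mul2n; apply: odd_double_half.
have nk i : par0 i + 2 * n i <= k by rewrite En leq_subr.
have [f [w [fR [w1 w2 w3] sw hS _]]] := spider_reach (erefl (\sum_i n i)) nk.
have cu : #|used w| <= Q + 3 * k + 3.
  by apply: (card_used (c := fun i => par0 i + 2 * n i)) => // j; rewrite sw.
(* A last refresh keeps the ends of the walks, which sit at positions in [K], and makes the centre
   and everything before the cuts new. Leg [i] then has [par0 i + 2 * n i + tl i = k] edges. *)
have [|g [gR gf ga]] := R_avoid (X := used w) fR.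
  by apply: leq_trans cu _; move: hQn; clear; lia.
have gaP i t : t < tl i -> g (spos i t) \notin used w by move=> /tl_min/ga.
have midP i x : x \in spider_mid g i (tl i) -> x \notin used w.
  by move=> /mem_spider_mid[j /andP[_ jt] ->]; apply: gaP.
have g0 : g None \notin used w.
  by apply: (gaP ord0 0); have /andP[] := tl_bounds ord0.
exists (g None), (fun i => w i ++ spider_mid g i (tl i)); split.
- move=> i; rewrite size_cat sw size_spider_mid En.
  by have /andP[] := tl_bounds i; clear; lia.
- move=> i; have [pi li] := hS i (in_setT _); have /andP[i0 ik] := tl_bounds i.
  rewrite rcons_cat cat_path pi li -(gf _ (tlK i)) /= -{1}(prednK i0).
  have := path_spider_mid i gR (t := (tl i).-1); rewrite prednK //; exact.
- move=> i; have /andP[i0 ik] := tl_bounds i.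
  rewrite rcons_cat cat_uniq w1 uniq_spider_mid // andbT /=; apply/hasPn => x.
  rewrite mem_rcons inE => /orP[/eqP ->|/midP/usedP[]//].
  by case/usedP: g0.
- move=> i j x ij; rewrite !mem_cat negb_or => /orP[xi|xi]; apply/andP; split.
  + exact: w2 ij xi.
  + by apply/negP => /midP/usedP[_ _ /(_ i)]; rewrite xi.
  + by case/usedP: (midP _ _ xi).
  + apply/negP => /mem_spider_mid[t /andP[t0 tt] Ex].
    have [s /andP[s0 ss] Ex2] := mem_spider_mid xi.
    have /andP[_ ik] := tl_bounds i; have /andP[_ jk] := tl_bounds j.
    have sk : s <= k by rewrite ltnW // (leq_trans ss).
    have tk : t <= k by rewrite ltnW // (leq_trans tt).
    have := R_inj gR (etrans (esym Ex2) Ex) => /(spos_inj sk tk s0)[E _].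
    by move: ij; rewrite E eqxx.
- move=> i x; rewrite rcons_cat mem_cat mem_rcons inE.
  case/or3P => [/w3//|/eqP ->|/midP/usedP[]//].
  by case/usedP: g0.
Qed.

End SpiderCase.
End SpiderTree.

Lemma iota_rcons a n : iota a n.+1 = rcons (iota a n) (a + n).
Proof. by rewrite -addn1 iotaD cats1. Qed.

Lemma path_map_iota (T : Type) (e : rel T) (g : nat -> T) a n :
  (forall t, a <= t < a + n -> e (g t) (g t.+1)) -> path e (g a) (map g (iota a.+1 n)).
Proof.
elim: n a => //= n IH a h; rewrite h ?leqnn ?addnS ?ltnS ?leq_addr //=.
by apply: IH => t /andP[at1 tn]; apply: h; rewrite ltnW //= addnS -addSn.
Qed.

(** * Cleaned families of embedded spiders and their segments *)

Section Assembly.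
Variable k' : nat.
Local Notation k := k'.+1.
Local Notation P := (spider_pos k').
Variables (V : finType) (e conf : rel V) (A : {set V}).
Hypotheses (e_sym : symmetric e) (conf_sym : symmetric conf) (conf_refl : reflexive conf).
Variables (d K0 s0 : nat).
Local Notation D := (K0 * d).
Hypothesis nbhd_ge : forall x, x \in A -> d <= #|nbhd e A x|.
Hypothesis nbhd_le : forall x, x \in A -> #|nbhd e A x| <= D.
Hypothesis conf_le : forall y z, y \in A -> #|[set w in nbhd e A y | conf w z]| <= s0.
Hypothesis d_gt0 : 0 < d.
Hypothesis K0_gt0 : 0 < K0.

Local Notation is_emb := (emb e conf A (None : P) (@spar k') setT).

Lemma clean_family (S : {set {ffun P -> V}}) (K : {set P}) W c theta
    (Dm : 'I_3 -> {set P}) (pm rt : 'I_3 -> P) :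
  (forall f, f \in S -> is_emb f) ->
  (forall f, f \in S -> spread (2 * c) K S f) ->
  #|A| * d ^ (3 * k) <= W * #|S| -> 0 < #|A| ->
  theta * (7 * K0 ^ (3 * k) * W) <= d ->
  (forall j, rooted_at None (@spar k') (rt j) (Dm j)) -> (forall j, pm j \notin Dm j) ->
  exists R : {set {ffun P -> V}}, [/\ R \subset S, R != set0,
    forall f (X : {set V}), f \in R -> #|P| * #|X| < c ->
      exists g, [/\ g \in R, {in K, g =1 f} & forall p, p \notin K -> g p \notin X] &
    forall f j, f \in R -> theta <=
      #|(fun g : {ffun P -> V} => g (pm j)) @: [set g in R | restr (Dm j) g == restr (Dm j) f]|].
Proof.
move=> Semb Ssp SW A0 hth hrt hpm.
have D0 : 0 < D by rewrite muln_gt0 K0_gt0.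
pose a j := #|A| * D ^ #|Dm j|.-1; pose m j := D ^ #|~: (pm j |: Dm j)|.
have S0 : 0 < #|S|.
  by rewrite lt0n; apply: contraTneq SW => ->; rewrite muln0 -ltnNge muln_gt0 A0 expn_gt0 d_gt0.
(* One factor [D] fewer than in the bound on all embeddings of the spider; this missing factor is
   why [theta] may be of order [d]. *)
have ma j : m j * a j = #|A| * D ^ (3 * k).-1.
  rewrite /m /a mulnCA -expnD; congr (_ * _ ^ _).
  have := cardsC (pm j |: Dm j); rewrite cardsU1 hpm card_spider_pos.
  have : 0 < #|Dm j| by apply/card_gt0P; exists (rt j); case: (hrt j).
  by clear; lia.
have [||||R [RS R0 Rcl Rext]] := @cleaning _ _ _ _ _ (restr K) (fun j => restr (Dm j))
    (fun j (g : {ffun P -> V}) => g (pm j)) S theta m a.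
- move=> j; have [n En] : exists n, #|Dm j| = n.+1.
    by exists #|Dm j|.-1; rewrite prednK //; apply/card_gt0P; exists (rt j); case: (hrt j).
  rewrite /a En; exact: (restr_count (@sdep_par k') e_sym nbhd_le En (hrt j) Semb).
- move=> j y z; have [->|[g]] := set_0Vmem [set f in S | (restr (Dm j) f == y) && (f (pm j) == z)];
    first by rewrite cards0.
  rewrite !inE => /and3P[gS /eqP gy /eqP gz].
  apply: leq_trans (ext_count conf (@sdep_par k') e_sym nbhd_le g _); last first.
    by apply/set0Pn; exists (pm j); rewrite setU11.
  apply: subset_leq_card; apply/subsetP => f; rewrite !inE => /and3P[fS /eqP fy /eqP fz].
  rewrite Semb //=; apply/restrP => p; rewrite in_setU1 => /orP[/eqP ->|pD].
    by rewrite fz gz.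
  by have /eqP/restrP/(_ p pD) := etrans fy (esym gy).
- by move=> j; rewrite expn_gt0 D0.
- under eq_bigr => j _ do rewrite ma; rewrite sum_nat_const card_ord.
  have W0 : 0 < W.
    case: (posnP W) SW => // ->; rewrite mul0n leqNgt.
    by rewrite muln_gt0 A0 expn_gt0 d_gt0.
  rewrite -(ltn_pmul2l W0); apply: leq_trans SW.
  have E : D ^ (3 * k).-1 * (K0 * d) = K0 ^ (3 * k) * d ^ (3 * k).
    by rewrite -expnSr prednK // expnMn.
  have E2 : d ^ (3 * k) = d * d ^ (3 * k).-1 by rewrite -expnS prednK.
  have E3 : K0 ^ (3 * k) = K0 * K0 ^ (3 * k).-1 by rewrite -expnS prednK.
  rewrite expnMn E2.
  move: hth; rewrite E3; set x := K0 ^ _; set y := d ^ _ => hth.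
  have x0 : 0 < x by rewrite expn_gt0 K0_gt0.
  have y0 : 0 < y by rewrite expn_gt0 d_gt0.
  have h1 : theta * (7 * x * W) <= d.
    apply: leq_trans hth; rewrite leq_mul2l; apply/orP; right; rewrite leq_mul2r.
    by apply/orP; right; rewrite leq_mul2l; apply/orP; right; rewrite leq_pmull.
  have h2 : theta * (6 * x * W) < d.
    have [->|t0] := posnP theta; first by rewrite mul0n.
    apply: leq_trans h1; rewrite -!mulnA ltn_pmul2l // ltn_pmul2r //.
    by rewrite muln_gt0 x0.
  have -> : W * (2 * theta * (3 * (#|A| * (x * y)))) = (theta * (6 * x * W)) * (#|A| * y).
    by nia.
  have -> : #|A| * (d * y) = d * (#|A| * y) by nia.
  by rewrite ltn_pmul2r // muln_gt0 A0.
exists R; split=> // f X fR hX.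
(* Cleaning leaves at least half of each class over [K], so spread [2 * c] in [S] becomes spread [c]
   in [R]. *)
apply: (spread_avoid fR _ hX); apply/forallP => p; apply/implyP => pK.
apply/forallP => v; rewrite -(leq_pmul2l (isT : 0 < 2)).
apply: leq_trans (Rcl f fR); have := Ssp f (subsetP RS f fR) => /forallP/(_ p).
rewrite pK /= => /forallP/(_ v); apply: leq_trans; rewrite mulnA leq_mul2l; apply/orP; right.
apply: subset_leq_card; apply/subsetP => g; rewrite !inE => /andP[/andP[gR ->] ->].
by rewrite (subsetP RS).
Qed.

Section Segment.
Variables (R : {set {ffun P -> V}}) (K : {set P}) (Qn theta ell : nat) (q : nat -> P).
Hypothesis R_emb : forall f, f \in R -> is_emb f.
Hypothesis q_inj : {in [pred t | t <= ell] &, injective q}.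
Hypothesis q_adj : forall f t, is_emb f -> t < ell -> e (f (q t)) (f (q t.+1)).
Hypothesis q0K : q 0 \in K.
Hypothesis qlK : q ell \in K.
Hypothesis qK : forall t, 0 < t < ell -> q t \notin K.
Hypothesis ell_gt1 : 1 < ell.

Definition seg_set a n : {set P} := [set p in [seq q t | t <- iota a n]].

Lemma seg_setP a n t : a <= t < a + n -> q t \in seg_set a n.
Proof. by move=> h; rewrite inE; apply: map_f; rewrite mem_iota. Qed.

Hypothesis R_avoid : forall f (X : {set V}), f \in R -> #|X| <= Qn ->
  exists g, [/\ g \in R, {in K, g =1 f} & forall p, p \notin K -> g p \notin X].
Hypothesis R_ext0 : forall f, f \in R -> theta <= #|(fun g : {ffun P -> V} => g (q 0))
  @: [set g in R | restr (seg_set 1 ell) g == restr (seg_set 1 ell) f]|.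
Hypothesis R_ext1 : forall f, f \in R -> theta <= #|(fun g : {ffun P -> V} => g (q ell))
  @: [set g in R | restr (seg_set 0 ell) g == restr (seg_set 0 ell) f]|.
Hypothesis R_ext2 : forall f, f \in R -> theta <= #|(fun g : {ffun P -> V} => g (q ell.-1))
  @: [set g in R | restr (seg_set 0 ell.-1) g == restr (seg_set 0 ell.-1) f]|.

Definition seg_mid (f : {ffun P -> V}) := [seq f (q t) | t <- iota 1 ell.-1].

Definition seg_fam (w : V) (m : seq V) (v : V) :=
  [exists f in R, [&& f (q 0) == w, seg_mid f == m & f (q ell) == v]].

Lemma seg_famP w m v : reflect
  (exists2 f, f \in R & [/\ f (q 0) = w, seg_mid f = m & f (q ell) = v]) (seg_fam w m v).
Proof.
apply: (iffP exists_inP) => [[f fR /and3P[/eqP ? /eqP ? /eqP ?]]|[f fR [E1 E2 E3]]].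
  by exists f.
by exists f; rewrite // E1 E2 E3 !eqxx.
Qed.

Lemma seg_midE (f g : {ffun P -> V}) : (forall t, 0 < t < ell -> g (q t) = f (q t)) -> seg_mid g = seg_mid f.
Proof.
move=> h; apply/eq_in_map => t; rewrite mem_iota => /andP[t0 tl]; apply: h.
by rewrite t0 /=; move: tl ell_gt1; clear; lia.
Qed.

(** The paths traced by members of [R] along [q] are flexible: a refresh off [K] reroutes the inside
    with both ends fixed, and the three extension hypotheses free the first end, the last end and
    the vertex before the last. *)
Lemma segment_case Q c : ell <= k -> R != set0 ->
  Q + 5 * k + 7 <= Qn -> Q + 5 * k + 7 <= theta ->
  2 * ((Q + 4) * s0) <= theta -> 2 * D <= c * theta -> c ^ 3 * (Q + 4) <= theta ->
  (2 * s0 + Q + 5) * c + (Q + 2 * k + 7) * c ^ (Q + 4).+2 <= Qn ->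
  exists u : 'I_3 -> V, (forall i j, i != j -> ~~ conf (u i) (u j)) /\ spider_rich e k Q u.
Proof.
move=> ellk /set0Pn[f0 f0R] h1 h2 h3 h4 h5 h6.
have cat_mid (f : {ffun P -> V}) :
    f (q 0) :: rcons (seg_mid f) (f (q ell)) = [seq f (q t) | t <- iota 0 ell.+1].
  rewrite /seg_mid -{2 3}(prednK (ltnW ell_gt1)) iota_rcons map_rcons add0n.
  by rewrite [iota 0 _]/= .
apply: (@path_case V e conf A e_sym conf_sym conf_refl D s0 nbhd_le conf_le ell Qn theta
  seg_fam _ _ _ _ _ k Q c (f0 (q 0)) (seg_mid f0) (f0 (q ell))) => //.
- move=> w m v /seg_famP[f fR [<- <- <-]]; have femb := R_emb fR; split.
  + by rewrite size_map size_iota.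
  + have := path_map_iota (e := e) (g := f \o q) (a := 0) (n := ell).
    rewrite -[ell in iota _ ell](prednK (ltnW ell_gt1)) iota_rcons map_rcons /= add1n.
    by rewrite (prednK (ltnW ell_gt1)); apply=> t /= tl; apply: q_adj.
  + rewrite cat_mid map_inj_in_uniq ?iota_uniq // => s t.
    rewrite !mem_iota /= !add0n !ltnS => sl tl E; apply: q_inj => //.
    apply/eqP; apply: contraT => ne; move: femb => /and3P[_ _ /forall_inP fc].
    by have /forall_inP/(_ (q t) (in_setT _)) := fc (q s) (in_setT _); rewrite ne E conf_refl.
  + move=> x; rewrite cat_mid => /mapP[t _ ->].
    by move: femb => /and3P[/forall_inP fA _ _]; apply: fA.
- move=> w m v X /seg_famP[f fR [<- _ <-]] hX.
  have [g [gR gf gX]] := R_avoid fR hX; exists (seg_mid g).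
    by apply/seg_famP; exists g => //; rewrite !gf.
  move=> x /mapP[t]; rewrite mem_iota => /andP[t0 tl] ->; apply/gX/qK.
  by rewrite t0 /=; move: tl ell_gt1; clear; lia.
- move=> w m v /seg_famP[f fR [<- <- _]]; apply: leq_trans (R_ext1 fR) _.
  apply: subset_leq_card; apply/subsetP => x /imsetP[g /setIdP[gR /restrP gf] ->].
  rewrite inE; apply/seg_famP; exists g => //.
  have gq t : t < ell -> g (q t) = f (q t) by move=> tl; apply/gf/seg_setP.
  by split=> //; [apply: gq; apply: ltnW|apply: seg_midE => t /andP[_]; apply: gq].
- move=> w m v /seg_famP[f fR [_ <- <-]]; apply: leq_trans (R_ext0 fR) _.
  apply: subset_leq_card; apply/subsetP => x /imsetP[g /setIdP[gR /restrP gf] ->].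
  rewrite inE; apply/seg_famP; exists g => //.
  have gq t : 0 < t <= ell -> g (q t) = f (q t).
    by move=> /andP[t0 tl]; apply/gf/seg_setP; rewrite t0 add1n ltnS.
  split=> //; last by apply: gq; rewrite leqnn andbT ltnW.
  by apply: seg_midE => t /andP[t0 tl]; apply: gq; rewrite t0 ltnW.
- by apply/seg_famP; exists f0.
- move=> ell2 w m y v /seg_famP[f fR [<- Em _]]; apply: leq_trans (R_ext2 fR) _.
  have midE (g : {ffun P -> V}) :
      seg_mid g = rcons [seq g (q t) | t <- iota 1 ell.-2] (g (q ell.-1)).
    rewrite /seg_mid -[ell.-1](@prednK) ?iota_rcons ?map_rcons ?add1n //.
    by move: ell2; clear; lia.
  move: Em; rewrite midE => /rcons_inj[Em _].
  apply: subset_leq_card; apply/subsetP => x /imsetP[g /setIdP[gR /restrP gf] ->].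
  have gq t : t < ell.-1 -> g (q t) = f (q t) by move=> tl; apply/gf/seg_setP.
  rewrite inE; apply/existsP; exists (g (q ell)); apply/seg_famP; exists g => //.
  split=> //; first by apply: gq; move: ell_gt1; clear; lia.
  rewrite midE -Em; congr rcons; apply/eq_in_map => t; rewrite mem_iota => /andP[t0 tl].
  by apply: gq; move: tl ell2; clear; lia.
Qed.

End Segment.
End Assembly.

(** * Almost regular graphs *)

Section Regular.
Variables (k' s0 K0 Q : nat).
Hypotheses (k'_gt0 : 0 < k') (K0_gt0 : 0 < K0).
Local Notation k := k'.+1.
Local Notation P := (spider_pos k').

(** All constants depend on the loss [W], because [theta] is about [d / W]. Here 28 is twice 7 for
    the factor in [2 * D], and twice again for the rounding in [theta]; in [spread_cst] the 2 is the
    half lost in cleaning. In [init_loss], [2 ^ (3 * k)] pays for [d / 2] choices per position and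
    one more 2 for discarding small classes. The [3 * k - 2] positions are all but the three
    leaves. *)
Definition ratio_cst W := 28 * K0 ^ (3 * k).+1 * W.
Definition avoid_cst W := Q + 5 * k + 10 + (2 * s0 + Q + 5) * ratio_cst W +
  (Q + 2 * k + 7) * ratio_cst W ^ (Q + 4).+2.
Definition spread_cst W := 2 * (#|P| * avoid_cst W).+1.
Definition theta_cst W := Q + 5 * k + 10 + 2 * ((Q + 4) * s0) + ratio_cst W ^ 3 * (Q + 4).
Definition init_loss := 2 ^ (3 * k).+1.
Definition loss_cst := loss_bound P spread_cst (3 * k - 2) init_loss.
Definition class_cst := class_bound P spread_cst (3 * k - 2) init_loss.
Definition deg_cst := 7 * K0 ^ (3 * k) * loss_cst * (theta_cst loss_cst).+1 + 2 * (#|P| * s0) + 1.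
Definition regular_cst := deg_cst ^ (3 * k) + class_cst * init_loss.

Variables (V : finType) (e conf : rel V) (A : {set V}) (d : nat).
Hypotheses (e_sym : symmetric e) (conf_sym : symmetric conf) (conf_refl : reflexive conf).
Local Notation D := (K0 * d).
Hypothesis nbhd_ge : forall x, x \in A -> d <= #|nbhd e A x|.
Hypothesis nbhd_le : forall x, x \in A -> #|nbhd e A x| <= D.
Hypothesis conf_le : forall y z, y \in A -> #|[set w in nbhd e A y | conf w z]| <= s0.
Hypothesis A_gt0 : 0 < #|A|.
Hypothesis hreg : regular_cst * #|A| ^ 2 <= d ^ (3 * k).

Local Notation is_emb := (emb e conf A (None : P) (@spar k') setT).
Local Notation goal := (exists u : 'I_3 -> V,
  (forall i j, i != j -> ~~ conf (u i) (u j)) /\ spider_rich e k Q u).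

Lemma deg_cst_le : deg_cst <= d.
Proof.
have k0 : 0 < 3 * k by [].
rewrite -(leq_exp2r _ _ k0); apply: leq_trans hreg.
apply: leq_trans (_ : deg_cst ^ (3 * k) * #|A| ^ 2 <= _).
  by rewrite leq_pmulr // expn_gt0 A_gt0.
by rewrite leq_mul2r /regular_cst leq_addr orbT.
Qed.

Lemma d_gt0 : 0 < d.
Proof. by apply: leq_trans deg_cst_le; rewrite /deg_cst addn1. Qed.

Lemma ratio_mono W W' : W <= W' -> ratio_cst W <= ratio_cst W'.
Proof. by move=> h; rewrite leq_mul2l h orbT. Qed.

Lemma theta_mono W W' : W <= W' -> theta_cst W <= theta_cst W'.
Proof.
move=> h; rewrite leq_add2l leq_mul2r; apply/orP; right.
by rewrite leq_exp2r // ratio_mono.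
Qed.

Section Spread.
Variables (S : {set {ffun P -> V}}) (K : {set P}) (W : nat).
Hypothesis S_emb : forall f, f \in S -> is_emb f.
Hypothesis S_spread : forall f, f \in S -> spread (spread_cst W) K S f.
Hypothesis S_large : #|A| * d ^ (3 * k) <= W * #|S|.
Hypothesis W_le : W <= loss_cst.

Let theta := d %/ (7 * K0 ^ (3 * k) * W).

Lemma W_gt0 : 0 < W.
Proof.
case: (posnP W) S_large => // ->; rewrite mul0n leqNgt.
by rewrite muln_gt0 A_gt0 expn_gt0 d_gt0.
Qed.

Lemma theta_ge : theta_cst W < theta.
Proof.
apply: leq_trans (_ : (theta_cst loss_cst).+1 <= _); first by rewrite ltnS theta_mono.
have c0 : 0 < 7 * K0 ^ (3 * k) * W by rewrite !muln_gt0 expn_gt0 K0_gt0 W_gt0.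
rewrite leq_divRL //; apply: leq_trans deg_cst_le; rewrite /deg_cst -addnA.
apply: leq_trans (leq_addr _ _); rewrite mulnC leq_mul2r; apply/orP; right.
by rewrite leq_mul2l W_le orbT.
Qed.

Lemma ratio_ok : 2 * D <= ratio_cst W * theta.
Proof.
set c1 := 7 * K0 ^ (3 * k) * W.
have c0 : 0 < c1 by rewrite !muln_gt0 expn_gt0 K0_gt0 W_gt0.
have h := ltn_ceil d c0; rewrite -/theta in h.
have t1 : 0 < theta by apply: leq_ltn_trans theta_ge.
have h2 : d <= 2 * theta * c1.
  by apply: leq_trans (ltnW h) _; rewrite leq_mul2r; apply/orP; right; lia.
have -> : ratio_cst W * theta = 2 * K0 * (2 * theta * c1).
  by rewrite /ratio_cst /c1 expnS; nia.
by rewrite [2 * (K0 * d)]mulnA leq_mul2l h2 orbT.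
Qed.

Lemma clean_spider_family (Dm : 'I_3 -> {set P}) (pm rt : 'I_3 -> P) :
  (forall j, rooted_at None (@spar k') (rt j) (Dm j)) -> (forall j, pm j \notin Dm j) ->
  exists R : {set {ffun P -> V}}, [/\ R != set0, forall f, f \in R -> is_emb f,
    forall f (X : {set V}), f \in R -> #|X| <= avoid_cst W ->
      exists g, [/\ g \in R, {in K, g =1 f} & forall p, p \notin K -> g p \notin X] &
    forall f j, f \in R -> theta <=
      #|(fun g : {ffun P -> V} => g (pm j)) @: [set g in R | restr (Dm j) g == restr (Dm j) f]|].
Proof.
move=> hrt hpm.
have [|R [RS R0 Rav Rext]] := clean_family e_sym nbhd_le d_gt0 K0_gt0 S_emb S_spread S_large
  A_gt0 (theta := theta) _ hrt hpm; first exact: leq_trunc_div.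
exists R; split=> //; first by move=> f /(subsetP RS)/S_emb.
by move=> f X fR hX; apply: Rav => //; rewrite ltnS leq_mul2l hX orbT.
Qed.

Lemma theta_facts : [/\ Q + 5 * k + 10 <= theta, 2 * ((Q + 4) * s0) <= theta &
  ratio_cst W ^ 3 * (Q + 4) <= theta].
Proof.
have := ltnW theta_ge; rewrite /theta_cst.
move: (ratio_cst W ^ 3 * (Q + 4)) (2 * ((Q + 4) * s0)) => x y h.
by split; move: h; clear; lia.
Qed.

Lemma avoid_facts : Q + 5 * k + 10 <= avoid_cst W /\
  (2 * s0 + Q + 5) * ratio_cst W + (Q + 2 * k + 7) * ratio_cst W ^ (Q + 4).+2 <= avoid_cst W.
Proof.
rewrite /avoid_cst; split; first by rewrite -[X in _ <= X]addnA leq_addr.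
by rewrite -[X in _ <= X]addnA leq_addl.
Qed.

Lemma segment_final ell (q : nat -> P) (rt : 'I_3 -> P) :
  1 < ell -> ell <= k -> {in [pred t | t <= ell] &, injective q} ->
  (forall f t, is_emb f -> t < ell -> e (f (q t)) (f (q t.+1))) ->
  q 0 \in K -> q ell \in K -> (forall t, 0 < t < ell -> q t \notin K) ->
  rooted_at None (@spar k') (rt ord0) (seg_set q 1 ell) ->
  rooted_at None (@spar k') (rt (inord 1)) (seg_set q 0 ell) ->
  rooted_at None (@spar k') (rt (inord 2)) (seg_set q 0 ell.-1) -> goal.
Proof.
move=> ell1 ellk q_inj q_adj q0K qlK qK rt0 rt1 rt2.
(* The third group omits the last end as well: when the vertex before it varies, that end has to be
   free to follow. *)
pose Dm (j : 'I_3) := nth set0 [:: seg_set q 1 ell; seg_set q 0 ell; seg_set q 0 ell.-1] j.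
pose pm (j : 'I_3) := nth None [:: q 0; q ell; q ell.-1] j.
have o1 : nat_of_ord (inord 1 : 'I_3) = 1 by rewrite inordK.
have o2 : nat_of_ord (inord 2 : 'I_3) = 2 by rewrite inordK.
have I3 (j : 'I_3) : [\/ j = ord0, j = inord 1 | j = inord 2].
  by case: j => [[|[|[|//]]] hj]; [apply: Or31|apply: Or32|apply: Or33];
     apply: val_inj; rewrite /= ?o1 ?o2.
have notin a n t : t <= ell -> (t < a) || (a + n <= t) -> a + n <= ell.+1 ->
    q t \notin seg_set q a n.
  move=> tl ht an; rewrite inE; apply/negP => /mapP[s]; rewrite mem_iota => /andP[s1 s2].
  move=> /q_inj E; have {}E : t = s.
    by apply: E => //; rewrite inE; move: s2 an; clear; lia.
  by move: ht s1 s2; rewrite E; clear; lia.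
have [j|j|R [R0 Remb Rav Rext]] := clean_spider_family (Dm := Dm) (pm := pm) (rt := rt).
- by case: (I3 j) => ->; rewrite /Dm ?o1 ?o2.
- by case: (I3 j) => ->; rewrite /Dm /pm ?o1 ?o2 /=; apply: notin; move: ell1; clear; lia.
have [t1 t2 t3] := theta_facts; have [a1 a2] := avoid_facts.
apply: (@segment_case k' V e conf A e_sym conf_sym conf_refl d K0 s0 nbhd_le conf_le
  R K (avoid_cst W) theta ell q Remb q_inj q_adj q0K qlK qK ell1 Rav _ _ _ Q (ratio_cst W)) => //.
- by move=> f fR; have := Rext f ord0 fR; rewrite /pm /Dm.
- by move=> f fR; have := Rext f (inord 1) fR; rewrite /pm /Dm o1.
- by move=> f fR; have := Rext f (inord 2) fR; rewrite /pm /Dm o2.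
- by move: a1; clear; lia.
- by move: t1; clear; lia.
- exact: ratio_ok.
Qed.

Lemma emb_spos_adj f i t : is_emb f -> t < k -> e (f (spos k' i t)) (f (spos k' i t.+1)).
Proof.
move=> /and3P[_ /forall_inP fe _] tk.
have := fe (spos k' i t.+1) (in_setT _); rewrite in_setT andbT spar_spos //.
Qed.

Lemma leg_gap i a b : a.+1 < b -> b <= k -> spos k' i a \in K -> spos k' i b \in K ->
  (forall t, a < t < b -> spos k' i t \notin K) -> goal.
Proof.
move=> ab bk aK bK hK.
pose q t := spos k' i (a + t).
have rtq s n : 0 < n -> s + n <= (b - a).+1 ->
    rooted_at None (@spar k') (q s) (seg_set q s n).
  move=> n0 sn; split; first by apply: seg_setP; rewrite leqnn -addn1 leq_add2l.
  move=> p; rewrite inE => /mapP[t]; rewrite mem_iota => /andP[st tn] -> ne.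
  have st' : s < t by rewrite ltn_neqAle st andbT; apply: contraNneq ne => ->.
  case: t st tn ne st' => // t st tn ne st'; split; first by rewrite /q addnS.
  rewrite /q addnS spar_spos; last by move: tn sn ab bk; clear; lia.
  by apply: seg_setP; rewrite -ltnS st' /= ltnW.
apply: (@segment_final (b - a) q (fun j : 'I_3 => if j == ord0 then q 1 else q 0)).
- by move: ab; clear; lia.
- by move: bk; clear; lia.
- move=> s t; rewrite !inE => sl tl /eqP; rewrite /q spos_eq; first by rewrite eqn_add2l => /eqP.
  + by move: sl ab bk; clear; lia.
  + by move: tl ab bk; clear; lia.
- by move=> f t fe tl; rewrite /q addnS; apply: emb_spos_adj => //; move: tl ab bk; clear; lia.
- by rewrite /q addn0.
- by rewrite /q subnKC // ltnW // ltnW.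
- by move=> t /andP[t0 tl]; apply: hK; move: t0 tl; clear; lia.
- by rewrite eqxx; apply: rtq; move: ab; clear; lia.
- by rewrite -val_eqE /= inordK //; apply: rtq; move: ab; clear; lia.
- by rewrite -val_eqE /= inordK //; apply: rtq; move: ab; clear; lia.
Qed.

Lemma vee_gap i j : i != j -> None \notin K -> spos k' i 1 \in K -> spos k' j 1 \in K -> goal.
Proof.
move=> ij nK iK jK.
pose q t := if t is t'.+1 then (if t' is _.+1 then spos k' j 1 else None) else spos k' i 1.
have par1 l : spar (spos k' l 1) = None by rewrite spar_spos.
have rtN (E : {set P}) : None \in E ->
    (forall p, p \in E -> [\/ p = None, p = spos k' i 1 | p = spos k' j 1]) ->
    rooted_at None (@spar k') None E.
  move=> nE hE; split=> // p pE pn; split=> //.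
  by case: (hE p pE) pn => -> //; rewrite par1.
have mem3 a n p : p \in seg_set q a n -> [\/ p = None, p = spos k' i 1 | p = spos k' j 1].
  rewrite inE => /mapP[[|[|t]] _ ->] /=; [exact: Or32|exact: Or31|exact: Or33].
have ne l : spos k' l 1 != None by [].
apply: (@segment_final 2 q (fun l : 'I_3 => if l == inord 2 then spos k' i 1 else None)) => //.
- move=> [|[|[|//]]] [|[|[|//]]] //= _ _.
  + by move=> E; have [E2 _] := spos_inj (isT : 1 <= k) (isT : 1 <= k) isT E; rewrite E2 eqxx in ij.
  + by move=> E; have [E2 _] := spos_inj (isT : 1 <= k) (isT : 1 <= k) isT E; rewrite E2 eqxx in ij.
- move=> f [|[|//]] fe _ /=; last exact: (emb_spos_adj j (t := 0) fe).
  by rewrite e_sym; apply: (emb_spos_adj i (t := 0) fe).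
- by move=> [|[|[|//]]].
- rewrite -val_eqE /= inordK //; apply: rtN => [|p]; last exact: mem3.
  exact: (seg_setP q (a := 1) (n := 2) (t := 1)).
- rewrite -val_eqE /= !inordK //; apply: rtN => [|p]; last exact: mem3.
  exact: (seg_setP q (a := 0) (n := 2) (t := 1)).
- rewrite eqxx; split; first exact: (seg_setP q (a := 0) (n := 1) (t := 0)).
  by move=> p; rewrite inE /= inE => /eqP ->; rewrite eqxx.
Qed.

Lemma spider_final : None \notin K -> (forall i, spos k' i k \in K) ->
  (forall i j, spos k' i 1 \in K -> spos k' j 1 \in K -> i = j) -> goal.
Proof.
move=> nK lK one.
have ex i : exists t, (0 < t) && (spos k' i t \in K) by exists k; rewrite lK.
pose tl i := ex_minn (ex i).
have tl1 i : 0 < tl i /\ spos k' i (tl i) \in K.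
  by rewrite /tl; case: ex_minnP => t /andP[].
have tlmin i t : 0 < t -> spos k' i t \in K -> tl i <= t.
  by move=> t0 tK; rewrite /tl; case: ex_minnP => s _; apply; rewrite t0.
have tlb i : 0 < tl i <= k by rewrite (tl1 i).1 /= tlmin.
have tlK i := (tl1 i).2.
have tlnK i t : t < tl i -> spos k' i t \notin K.
  case: t => [//|t] tt; apply/negP => tK; have := tlmin i t.+1 isT tK.
  by rewrite leqNgt tt.
have tlone i j : tl i = 1 -> tl j = 1 -> i = j.
  by move=> ti tj; apply: one; [rewrite -ti|rewrite -tj].
have [j|j|R [/set0Pn[f0 f0R] Remb Rav Rext]] := clean_spider_family (Dm := core_but k' tl)
  (pm := fun i => spos k' i (tl i)) (rt := fun _ => None).
- have tj0 : None != spos k' j (tl j) by case: (tl j) (tl1 j).1.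
  split; first by rewrite inE tj0.
  case=> // -[l a]; rewrite inE => /andP[al ne] _; split=> //=.
  apply: core_butP => //; first exact: ltnW.
  have [a0|a0] := posnP (a : nat); first by rewrite a0.
  apply/eqP => E; have [ak tk] : (a : nat) <= k /\ tl j <= k.
    by split; [apply: ltnW|case/andP: (tlb j)].
  by have [E1 E2] := spos_inj ak tk a0 E; move: al; rewrite E1 E2 ltnn.
- by rewrite inE eqxx andbF.
have [t1 _ _] := theta_facts; have [a1 _] := avoid_facts.
have hQ : Q + 4 * k + 10 <= avoid_cst W by move: a1; clear; lia.
have ht : Q + 4 * k + 10 <= theta by move: t1; clear; lia.
exists (fun i => f0 (spos k' i (tl i - odd (k - tl i)))); split.
  move=> i j ij; apply: (R_conf Remb f0R); exact: start_neq.
move=> X hX.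
exact: (spider_found e_sym conf_refl Remb tlb tlK tlnK Rav Rext hQ ht f0R hX).
Qed.

Lemma spread_final : K != setT -> (forall i, spos k' i k \in K) -> goal.
Proof.
move=> KT lK; have [nK|nK] := boolP (None \in K); last first.
  have [[i j] /and3P[/= ij iK jK]|no] := pickP [pred x : 'I_3 * 'I_3 |
     [&& x.1 != x.2, spos k' x.1 1 \in K & spos k' x.2 1 \in K]].
    exact: vee_gap ij nK iK jK.
  apply: spider_final => // i j iK jK; apply/eqP; have := no (i, j).
  by rewrite /= iK jK !andbT => /negbFE.
(* With the centre in [K] and all leaves in [K], a position missing from [K] lies on a leg strictly
   between two consecutive positions of [K]. *)
have [p pK] : exists p, p \notin K.
  have /set0Pn[p] : ~: K != set0 by apply: contra KT => /eqP h; rewrite -[K]setCK h setC0.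
  by rewrite inE => pK; exists p.
have [i [t [t0 tk Ep]]] : exists i t, [/\ 0 < t, t <= k & p = spos k' i t].
  by apply: sposP; apply: contraNneq pK => ->.
have tK : spos k' i t \notin K by rewrite -Ep.
have exa : exists s, (s <= t) && (spos k' i s \in K) by exists 0.
have exb : exists s, (t <= s) && (spos k' i s \in K) by exists k; rewrite tk lK.
have hub s : (s <= t) && (spos k' i s \in K) -> s <= t by case/andP.
case: (ex_maxnP exa hub) => a /andP[at1 aK] amax.
case: (ex_minnP exb) => b /andP[tb bK] bmin.
have at2 : a < t by rewrite ltn_neqAle at1 andbT; apply: contraNneq tK => <-.
have tb2 : t < b by rewrite ltn_neqAle tb andbT; apply: contraNneq tK => ->.
apply: (leg_gap (i := i) (a := a) (b := b)) => //.
- exact: leq_ltn_trans tb2.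
- by apply: bmin; rewrite tk lK.
move=> s /andP[as1 sb]; apply/negP => sK.
have [st|st] := leqP s t.
  by have := amax s; rewrite st sK leqNgt as1 => /(_ isT).
by have := bmin s; rewrite (ltnW st) sK leqNgt sb => /(_ isT).
Qed.

End Spread.

(** There are at most [#|A| ^ 3] leaf triples, so embeddings in leaf classes smaller than
    [class_cst] number at most [class_cst * #|A| ^ 3]. The bound on [d ^ (3 * k)] makes this at most
    half of the total, and the sunflower starts with [K] the set of leaves. *)
Lemma regular_case : goal.
Proof.
have [v0 v0A] : exists v, v \in A by apply/card_gt0P.
pose S := embs e conf A (None : P) (@spar k') setT v0.
pose L : {set P} := [set spos k' i k | i : 'I_3].
have cS : #|A| * d ^ (3 * k) <= 2 ^ (3 * k) * #|S|.
  have := embs_count (@sdep_par k') conf_sym nbhd_ge conf_le v0 (n := 3 * k) (E := setT).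
  rewrite cardsT card_spider_pos => /(_ erefl (in_setT _)).
  move=> /(_ (fun _ _ _ => in_setT _)) h.
  apply: leq_trans (_ : 2 ^ (3 * k) * (#|A| * (d - (3 * k).+1 * s0) ^ (3 * k)) <= _).
    rewrite mulnCA -expnMn leq_mul2l; apply/orP; right; rewrite leq_exp2r //.
    have := deg_cst_le; rewrite /deg_cst card_spider_pos -addnA => h1.
    have := leq_trans (leq_addl _ _) h1; move: (_ * s0) => x; clear; lia.
  by rewrite leq_mul2l h orbT.
have Semb f : f \in S -> is_emb f by rewrite inE => /andP[].
pose S1 := [set f in S | class_cst <= #|agree_class S L f|].
have S1E f : f \in S1 -> agree_class S1 L f = agree_class S L f.
  rewrite inE => /andP[fS fc]; apply/setP => g; rewrite !inE.
  case: (boolP (_ == _)) => gf; rewrite ?andbF // !andbT.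
  by rewrite (agree_class_eq _ gf) fc andbT.
have lost : #|S :\: S1| <= class_cst * #|A| ^ 3.
  have h1 : #|restr L @: (S :\: S1)| <= #|A| ^ 3.
    have -> : #|A| ^ 3 = #|[set g : {ffun 'I_3 -> V} | g \in ffun_on (mem A)]|.
      by rewrite cardsE card_ffun_on card_ord.
    pose phi (g : {ffun 'I_3 -> V}) : {ffun P -> option V} :=
      [ffun p => if p \in L then (if p is Some (i, _) then Some (g i) else None) else None].
    apply: leq_trans (leq_imset_card phi _); apply: subset_leq_card.
    apply/subsetP => x /imsetP[f]; rewrite inE => /andP[_ fS] ->.
    have /and3P[/forall_inP fA _ _] := Semb f fS.
    apply/imsetP; exists [ffun i => f (spos k' i k)].
      by rewrite inE; apply/ffun_onP => i; rewrite ffunE; apply: fA.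
    apply/ffunP => p; rewrite !ffunE; case: ifP => // /imsetP[i _ ->].
    by rewrite /= ffunE.
  apply: leq_trans (_ : class_cst * #|restr L @: (S :\: S1)| <= _); last first.
    by rewrite leq_mul2l h1 orbT.
  rewrite -sum1_card (partition_big_imset (restr L)) /= mulnC -sum_nat_const.
  apply: leq_sum => x /imsetP[f]; rewrite !inE => /andP[nf fS] ->; rewrite sum1dep_card.
  apply: leq_trans (_ : #|agree_class S L f| <= _).
    by apply: subset_leq_card; apply/subsetP => g; rewrite !inE => /andP[/andP[_ ->] ->].
  by move: nf; rewrite fS /= -ltnNge => /ltnW.
have cS1 : #|A| * d ^ (3 * k) <= init_loss * #|S1|.
  have E := cardsID S1 S; rewrite (setIidPr _) in E; last first.
    by apply/subsetP => f; rewrite inE => /andP[].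
  have h : init_loss * (class_cst * #|A| ^ 3) <= #|A| * d ^ (3 * k).
    have -> : init_loss * (class_cst * #|A| ^ 3) = #|A| * (init_loss * class_cst * #|A| ^ 2).
      by rewrite [#|A| ^ 3]expnS mulnA mulnCA.
    rewrite leq_mul2l; apply/orP; right.
    apply: leq_trans hreg; rewrite leq_mul2r; apply/orP; right.
    by rewrite mulnC /regular_cst leq_addl.
  have h2 := leq_trans (leq_mul (leqnn init_loss) lost) h.
  have E2 : init_loss = 2 * 2 ^ (3 * k) by rewrite /init_loss expnS.
  move: cS h2; rewrite E2 -E !mulnDr; move: (2 ^ _) (#|A| * _) => x y; clear; lia.
have L3 : #|~: L| = 3 * k - 2.
  have : #|L| = 3.
    rewrite card_imset ?card_ord // => i j E.
    by have [] := spos_inj (leqnn k) (leqnn k) isT E.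
  by have := cardsC L; rewrite card_spider_pos => E c3; move: E; rewrite c3; clear; lia.
have [||f fS1|K [S2 [W [[LK KT S21] [SW WW sp]]]]] :=
  sunflower (G := spread_cst) _ L3 _ cS1.
- by [].
- by rewrite muln_gt0 A_gt0 expn_gt0 d_gt0.
- by rewrite S1E //; move: fS1; rewrite inE => /andP[].
apply: (spread_final (S := S2) (K := K) (W := W)) => //.
- by move=> f /(subsetP S21); rewrite inE => /andP[/Semb].
- by move=> i; apply: (subsetP LK); apply: imset_f.
Qed.

End Regular.

(** * Regularization *)

Import Order.TTheory GRing.Theory Num.Theory.

Lemma max_ratio (T : finType) (P : pred T) (f g : T -> nat) x0 :
  P x0 -> (forall x, P x -> 0 < g x) ->
  exists2 x, P x & forall y, P y -> f y * g x <= f x * g y.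
Proof.
move=> Px0 g0; pose F x := ((f x)%:R / (g x)%:R : rat)%R.
case: (arg_maxP F Px0) => x Px xmax; exists x => // y Py.
have : (F y <= F x)%R := xmax y Py; rewrite /F.
rewrite ler_pdivrMr; last by rewrite ltr0n g0.
rewrite mulrAC ler_pdivlMr; last by rewrite ltr0n g0.
by rewrite -!natrM ler_nat.
Qed.

(** Deleting a lightest element never lowers the average weight. *)
Lemma heavy_subset (T : finType) (w : T -> nat) (A : {set T}) h : 0 < h <= #|A| ->
  exists B : {set T}, [/\ B \subset A, #|B| = h &
    h * \sum_(y in A) w y <= #|A| * \sum_(y in B) w y].
Proof.
elim: {A}_.+1 {-2}A (ltnSn #|A|) => // N IH A; rewrite ltnS => AN /andP[h0 hA].
have [E|hA'] := eqVneq h #|A|; first by exists A; rewrite E.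
have {}hA : h < #|A| by rewrite ltn_neqAle hA' hA.
have [a0 a0A] : exists a, a \in A by apply/card_gt0P; apply: leq_ltn_trans hA.
case: (arg_minnP w a0A) => a aA amin; have {}aA : a \in A := aA.
have cA := cardsD1 a A; rewrite aA add1n in cA.
have [||B [BA Bh hB]] := IH (A :\ a).
- by move: AN; rewrite cA.
- by rewrite h0 -ltnS -cA.
exists B; split=> //; first by apply: subset_trans BA (subsetDl _ _).
have c0 : 0 < #|A :\ a| by apply: leq_trans h0 _; rewrite -ltnS -cA.
rewrite -(leq_pmul2l c0).
have wa : #|A :\ a| * w a <= \sum_(y in A :\ a) w y.
  rewrite -sum_nat_const; apply: leq_sum => y; rewrite inE => /andP[_ yA]; exact: amin.
rewrite (big_setD1 a) //= cA.
move: hB wa; move: #|A :\ a| (\sum_(y in A :\ a) w y) (\sum_(y in B) w y) (w a) => m x y z.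
clear => h1 h2.
apply: leq_trans (_ : h * (m.+1 * x) <= _); first nia.
by nia.
Qed.

Section Regularization.
Variables (V : finType) (e : rel V).
Hypothesis e_sym : symmetric e.

Definition arcs (A B : {set V}) := \sum_(x in A) #|nbhd e B x|.

Lemma arcsC A B : arcs A B = arcs B A.
Proof.
have E X Y : arcs X Y = \sum_(x in X) \sum_(y in Y) (e x y : nat).
  apply: eq_bigr => x _; rewrite -sum1dep_card big_mkcondr /=.
  by apply: eq_bigr => y _; case: (e x y).
by rewrite !E exchange_big /=; do 2!apply: eq_bigr => ? _; rewrite e_sym.
Qed.

Lemma nbhdS (A B : {set V}) x : A \subset B -> nbhd e A x \subset nbhd e B x.
Proof. by move=> AB; apply/subsetP => y; rewrite !inE => /andP[/(subsetP AB)-> ->]. Qed.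

Lemma arcsS (A B A' B' : {set V}) : A \subset A' -> B \subset B' -> arcs A B <= arcs A' B'.
Proof.
move=> AA BB; apply: leq_trans (_ : arcs A B' <= _).
  by apply: leq_sum => x _; apply/subset_leq_card/nbhdS.
rewrite /arcs [X in _ <= X](big_setID A) /= (setIidPr AA); exact: leq_addr.
Qed.

Lemma arcs_setD (A H : {set V}) : H \subset A -> arcs A A <= arcs (A :\: H) (A :\: H) + 2 * arcs H A.
Proof.
move=> HA; have E B : arcs A B = arcs H B + arcs (A :\: H) B.
  by rewrite /arcs (big_setID H) /= (setIidPr HA).
rewrite E [arcs (A :\: H) A]arcsC E.
have := arcsS (subxx H) (subsetDl A H).
move: (arcs H A) (arcs H _) (arcs _ _) => x y z; clear; lia.
Qed.

Lemma arcs1 x A : arcs [set x] A = #|nbhd e A x|.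
Proof. by rewrite /arcs big_set1. Qed.

(** The ratio of [arcs A A ^ (3 * k)] to [#|A| ^ (3 * k + 2)] measures edges against the exponent
    [1 + 2 / (3 * k)]. A maximizer stays dense and has no denser subset, whatever its size. *)
Lemma max_density_subset k C : 0 < k -> 0 < #|V| ->
  C * #|V| ^ (3 * k + 2) <= arcs setT setT ^ (3 * k) ->
  exists A : {set V}, [/\ 0 < #|A|, C * #|A| ^ (3 * k + 2) <= arcs A A ^ (3 * k) &
    forall B : {set V}, arcs B B ^ (3 * k) * #|A| ^ (3 * k + 2)
      <= arcs A A ^ (3 * k) * #|B| ^ (3 * k + 2)].
Proof.
move=> k0 V0 hC.
have [||A A0 Amax] := @max_ratio _ [pred A : {set V} | 0 < #|A|]
  (fun A => arcs A A ^ (3 * k)) (fun A => #|A| ^ (3 * k + 2)) setT.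
- by rewrite /= cardsT.
- by move=> B; rewrite /= => B0; rewrite expn_gt0 B0.
exists A; split=> // [|B].
  have := Amax setT; rewrite /= cardsT => /(_ V0) h.
  have n0 : 0 < #|V| ^ (3 * k + 2) by rewrite expn_gt0 V0.
  rewrite -(leq_pmul2r n0); apply: leq_trans h.
  by rewrite mulnAC leq_mul2r hC orbT.
have [B0|B0] := posnP #|B|; last exact: Amax.
have -> : B = set0 by apply/eqP; rewrite -cards_eq0 B0.
by rewrite /arcs big_set0 exp0n // muln_gt0.
Qed.

Section Prune.
Variables (k : nat) (A : {set V}).
Hypotheses (k_gt0 : 0 < k) (A_gt0 : 0 < #|A|).
Local Notation N := #|A|.
Local Notation M := (arcs A A).
Hypothesis M_gt0 : 0 < M.
Hypothesis A_max : forall B : {set V}, arcs B B ^ (3 * k) * N ^ (3 * k + 2)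
  <= M ^ (3 * k) * #|B| ^ (3 * k + 2).

(** The value for which the exchange argument closes: its square is [16 ^ (3 * k) * 4]. It is
    compared with the average degree, the quotient of [arcs A A] by [#|A|]. *)
Definition max_deg_cst := 2 ^ (6 * k).+1.
Definition heavy := [set x in A | max_deg_cst * M < N * #|nbhd e A x|].

Lemma heavy_small : max_deg_cst * #|heavy| <= N.
Proof.
rewrite -(leq_pmul2l M_gt0).
apply: leq_trans (_ : \sum_(x in heavy) N * #|nbhd e A x| <= _).
  rewrite mulnCA mulnC [M * _]mulnC -mulnA [M * _]mulnC -sum_nat_const.
  by apply: leq_sum => x; rewrite inE => /andP[_ /ltnW].
rewrite -big_distrr /= mulnC leq_mul2r; apply/orP; right.
by apply: (arcsS (B := A) (B' := A)) => //; apply/subsetP => x; rewrite inE => /andP[].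
Qed.

(* An exchange argument: the [#|heavy|] best targets of [heavy] together with
   [heavy] would otherwise form a set denser than [A]. *)
Lemma heavy_arcs : 8 * arcs heavy A <= M.
Proof.
have HA : heavy \subset A by apply/subsetP => x; rewrite inE => /andP[].
have [h0|h0] := posnP #|heavy|.
  have -> : heavy = set0 by apply/eqP; rewrite -cards_eq0 h0.
  by rewrite /arcs big_set0 muln0.
have hsm := heavy_small.
have [|B [BA Bh hB]] := heavy_subset (fun y => #|nbhd e heavy y|) (A := A) (h := #|heavy|).
  by rewrite h0 subset_leq_card.
rewrite -/(arcs A heavy) -/(arcs B heavy) !(arcsC _ heavy) in hB.
pose U := heavy :|: B.
have hU : arcs heavy B <= arcs U U by apply: arcsS; [apply: subsetUl|apply: subsetUr].
have cU : #|U| <= 2 * #|heavy| by rewrite mul2n -addnn -[X in _ + X]Bh cardsU_le.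
suff h8 : 8 * N * arcs heavy B <= #|heavy| * M.
  rewrite -(leq_pmul2l h0) mulnCA; apply: leq_trans h8.
  by rewrite -mulnA leq_mul2l hB orbT.
apply: leq_trans (leq_mul (leqnn _) hU) _; rewrite leqNgt; apply/negP => hlt.
have hmax := A_max U.
have k3 : 0 < 3 * k by rewrite muln_gt0.
have Uh : #|U| ^ (3 * k + 2) <= (2 * #|heavy|) ^ (3 * k + 2) by rewrite leq_exp2r // addn2.
have {}hmax := leq_trans hmax (leq_mul (leqnn _) Uh).
have := hlt; rewrite -(ltn_exp2r _ _ k3) => {}hlt.
have N2 : 0 < N ^ 2 by rewrite expn_gt0 A_gt0.
have : (#|heavy| * M) ^ (3 * k) * N ^ 2 < (#|heavy| * M) ^ (3 * k) * (max_deg_cst * #|heavy|) ^ 2.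
  apply: leq_trans (_ : (8 * N * arcs U U) ^ (3 * k) * N ^ 2 <= _); first by rewrite ltn_pmul2r.
  have -> : (8 * N * arcs U U) ^ (3 * k) * N ^ 2 =
      8 ^ (3 * k) * (arcs U U ^ (3 * k) * N ^ (3 * k + 2)).
    by rewrite !expnMn expnD; move: (8 ^ _) (N ^ _) (arcs _ _ ^ _) (N ^ 2) => a b c d; clear; lia.
  have -> : (#|heavy| * M) ^ (3 * k) * (max_deg_cst * #|heavy|) ^ 2 =
      8 ^ (3 * k) * (M ^ (3 * k) * (2 * #|heavy|) ^ (3 * k + 2)).
    rewrite [(max_deg_cst * _) ^ 2]expnMn.
    have -> : max_deg_cst ^ 2 = (8 * 2) ^ (3 * k) * 2 ^ 2.
      by rewrite (_ : 8 * 2 = 2 ^ 4) // -(expnM 2 4) /max_deg_cst -expnM -expnD; congr (2 ^ _); lia.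
    rewrite !expnMn !expnD; move: (8 ^ _) (2 ^ (3 * k)) (#|heavy| ^ (3 * k)) (M ^ _) => a b c d.
    by move: (2 ^ 2) (#|heavy| ^ 2) => x y; clear; lia.
  by rewrite leq_mul2l hmax orbT.
rewrite ltn_pmul2l ?expn_gt0 ?muln_gt0 ?h0 ?M_gt0 // ltn_exp2r // ltnNge.
by rewrite hsm.
Qed.

(** [B] maximizes [4 * N * arcs B B + M * (N - #|B|)] among subsets without heavy vertices. Deleting
    a vertex of too small degree would increase this, and the empty set loses to [A1], which still
    carries half of the arcs. *)
Lemma prune : exists B : {set V}, [/\ 0 < #|B|, B \subset A &
  forall x, x \in B -> M <= 8 * N * #|nbhd e B x| /\ N * #|nbhd e B x| <= max_deg_cst * M].
Proof.
have HA : heavy \subset A by apply/subsetP => x; rewrite inE => /andP[].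
pose A1 := A :\: heavy.
have A1A : A1 \subset A := subsetDl _ _.
have M1 : M <= 2 * arcs A1 A1.
  have := arcs_setD HA; have := heavy_arcs; rewrite -/A1.
  move: (arcs _ _) (arcs _ _) (arcs _ _) => x y z; clear; lia.
pose f (B : {set V}) := 4 * N * arcs B B + M * (N - #|B|).
case: (@arg_maxnP _ A1 (fun B : {set V} => B \subset A1) f (subxx _)) => B BA1 Bmax0.
have {Bmax0} Bmax (B' : {set V}) : B' \subset A1 -> f B' <= f B := Bmax0 B'.
have BA := subset_trans BA1 A1A.
exists B; split=> //.
  rewrite lt0n cards_eq0; apply/eqP => B0; have := Bmax A1 (subxx _).
  have a0 : arcs set0 set0 = 0 by rewrite /arcs big_set0.
  rewrite /f B0 a0 cards0 muln0 subn0 add0n leqNgt => /negP[].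
  apply: leq_trans (leq_addr _ _).
  have := leq_mul (leqnn N) M1; have : 0 < M * N by rewrite muln_gt0 M_gt0 A_gt0.
  move: (arcs A1 A1) M N => x y z; clear; nia.
move=> x xB; split; last first.
  have : x \in A1 by apply: (subsetP BA1).
  rewrite !inE => /andP[]; case: (x \in A) => //=; rewrite -leqNgt => h _.
  apply: leq_trans h; rewrite leq_mul2l; apply/orP; right.
  exact/subset_leq_card/nbhdS.
have h1 := Bmax (B :\ x) (subset_trans (subsetDl _ _) BA1).
have h2 := arcs_setD (A := B) (H := [set x]); rewrite sub1set xB arcs1 in h2.
have cB := cardsD1 x B; rewrite xB add1n in cB.
have cN := subset_leq_card BA.
move: h1 (h2 isT) cN; rewrite /f cB.
move: (arcs B B) (arcs (B :\ x) _) (#|B :\ x|) (#|nbhd e B x|) M N => a b c d m n.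
clear => h1 h2 cN.
have E : n - c = (n - c.+1).+1 by rewrite -subSn.
rewrite E mulnS in h1.
have := leq_mul (leqnn (4 * n)) h2; rewrite mulnDr.
have -> : 4 * n * (2 * d) = 8 * n * d by lia.
move: h1; move: (4 * n * a) (4 * n * b) (m * (n - c.+1)) (8 * n * d) => p q r t; lia.
Qed.

End Prune.

End Regularization.

Theorem dense_spider_rich k' s0 Q : 0 < k' ->
  exists C, 0 < C /\ forall (V : finType) (e conf : rel V),
  symmetric e -> symmetric conf -> reflexive conf ->
  (forall y z, #|[set w | e y w & conf w z]| <= s0) ->
  0 < #|V| -> C * #|V| ^ (3 * k'.+1 + 2) <= arcs e setT setT ^ (3 * k'.+1) ->
  exists u : 'I_3 -> V,
    (forall i j, i != j -> ~~ conf (u i) (u j)) /\ spider_rich e k'.+1 Q u.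
Proof.
move=> k'0; set k := k'.+1.
(* A factor 8 separates the minimum degree from the average, and rounding [d] down costs another
   2. *)
pose K0 := 16 * max_deg_cst k.
pose C := 16 ^ (3 * k) * (regular_cst k' s0 K0 Q).+1.
have K00 : 0 < K0 by rewrite muln_gt0 /= expn_gt0.
exists C; split=> [|V e conf e_sym c_sym c_refl c_le V0 hC].
  by rewrite muln_gt0 expn_gt0.
have k3 : 0 < 3 * k by [].
have [A [A0 hA Amax]] := max_density_subset (isT : 0 < k) V0 hC.
have N0 : 0 < #|A| ^ (3 * k) by rewrite expn_gt0 A0.
have M0 : 0 < arcs e A A.
  rewrite -(ltn_exp2r _ _ k3) exp0n //; apply: leq_trans hA.
  by rewrite !muln_gt0 !expn_gt0 A0.
have [B [B0 BA hB]] := prune e_sym (isT : 0 < k) A0 M0 Amax.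
pose d := arcs e A A %/ (8 * #|A|).
have MN : 16 * #|A| <= arcs e A A.
  rewrite -(leq_exp2r _ _ k3); apply: leq_trans hA.
  rewrite expnMn expnD /C -!mulnA leq_mul2l; apply/orP; right.
  by rewrite mulnCA -[X in X <= _]muln1 leq_mul2l; rewrite muln_gt0 expn_gt0 A0 orbT.
have N8 : 0 < 8 * #|A| by rewrite muln_gt0.
have d0 : 0 < d by rewrite divn_gt0 //; apply: leq_trans MN; rewrite leq_mul2r orbT.
have Md : arcs e A A <= 16 * #|A| * d.
  have := ltn_ceil (arcs e A A) N8; rewrite -/d.
  move: d0; move: (arcs e A A) d #|A| => x y z; clear; nia.
apply: (@regular_case k' s0 K0 Q k'0 K00 V e conf B d e_sym c_sym c_refl) => //.
- move=> x xB; have [h _] := hB x xB.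
  by apply: leq_trans (leq_div2r _ h) _; rewrite mulKn.
- move=> x xB; have [_ h] := hB x xB.
  rewrite -(leq_pmul2l A0); apply: leq_trans h _.
  apply: leq_trans (leq_mul (leqnn _) Md) _; rewrite /K0.
  by move: (max_deg_cst k) #|A| (d) => x1 y z; clear; lia.
- move=> y z yB; apply: leq_trans (c_le y z); apply: subset_leq_card.
  by apply/subsetP => w; rewrite !inE => /andP[/andP[_ ->] ->].
have Md3 : arcs e A A ^ (3 * k) <= 16 ^ (3 * k) * #|A| ^ (3 * k) * d ^ (3 * k).
  by rewrite -!expnMn leq_exp2r.
have c16 : 0 < 16 ^ (3 * k) * #|A| ^ (3 * k) by rewrite muln_gt0 N0 expn_gt0.
rewrite -/k -(leq_pmul2l c16); apply: leq_trans Md3; apply: leq_trans hA.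
rewrite expnD /C -!mulnA leq_mul2l; apply/orP; right.
rewrite mulnCA leq_mul //.
rewrite leq_mul2l leq_exp2r // subset_leq_card // orbT //.
Qed.

(** * Copies of subdivided bipartite graphs *)

Section FunSpiders.
Variables (V : finType) (e : rel V) (l : nat) (u : 'I_3 -> V).
Hypothesis l_gt0 : 0 < l.

Definition legs_fun := 'I_3 -> nat -> V.

Definition fun_spider (X : {set V}) (p : legs_fun) : Prop :=
  [/\ forall a, p a 0 = u a,
      forall a a', p a l = p a' l,
      forall a m, m < l -> e (p a m) (p a m.+1),
      forall a a' m m', 0 < m <= l -> 0 < m' <= l -> p a m = p a' m' ->
        m = m' /\ (a = a' \/ m = l) &
      forall a m, 0 < m <= l -> p a m \notin X /\ forall a', p a m != u a'].

Lemma fun_spider_exists Q (X : {set V}) : spider_rich e l Q u -> #|X| <= Q ->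
  exists p, fun_spider X p.
Proof.
move=> rich XQ; have [v [w [sw pw uw dw aw]]] := rich X XQ.
pose p (a : 'I_3) m := nth v (u a :: rcons (w a) v) m.
have sr a : size (rcons (w a) v) = l by rewrite size_rcons sw prednK.
have pS a m : p a m.+1 = nth v (rcons (w a) v) m by [].
have pl a : p a l = v.
  by rewrite -(prednK l_gt0) pS nth_rcons sw ltnn eqxx.
have pin a m : 0 < m <= l -> p a m \in rcons (w a) v.
  by case: m => // m ml; rewrite pS mem_nth // sr.
have pw' a m : 0 < m < l -> p a m \in w a.
  case: m => // m ml; have mw : m < size (w a) by rewrite sw; lia.
  by rewrite pS nth_rcons mw mem_nth.
have vnw a : v \notin w a by have := uw a; rewrite rcons_uniq => /andP[].
exists p; split.
- by [].
- by move=> a a'; rewrite !pl.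
- by move=> a m ml; have /(pathP v) := pw a; apply; rewrite sr.
- move=> a a' m m' hm hm' E.
  have same b n n' : 0 < n <= l -> 0 < n' <= l -> p b n = p b n' -> n = n'.
    case: n n' => [//|n] [//|n'] hn hn' /eqP; rewrite !pS nth_uniq ?sr ?uw //.
    by move/eqP ->.
  have [ml|ml] := eqVneq m l.
    move: E; rewrite ml pl -(pl a') => E; split; last by right.
    by apply: (same a') => //; rewrite l_gt0 leqnn.
  have [ml'|ml'] := eqVneq m' l.
    have : p a m \in w a by apply: pw'; lia.
    by rewrite E ml' pl (negPf (vnw a)).
  have [aa|aa] := eqVneq a a'; first by move: E; rewrite -aa => /same-> //; split=> //; left.
  have pm : p a m \in w a by apply: pw'; lia.
  have : p a' m' \in w a' by apply: pw'; lia.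
  by rewrite -E (negPf (dw _ _ _ aa pm)).
- by move=> a m hm; apply: (aw a); apply: pin.
Qed.

(** The avoided set is an arbitrary function of the spiders already chosen: for the energy graph it
    is larger than the set of their vertices. *)
Lemma greedy_spiders Q (X : seq legs_fun -> {set V}) (p0 : legs_fun) B :
  spider_rich e l Q u -> (forall s, size s < B -> #|X s| <= Q) ->
  exists2 s, size s = B & forall j, j < B -> fun_spider (X (take j s)) (nth p0 s j).
Proof.
move=> rich; elim: B => [|B IH] XQ; first by exists [::].
have [j jB|s sB hs] := IH; first by apply: XQ; apply: ltnW.
have [|p hp] := @fun_spider_exists Q (X s) rich; first by apply: XQ; rewrite sB.
exists (rcons s p) => [|j]; first by rewrite size_rcons sB.
rewrite ltnS leq_eqVlt => /orP[/eqP->|jB].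
  by rewrite nth_rcons sB ltnn eqxx -{1}sB -cats1 take_size_cat.
by rewrite nth_rcons sB jB -cats1 takel_cat ?sB 1?ltnW //; apply: hs.
Qed.

Definition leg_verts (p : legs_fun) : {set V} := [set p x.1 x.2 | x : 'I_3 * 'I_l.+1].

Lemma card_leg_verts p : #|leg_verts p| <= 3 * l.+1.
Proof.
by apply: leq_trans (leq_imset_card _ _) _; rewrite ?cardsT card_prod !card_ord.
Qed.

Lemma mem_leg_verts p a m : m <= l -> p a m \in leg_verts p.
Proof. by move=> ml; apply/imsetP; exists (a, inord m); rewrite //= inordK. Qed.

Definition legs_union (p0 : legs_fun) (s : seq legs_fun) : {set V} :=
  \bigcup_(j < size s) leg_verts (nth p0 s j).

Lemma card_legs_union p0 s : #|legs_union p0 s| <= size s * (3 * l.+1).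
Proof.
rewrite -[X in _ <= X * _]card_ord -sum_nat_const.
apply: leq_trans (card_bigcup_le _ _) _.
by apply: leq_sum => j _; apply: card_leg_verts.
Qed.

Lemma legs_unionP p0 s B j j' a m : size s = B -> j < B -> j' < j -> m <= l ->
  nth p0 s j' a m \in legs_union p0 (take j s).
Proof.
move=> sB jB jj ml; have st : size (take j s) = j by rewrite size_take sB jB.
apply/bigcupP; have jt : j' < size (take j s) by rewrite st.
by exists (Ordinal jt) => //=; rewrite nth_take // mem_leg_verts.
Qed.

End FunSpiders.

Section KsubFacts.
Variables (a b l : nat).

(** The distance along a path from the side of size [a]. Its parity gives the bipartition, and it
    orients each edge and locates it on its path. *)
Definition Ksub_depth (x : Ksub_vert a b l) : nat :=
  match x with inl (inl _) => 0 | inl (inr _) => l | inr (_, _, t) => t.+1 end.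

Lemma Ksub_path_mid i j (t : 'I_l.-1) : @Ksub_path a b l i j t.+1 = inr (i, j, t).
Proof. by rewrite /Ksub_path /= valK. Qed.

Lemma Ksub_path_last i j : 0 < l -> @Ksub_path a b l i j l = inl (inr j).
Proof.
by move=> l0; rewrite /Ksub_path; case: eqP => [E|_]; [rewrite E in l0|rewrite insubF ?ltnn].
Qed.

Lemma Ksub_depth_path i j t : t <= l -> Ksub_depth (Ksub_path l i j t) = t.
Proof.
case: t => [//|t] tl; have [tl'|tl'] := ltnP t l.-1.
  by rewrite (Ksub_path_mid i j (Ordinal tl')).
have -> : t.+1 = l by lia.
by rewrite Ksub_path_last //; lia.
Qed.

Lemma card_Ksub_vert : #|vert (Ksub a b l)| = a + b + a * b * l.-1.
Proof. by rewrite /= !card_sum !card_prod !card_ord. Qed.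

Lemma Ksub_bipartite : bipartite (Ksub a b l).
Proof.
exists [set x | odd (Ksub_depth x)] => ed /imsetP[[[i j] t] _ ->] /=.
have d1 := Ksub_depth_path i j (ltnW (ltn_ord t)).
have d2 := Ksub_depth_path i j (ltn_ord t).
set x := Ksub_path l i j t in d1 *; set y := Ksub_path l i j t.+1 in d2 *.
case ot : (odd t).
  suff -> : [set x; y] :&: [set x0 | odd (Ksub_depth x0)] = [set x] by rewrite cards1.
  apply/setP => z; rewrite !inE; case: (eqVneq z x) => [->|_] /=; first by rewrite d1 ot.
  by case: (eqVneq z y) => [->|_] //=; rewrite d2 /= ot.
suff -> : [set x; y] :&: [set x0 | odd (Ksub_depth x0)] = [set y] by rewrite cards1.
apply/setP => z; rewrite !inE; case: (eqVneq z y) => [->|_] /=; first by rewrite d2 /= ot orbT.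
by case: (eqVneq z x) => [->|_] //=; rewrite d1 /= ot.
Qed.

(** Depth recovers [t]. Since [l > 1], each edge has an inner vertex of its path as an end, and that
    vertex records [i] and [j]: it is the far end if [t = 0] and the near end otherwise. *)
Lemma card_Ksub_edges : 1 < l -> #|edges (Ksub a b l)| = a * b * l.
Proof.
move=> l1; rewrite /= /Ksub_edges card_imset ?card_prod ?card_ord //.
move=> [[i j] t] [[i' j'] t'] /= E.
have dt := Ksub_depth_path i j (ltnW (ltn_ord t)).
have dt1 := Ksub_depth_path i j (ltn_ord t).
have dt' := Ksub_depth_path i' j' (ltnW (ltn_ord t')).
have dt1' := Ksub_depth_path i' j' (ltn_ord t').
have m1 : Ksub_path l i j t \in [set Ksub_path l i' j' t'; Ksub_path l i' j' t'.+1].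
  by rewrite -E set21.
have m2 : Ksub_path l i j t.+1 \in [set Ksub_path l i' j' t'; Ksub_path l i' j' t'.+1].
  by rewrite -E set22.
have [tt E1 E2] : [/\ t = t' :> nat, Ksub_path l i j t = Ksub_path l i' j' t' &
    Ksub_path l i j t.+1 = Ksub_path l i' j' t'.+1].
  move: m1 m2; rewrite !inE => /orP[/eqP F1|/eqP F1] /orP[/eqP F2|/eqP F2].
  - by have := congr1 Ksub_depth F1; have := congr1 Ksub_depth F2; rewrite dt dt1 dt'; lia.
  - by have := congr1 Ksub_depth F1; rewrite dt dt'.
  - by have := congr1 Ksub_depth F1; have := congr1 Ksub_depth F2; rewrite dt dt1 dt' dt1'; lia.
  - by have := congr1 Ksub_depth F1; have := congr1 Ksub_depth F2; rewrite dt dt1 dt1'; lia.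
have Et : t = t' by apply: val_inj.
rewrite -Et in E1 E2 *.
have [t0|t0] := posnP (t : nat).
  have l2 : 0 < l.-1 by lia.
  by move: E2; rewrite t0 !(Ksub_path_mid _ _ (Ordinal l2)) => -[-> ->].
have l2 : t.-1 < l.-1 by have := ltn_ord t; lia.
by move: E1; rewrite -(prednK t0) !(Ksub_path_mid _ _ (Ordinal l2)) => -[-> ->].
Qed.

End KsubFacts.

Lemma spider_rich_copy (V : finType) (E : {set {set V}}) b l (u : 'I_3 -> V) :
  1 < l -> injective u ->
  spider_rich (fun x y => [set x; y] \in E) l (b * (3 * l.+1)) u ->
  contains_copy (Ksub 3 b l) E.
Proof.
move=> l1 u_inj rich; pose p0 : legs_fun V := fun a _ => u a.
have l0 : 0 < l := ltnW l1.
have [s sb|s sB hs] := greedy_spiders l0 (X := legs_union l p0) p0 (B := b) rich.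
  by apply: leq_trans (card_legs_union _ _ _) _; rewrite leq_mul2r ltnW ?orbT.
pose p j := nth p0 s j.
have pX j j' a a' m m' : j < b -> j' < j -> 0 < m <= l -> m' <= l -> p j a m != p j' a' m'.
  move=> jb jj hm hm'; have [_ _ _ _ /(_ a m hm)[+ _]] := hs j jb.
  by apply: contraNneq; rewrite -/(p j) => ->; apply: legs_unionP (sB) jb jj hm'.
pose g (x : Ksub_vert 3 b l) : V := match x with
  | inl (inl i) => u i | inl (inr j) => p j ord0 l | inr (i, j, t) => p j i t.+1 end.
have gp i (j : 'I_b) t : t <= l -> g (Ksub_path l i j t) = p j i t.
  have [p1 p2 _ _ _] := hs j (ltn_ord j).
  case: t => [_|t tl]; first by rewrite /= /p p1.
  have [tl'|tl'] := ltnP t l.-1; first by rewrite (Ksub_path_mid i j (Ordinal tl')).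
  have -> : t.+1 = l by lia.
  by rewrite Ksub_path_last //=; apply: p2.
have pu (j : 'I_b) i m i' : 0 < m <= l -> p j i m <> u i'.
  by move=> hm E'; have [_ _ _ _ /(_ i m hm)[_ /(_ i')]] := hs j (ltn_ord j); rewrite -E' eqxx.
have pp (j j' : 'I_b) i i' m m' : 0 < m <= l -> 0 < m' <= l -> p j i m = p j' i' m' ->
    [/\ j = j', m = m' & i = i' \/ m = l].
  move=> hm hm' E'.
  have jj : j = j'.
    apply: val_inj; case: (ltngtP j j') => // jj.
      by have := pX j' j i' i m' m (ltn_ord _) jj hm'; rewrite E' eqxx; case/andP: hm => _ -> /(_ isT).
    by have := pX j j' i i' m m' (ltn_ord _) jj hm; rewrite E' eqxx; case/andP: hm' => _ -> /(_ isT).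
  rewrite -jj in E' *; have [_ _ _ inj _] := hs j (ltn_ord j).
  by have [] := inj _ _ _ _ hm hm' E'.
have hl : 0 < l <= l by rewrite l0 leqnn.
have ht (t : 'I_l.-1) : 0 < t.+1 <= l by have := ltn_ord t; lia.
apply/existsP; exists (finfun g); apply/andP; split.
  apply/injectiveP => x y; rewrite !ffunE.
  case: x => [[i|j]|[[i j] t]]; case: y => [[i'|j']|[[i' j'] t']] /= E'.
  - by rewrite (u_inj _ _ E').
  - by case: (pu j' ord0 l i hl).
  - by case: (pu j' i' t'.+1 i (ht _)).
  - by case: (pu j ord0 l i' hl).
  - by have [-> _ _] := pp _ _ _ _ _ _ hl hl E'.
  - by have [_ E2 _] := pp _ _ _ _ _ _ hl (ht _) E'; have := ltn_ord t'; lia.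
  - by case: (pu j i t.+1 i' (ht _)).
  - by have [_ E2 _] := pp _ _ _ _ _ _ (ht _) hl E'; have := ltn_ord t; lia.
  - have [-> [tt] [->|E2]] := pp _ _ _ _ _ _ (ht _) (ht _) E'.
      by rewrite (val_inj tt).
    by have := ltn_ord t; lia.
apply/forall_inP => ed /imsetP[[[i j] t] _ ->] /=.
rewrite imsetU !imset_set1 !ffunE !gp; [|exact: ltn_ord|exact/ltnW/ltn_ord].
by have [_ _ adj _ _] := hs j (ltn_ord j); apply: adj.
Qed.

Lemma card_arcs (V : finType) (e : rel V) :
  arcs e setT setT = #|[set x : V * V | e x.1 x.2]|.
Proof.
rewrite -sum1dep_card -(pair_big_dep predT (fun x y => e x y) (fun _ _ => 1)) /=.
rewrite /arcs (eq_bigl xpredT) => [|x]; last by rewrite inE.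
apply: eq_bigr => x _; rewrite -sum1dep_card.
by apply: eq_bigl => y; rewrite inE.
Qed.

(** The dense theorem with equality as the conflict relation, so that [s0 = 1] and the three leaves
    are merely distinct. *)
Theorem ex_Ksub_bound b l : 1 < l ->
  exists C, forall n, 0 < n -> ex n (Ksub 3 b l) ^ (3 * l) <= C * n ^ (3 * l + 2).
Proof.
move=> l1; have l0 : 0 < l.-1 by lia.
have [C [C0 hC]] := dense_spider_rich 1 (b * (3 * l.+1)) l0.
have El : l.-1.+1 = l by lia.
rewrite El in hC.
exists C => n n0; have k3 : 0 < 3 * l by lia.
rewrite /ex; elim/big_ind: _ => [||E /andP[/forall_inP E2 nE]].
- by rewrite exp0n.
- by move=> x y hx hy; rewrite /maxn; case: ifP.
rewrite leqNgt; apply: contra nE => /ltnW hE.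
pose e (x y : 'I_n) := [set x; y] \in E.
have [||||||u [u1 u2]] := hC 'I_n e eq_op; last first.
- apply: spider_rich_copy u2 => // i j uij; apply/eqP/contraT => /u1.
  by rewrite uij eqxx.
- rewrite card_ord; apply: leq_trans hE _; rewrite leq_exp2r //.
  apply: leq_trans (_ : #|[set x : 'I_n * 'I_n | e x.1 x.2]| <= _); last first.
    by rewrite card_arcs.
  apply: leq_trans (leq_imset_card (fun x : 'I_n * 'I_n => [set x.1; x.2]) _).
  apply: subset_leq_card; apply/subsetP => ed edE; have := E2 ed edE.
  move=> /cards2P[x [y [xy Exy]]]; apply/imsetP; exists (x, y) => //.
  by rewrite inE /= /e -Exy.
- by rewrite card_ord.
- move=> y z; apply: leq_trans (_ : #|[set z]| <= _); last by rewrite cards1.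
  by apply: subset_leq_card; apply/subsetP => w; rewrite !inE => /andP[_].
- by [].
- exact: eq_sym.
- by move=> x y; rewrite /e setUC.
Qed.

(** * The colour energy graph *)

Lemma set2_inj (T : finType) (x y y' : T) : [set x; y] = [set x; y'] -> y = y'.
Proof.
move=> E; have : y \in [set x; y'] by rewrite -E set22.
have : y' \in [set x; y] by rewrite E set22.
by rewrite !inE => /orP[/eqP->|/eqP->] // /orP[/eqP|/eqP].
Qed.

(** The degrees in [D] add up to [2 * #|D|]; members of [N] contribute at least 2 and members of [Y]
    at least 1. *)
Lemma incidence_count (T : finType) (D : {set {set T}}) (N Y : {set T}) :
  (forall ed, ed \in D -> #|ed| = 2) -> [disjoint N & Y] ->
  (forall x, x \in N -> exists e1 e2,
     [/\ e1 \in D, e2 \in D, e1 != e2, x \in e1 & x \in e2]) ->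
  (forall x, x \in Y -> exists2 ed, ed \in D & x \in ed) ->
  2 * #|N| + #|Y| <= 2 * #|D|.
Proof.
move=> D2 NY hN hY.
pose deg x := #|[set ed in D | x \in ed]|.
have -> : 2 * #|D| = \sum_x deg x.
  rewrite mulnC -sum_nat_const.
  transitivity (\sum_(ed in D) \sum_x (x \in ed : nat)).
    apply: eq_bigr => ed /D2 <-; rewrite -sum1_card big_mkcond /=.
    by apply: eq_bigr => x _; case: (x \in ed).
  rewrite exchange_big /=; apply: eq_bigr => x _; rewrite /deg -sum1dep_card big_mkcondr /=.
  by apply: eq_bigr => ed _; case: (x \in ed).
have -> : 2 * #|N| + #|Y| = \sum_x ((if x \in N then 2 else 0) + (if x \in Y then 1 else 0)).
  by rewrite big_split /= -!big_mkcond !sum_nat_const mulnC muln1.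
apply: leq_sum => x _; have [xN|xN] := boolP (x \in N).
  rewrite (disjointFr NY xN) addn0; have [e1 [e2 [h1 h2 ne x1 x2]]] := hN x xN.
  have -> : 2 = #|[set e1; e2]| by rewrite cards2 ne.
  by apply: subset_leq_card; apply/subsetP => ed; rewrite !inE => /orP[]/eqP->; rewrite ?h1 ?h2.
rewrite add0n; case: ifP => // /hY[ed h1 h2]; apply/card_gt0P; exists ed; by rewrite inE h1.
Qed.

Lemma card_bigcup_disjoint (I X : finType) (F : I -> {set X}) :
  (forall i j x, x \in F i -> x \in F j -> i = j) -> #|\bigcup_i F i| = \sum_i #|F i|.
Proof.
move=> h; rewrite -sum1_card partition_disjoint_bigcup.
  by apply: eq_bigr => i _; rewrite sum1_card.
move=> i j ij; rewrite -setI_eq0; apply/eqP/setP => x; rewrite !inE.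
by apply/negP => /andP[xi xj]; rewrite (h _ _ _ xi xj) eqxx in ij.
Qed.

Section Energy.
Variables (T K : finType) (col : {set T} -> K) (M : {set {set T}}) (r : nat) (phi : T -> 'I_r).
Hypothesis M2 : forall ed, ed \in M -> #|ed| = 2.
Hypothesis M_matching : forall ed ed' x, ed \in M -> ed' \in M -> col ed = col ed' ->
  x \in ed -> x \in ed' -> ed = ed'.

Local Notation U := {ffun 'I_r -> T}.

(** Coordinate [i] uses only vertices labelled [i] by [phi], so projections to different coordinates
    are disjoint and their vertices and edges can be added up. *)
Definition energy_adj : rel U := fun x y => [exists c, [forall i,
  [&& [set x i; y i] \in M, col [set x i; y i] == c, phi (x i) == i & phi (y i) == i]]].

Definition energy_conf : rel U := fun x y => [exists i, x i == y i].

Lemma energy_adjP x y : energy_adj x y -> exists c, forall i,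
  [/\ [set x i; y i] \in M, col [set x i; y i] = c, phi (x i) = i & phi (y i) = i].
Proof.
by case/existsP => c /forallP h; exists c => i; have /and4P[? /eqP ? /eqP ? /eqP ?] := h i.
Qed.

Lemma energy_adj_sym : symmetric energy_adj.
Proof.
move=> x y; apply: eq_existsb => c; apply: eq_forallb => i.
by rewrite setUC [(phi _ == _) && _]andbC.
Qed.

Lemma energy_conf_sym : symmetric energy_conf.
Proof. by move=> x y; apply: eq_existsb => i; rewrite eq_sym. Qed.

Lemma energy_conf_refl : 0 < r -> reflexive energy_conf.
Proof. by move=> r0 x; apply/existsP; exists (Ordinal r0). Qed.

(** One coordinate of a neighbour fixes the colour, and in the matching of that colour every
    coordinate of [x] has only one partner. *)
Lemma energy_proper x y y' i : energy_adj x y -> energy_adj x y' -> y i = y' i -> y = y'.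
Proof.
move=> /energy_adjP[c hc] /energy_adjP[c' hc'] E.
have cc : c = c'.
  by have [_ <- _ _] := hc i; have [_ <- _ _] := hc' i; rewrite E.
apply/ffunP => j; have [m1 c1 _ _] := hc j; have [m2 c2 _ _] := hc' j.
apply: (@set2_inj _ (x j)); apply: (M_matching (x := x j)) => //; last 2 first.
- exact: set21.
- exact: set21.
by rewrite c1 c2.
Qed.

Lemma energy_conf_le y z : #|[set w | energy_adj y w & energy_conf w z]| <= r.
Proof.
apply: leq_trans (_ : #|\bigcup_(i < r) [set w | energy_adj y w & w i == z i]| <= _).
  apply: subset_leq_card; apply/subsetP => w; rewrite inE => /andP[yw /existsP[i wi]].
  by apply/bigcupP; exists i => //; rewrite inE yw.
rewrite -[X in _ <= X]card_ord -[X in _ <= X]muln1 -sum_nat_const.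
apply: leq_trans (card_bigcup_le _ _) _.
apply: leq_sum => i _; apply/card_le1_eqP => w w'; rewrite !inE.
move=> /andP[yw /eqP wi] /andP[yw' /eqP wi']; apply/esym/(energy_proper yw yw' (i := i)).
by rewrite wi wi'.
Qed.

(** * Projections of successive spiders to one coordinate *)

Section Core.
Variables (l B : nat) (u : 'I_3 -> U) (p : nat -> legs_fun U) (X : nat -> {set U}).
Hypothesis l_gt1 : 1 < l.
Hypothesis u_conf : forall a a', a != a' -> ~~ energy_conf (u a) (u a').
Hypothesis p_spider : forall j, j < B -> fun_spider energy_adj l u (X j) (p j).

Definition tuples j : {set U} :=
  [set u a | a : 'I_3] :|: [set p x.1.1 x.1.2 x.2 | x : 'I_j * 'I_3 * 'I_l.+1].

Definition shadow i j : {set T} := [set x i | x : U in tuples j].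

Definition shadow_edges i j : {set {set T}} :=
  [set [set p x.1.1 x.1.2 x.2 i; p x.1.1 x.1.2 x.2.+1 i] | x : 'I_j * 'I_3 * 'I_l].

Hypothesis p_fresh : forall j a i, j < B -> p j a 1 i \notin shadow i j.

Lemma mem_tuples j j' a m : j' < j -> m <= l -> p j' a m \in tuples j.
Proof.
move=> jj ml; rewrite inE; apply/orP; right; apply/imsetP.
by exists (Ordinal jj, a, inord m); rewrite //= inordK.
Qed.

Lemma mem_shadow i j j' a m : j' < j -> m <= l -> p j' a m i \in shadow i j.
Proof. by move=> jj ml; apply: (imset_f (fun x : U => x i)); apply: mem_tuples. Qed.

Lemma u_shadow i j a : u a i \in shadow i j.
Proof.
by apply: (imset_f (fun x : U => x i)); rewrite inE; apply/orP; left; apply: imset_f.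
Qed.

Lemma shadowP i j x : x \in shadow i j ->
  (exists a, x = u a i) \/ (exists j' a m, [/\ j' < j, m <= l & x = p j' a m i]).
Proof.
case/imsetP => y; rewrite inE => /orP[] /imsetP.
  by case=> a _ -> ->; left; exists a.
case=> -[[j' a] m] _ -> ->; right; exists j', a, m.
by split; [exact: ltn_ord|rewrite -ltnS; exact: ltn_ord|].
Qed.

Lemma shadowS i j j' : j <= j' -> shadow i j \subset shadow i j'.
Proof.
move=> jj; apply/subsetP => x /shadowP[[a ->]|[j0 [a [m [h1 h2 ->]]]]]; first exact: u_shadow.
by apply: mem_shadow => //; apply: leq_trans jj.
Qed.

Lemma shadow_edgesP i j ed : ed \in shadow_edges i j ->
  exists j' a m, [/\ j' < j, m < l & ed = [set p j' a m i; p j' a m.+1 i]].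
Proof. by case/imsetP => -[[j' a] m] _ ->; exists j', a, m; split. Qed.

Lemma mem_shadow_edges i j j' a m : j' < j -> m < l ->
  [set p j' a m i; p j' a m.+1 i] \in shadow_edges i j.
Proof. by move=> jj ml; apply/imsetP; exists (Ordinal jj, a, Ordinal ml). Qed.

Lemma shadow_edges_sub i j ed : ed \in shadow_edges i j -> ed \subset shadow i j.
Proof.
case/shadow_edgesP => j' [a [m [jj ml ->]]]; apply/subsetP => x.
by rewrite !inE => /orP[]/eqP->; apply: mem_shadow => //; apply: ltnW.
Qed.

(** Each new vertex lies on two new edges, because the two tuples around it differ in every
    coordinate by [energy_proper]; each of the three leaves lies on one, by [p_fresh]. So twice the
    new edges is at least twice the new vertices plus 3, and parity turns the surplus 3/2 into 2. *)
Lemma shadow_edges_step i j : j < B ->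
  #|shadow_edges i j| + #|shadow i j.+1| + 2 <= #|shadow_edges i j.+1| + #|shadow i j|.
Proof.
move=> jB; have [p0 pl padj pinj pX] := p_spider jB.
pose D := [set ed in shadow_edges i j.+1 | ~~ (ed \subset shadow i j)].
pose N := shadow i j.+1 :\: shadow i j.
pose Y := [set u a i | a : 'I_3].
have padj' a m : 0 < m <= l -> energy_adj (p j a m) (p j a m.-1).
  by case: m => // m ml; rewrite energy_adj_sym; apply: padj; case/andP: ml.
have memD a m x : m < l -> x \in [set p j a m i; p j a m.+1 i] -> x \notin shadow i j ->
    [set p j a m i; p j a m.+1 i] \in D.
  move=> ml xe xS; rewrite inE mem_shadow_edges //=; apply/subsetPn; by exists x.
have memD' a m x : 0 < m <= l -> x \in [set p j a m i; p j a m.-1 i] -> x \notin shadow i j ->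
    [set p j a m i; p j a m.-1 i] \in D.
  by case: m => // m ml; rewrite setUC; apply: memD; case/andP: ml.
have cY : #|Y| = 3.
  rewrite card_imset ?card_ord // => a a' E; apply/eqP/contraT => /u_conf/existsPn/(_ i).
  by rewrite E eqxx.
have count : 2 * #|N| + #|Y| <= 2 * #|D|.
  apply: incidence_count.
  - move=> ed; rewrite inE => /andP[/shadow_edgesP[j' [a [m [jj ml ->]]]] _].
    have jB' : j' < B by apply: leq_trans jj _.
    have [_ _ /(_ a m ml)/energy_adjP[c hc] _ _] := p_spider jB'.
    by have [/M2] := hc i.
  - rewrite disjoint_subset; apply/subsetP => x; rewrite !inE => /andP[xS _].
    by apply: contra xS => /imsetP[a _ ->]; apply: u_shadow.
  - move=> x; rewrite inE => /andP[xS /shadowP[[a Ex]|[j' [a [m [jj ml Ex]]]]]].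
      by rewrite Ex u_shadow in xS.
    have Ej : j' = j.
      apply/eqP; rewrite eqn_leq -ltnS jj leqNgt; apply: contra xS => jj'.
      by rewrite Ex mem_shadow.
    rewrite Ej in Ex.
    have m0 : 0 < m.
      by rewrite lt0n; apply: contraNneq xS => m0; rewrite Ex m0 p0 u_shadow.
    have [ml'|ml'] := ltnP m l.
      exists [set p j a m i; p j a m.-1 i], [set p j a m i; p j a m.+1 i].
      have xi z : x \in [set p j a m i; z] by rewrite Ex set21.
      split=> //; first by apply: (memD' a m x); rewrite ?m0.
        exact: (memD a m x).
      apply/eqP => /set2_inj/(energy_proper (padj' a m _) (padj a m ml')) E.
      have {}E : p j a m.-1 = p j a m.+1 by apply: E; rewrite m0.
      have m1 : 0 < m.+1 <= l by [].
      have [m1'|m1'] := posnP m.-1.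
        by have [_ /(_ a)] := pX a m.+1 m1; rewrite -E m1' p0 eqxx.
      have [|E' _] := pinj a a m.-1 m.+1 _ m1 E; first by rewrite m1'; lia.
      by move: E' m0; clear; lia.
    have Em : m = l by apply/eqP; rewrite eqn_leq ml.
    have Ex0 b : x = p j b l i by rewrite Ex Em (pl a b).
    (* At the centre the two new edges come from two different legs. *)
    pose b1 : 'I_3 := inord 1.
    have l0 : 0 < l <= l by rewrite ltnW //=.
    exists [set p j ord0 l i; p j ord0 l.-1 i], [set p j b1 l i; p j b1 l.-1 i].
    split.
    - by apply: (memD' ord0 l x); rewrite // -Ex0 set21.
    - by apply: (memD' b1 l x); rewrite // -Ex0 set21.
    - rewrite -!Ex0 (Ex0 ord0); apply/eqP => /set2_inj.
      have a1 := padj' ord0 l l0; have a2 := padj' b1 l l0.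
      rewrite -(pl ord0) in a2.
      move=> /(energy_proper a1 a2) E.
      have l2 : 0 < l.-1 <= l by move: l_gt1; clear; lia.
      have [_ [E'|E']] := pinj _ _ _ _ l2 l2 E; last by move: E' l_gt1; clear; lia.
      by have := congr1 val E'; rewrite /= inordK.
    - by rewrite -Ex0 set21.
    - by rewrite -Ex0 set21.
  - move=> x /imsetP[a _ ->]; exists [set p j a 0 i; p j a 1 i]; last by rewrite p0 set21.
    by apply: (memD a 0 (p j a 1 i)) => //; [apply: ltnW|apply: set22|apply: p_fresh].
have cN : #|shadow i j.+1| = #|shadow i j| + #|N|.
  by rewrite -(cardsID (shadow i j) (shadow i j.+1)) (setIidPr (shadowS i (leqnSn j))).
have cD : #|shadow_edges i j| + #|D| <= #|shadow_edges i j.+1|.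
  rewrite -(cardsID D (shadow_edges i j.+1)) addnC; apply: leq_add.
    by apply: subset_leq_card; apply/subsetP => ed; rewrite !inE => /andP[-> ->].
  apply: subset_leq_card; apply/subsetP => ed edj; rewrite !inE.
  rewrite (shadow_edges_sub edj) andbF /=.
  have /shadow_edgesP[j' [a [m [jj ml ->]]]] := edj.
  by apply: mem_shadow_edges => //; apply: ltnW.
move: count cN cD; rewrite cY; clear; lia.
Qed.

Lemma shadow0 i : #|shadow i 0| <= 3.
Proof.
apply: leq_trans (_ : #|[set u a i | a : 'I_3]| <= _).
  apply: subset_leq_card; apply/subsetP => x /shadowP[[a ->]|[j' [a [m []]]]] //.
  exact: imset_f.
by apply: leq_trans (leq_imset_card _ _) _; rewrite ?cardsT card_ord.
Qed.

Lemma shadow_edges_ge i j : j <= B -> #|shadow i j| + 2 * j <= #|shadow_edges i j| + 3.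
Proof.
elim: j => [_|j IH jB]; first by have := shadow0 i; clear; lia.
have := IH (ltnW jB); have := shadow_edges_step i jB; clear; lia.
Qed.

Lemma shadow_le i j : j <= B -> #|shadow i j| <= 3 + j * (3 * l.-1 + 1).
Proof.
elim: j => [_|j IH jB]; first exact: shadow0.
have [p0 pl _ _ _] := p_spider jB.
pose W := [set p j x.1 x.2.+1 i | x : 'I_3 * 'I_l.-1] :|: [set p j ord0 l i].
apply: leq_trans (_ : #|shadow i j :|: W| <= _).
  apply: subset_leq_card; apply/subsetP => x /shadowP[[a ->]|[j' [a [m [jj ml ->]]]]].
    by rewrite inE u_shadow.
  rewrite ltnS leq_eqVlt in jj; case/orP: jj => [/eqP->|jj]; last by rewrite inE mem_shadow.
  have [->|m0] := posnP m; first by rewrite p0 inE u_shadow.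
  apply/setUP; right; rewrite inE; have [ml'|ml'] := ltnP m l; last first.
    have -> : m = l by apply/eqP; rewrite eqn_leq ml.
    by rewrite (pl a ord0) set11 orbT.
  have mm : m.-1 < l.-1 by lia.
  by apply/orP; left; apply/imsetP; exists (a, Ordinal mm) => //=; rewrite prednK.
apply: leq_trans (cardsU_le _ _) _; rewrite mulSn addnCA addnC; apply: leq_add.
  apply: leq_trans (cardsU_le _ _) _; rewrite cards1 leq_add2r.
  by apply: leq_trans (leq_imset_card _ _) _; rewrite ?cardsT card_prod !card_ord.
by rewrite IH // ltnW.
Qed.

(** * Pendant edges that bring every coordinate to exactly [s] vertices *)

Section Padding.
Variables (b s : nat).
Hypothesis s_def : s = 3 + b * (3 * l.-1 + 1).
Hypothesis bsB : b + s <= B.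

Definition pad i (t : nat) : {set T} := [set p (b + j) ord0 1 i | j : 'I_t].
Definition pad_edges i (t : nat) : {set {set T}} :=
  [set [set u ord0 i; p (b + j) ord0 1 i] | j : 'I_t].
Definition deficit i := s - #|shadow i b|.
Definition full_shadow i := shadow i b :|: pad i (deficit i).
Definition full_edges i := shadow_edges i b :|: pad_edges i (deficit i).

Lemma deficit_lt i (j : 'I_(deficit i)) : b + j < B.
Proof.
apply: leq_trans bsB; rewrite ltn_add2l; apply: leq_trans (ltn_ord j) _; exact: leq_subr.
Qed.

Lemma pad_inj i : injective (fun j : 'I_(deficit i) => p (b + j) ord0 1 i).
Proof.
have h (j j' : 'I_(deficit i)) : p (b + j) ord0 1 i = p (b + j') ord0 1 i -> ~~ (j < j').
  move=> E; apply/negP => jj; have := p_fresh ord0 i (deficit_lt j').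
  by rewrite -E mem_shadow // ?ltn_add2l //; apply: ltnW.
move=> j j' E; apply: val_inj; apply/eqP.
by rewrite eqn_leq leqNgt h //= leqNgt h.
Qed.

Lemma pad_fresh i (j : 'I_(deficit i)) : p (b + j) ord0 1 i \notin shadow i b.
Proof.
apply: contra (p_fresh ord0 i (deficit_lt j)); apply/subsetP/shadowS; exact: leq_addr.
Qed.

Lemma shadow_le_full i : #|shadow i b| <= s.
Proof. by rewrite s_def; apply: shadow_le; apply: leq_trans (leq_addr _ _) bsB. Qed.

Lemma card_full_shadow i : #|full_shadow i| = s.
Proof.
have := cardsUI (shadow i b) (pad i (deficit i)); rewrite -/(full_shadow i).
have -> : shadow i b :&: pad i (deficit i) = set0.
  apply/setP => x; rewrite !inE; apply/negP => /andP[xS /imsetP[j _ Ex]].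
  by move: xS; rewrite Ex; apply/negP/pad_fresh.
rewrite cards0 addn0 => ->; rewrite [#|pad _ _|]card_imset; last exact: pad_inj.
by rewrite card_ord subnKC // shadow_le_full.
Qed.

(** Each pendant edge adds one vertex and one edge, so the excess [2 * b - 3] of edges over vertices
    is kept. With the value of [s], [s + 2 * b - 3] is [3 * b * l], the number of edges of the
    subdivided graph. *)
Lemma card_full_edges i : s + 2 * b <= #|full_edges i| + 3.
Proof.
have := cardsUI (shadow_edges i b) (pad_edges i (deficit i)); rewrite -/(full_edges i).
have -> : shadow_edges i b :&: pad_edges i (deficit i) = set0.
  apply/setP => x; rewrite !inE; apply/negP => /andP[/shadow_edges_sub/subsetP xS /imsetP[j _ Ex]].
  have := pad_fresh j; rewrite xS //.
  by rewrite Ex set22.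
rewrite cards0 addn0 => ->; rewrite [#|pad_edges _ _|]card_imset; last by move=> j j' /set2_inj/pad_inj.
have := shadow_edges_ge i (leq_trans (leq_addr _ _) bsB).
by have := shadow_le_full i; rewrite card_ord /deficit; clear; lia.
Qed.

(** The pairs of tuples behind the edges, without reference to a coordinate; only the amount [t] of
    padding varies, and the pairs grow with it. *)
Definition full_pairs t (x y : U) :=
  (exists j a m, [/\ j < b, m < l & x = p j a m /\ y = p j a m.+1]) \/
  (exists2 j, j < t & x = u ord0 /\ y = p (b + j) ord0 1).

Lemma full_pairs_adj t x y : t <= s -> full_pairs t x y -> energy_adj x y.
Proof.
move=> ts [[j [a [m [jb ml [-> ->]]]]]|[j jt [-> ->]]].
  have jB : j < B by apply: leq_trans bsB; apply: leq_trans jb (leq_addr _ _).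
  by have [_ _ adj _ _] := p_spider jB; apply: adj.
have jB : b + j < B by apply: leq_trans bsB; rewrite ltn_add2l; apply: leq_trans ts.
have [p0 _ adj _ _] := p_spider jB; rewrite -(p0 ord0); apply: adj; exact: ltnW.
Qed.

Lemma full_edgesP i ed : ed \in full_edges i <->
  exists x y, full_pairs (deficit i) x y /\ ed = [set x i; y i].
Proof.
split.
  case/setUP => [/shadow_edgesP[j [a [m [jb ml ->]]]]|/imsetP[j _ ->]].
    by exists (p j a m), (p j a m.+1); split=> //; left; exists j, a, m; split.
  by exists (u ord0), (p (b + j) ord0 1); split=> //; right; exists j.
case=> x [y [[[j [a [m [jb ml [-> ->]]]]]|[j jt [-> ->]]] ->]]; apply/setUP.
  by left; apply: mem_shadow_edges.
by right; apply/imsetP; exists (Ordinal jt).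
Qed.

Lemma deficit_le i : deficit i <= s.
Proof. exact: leq_subr. Qed.

Lemma full_edges_sub i ed : ed \in full_edges i -> ed \subset full_shadow i.
Proof.
case/setUP => [/shadow_edges_sub h|/imsetP[j _ ->]].
  by apply: subset_trans h (subsetUl _ _).
apply/subsetP => x; rewrite !inE => /orP[]/eqP->; first by rewrite u_shadow.
by apply/orP; right; apply: imset_f.
Qed.

Lemma full_edges_card i ed : ed \in full_edges i -> #|ed| = 2.
Proof.
move=> /full_edgesP[x [y [/(full_pairs_adj (deficit_le i))/energy_adjP[c hc] ->]]].
by have [/M2] := hc i.
Qed.

Lemma full_shadow_phi i x : 0 < b -> x \in full_shadow i -> phi x = i.
Proof.
move=> b0.
have B0 j : j < b -> j < B by move=> h; apply: leq_trans bsB; apply: leq_trans h (leq_addr _ _).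
have hp j a m : j < B -> m <= l -> phi (p j a m i) = i.
  move=> jB ml; have [_ _ adj _ _] := p_spider jB.
  case: m ml => [|m] ml.
    by have /energy_adjP[c /(_ i)[_ _]] := adj a 0 (ltnW l_gt1).
  by have /energy_adjP[c /(_ i)[_ _]] := adj a m ml.
case/setUP => [/shadowP[[a ->]|[j [a [m [jb ml ->]]]]]|/imsetP[j _ ->]].
- by have [p0 _ _ _ _] := p_spider (B0 0 b0); rewrite -p0; apply: hp => //; apply: B0.
- by apply: hp => //; apply: B0.
- by apply: hp; [apply: deficit_lt|apply: ltnW].
Qed.

(* Every tuple edge in use projects to an edge of the most heavily padded coordinate
   [i0], so the edges of that coordinate already carry all the colours. *)
Lemma energy_core : 0 < b -> 0 < r -> exists (S : {set T}) (Om Om0 : {set {set T}}),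
  [/\ #|S| = r * s, Om0 \subset Om, (forall ed, ed \in Om -> #|ed| = 2 /\ ed \subset S),
      (forall ed, ed \in Om -> exists2 ed0, ed0 \in Om0 & col ed = col ed0) &
      (r - 1) * (s + 2 * b - 3) + #|Om0| <= #|Om|].
Proof.
move=> b0 r0.
case: (@arg_maxnP _ (Ordinal r0) xpredT deficit isT) => i0 _ imax'.
have imax i : deficit i <= deficit i0 := imax' i isT.
exists (\bigcup_i full_shadow i), (\bigcup_i full_edges i), (full_edges i0); split.
- rewrite card_bigcup_disjoint => [|i j x xi xj].
    by rewrite (eq_bigr (fun _ => s)) => [|i _]; rewrite ?sum_nat_const ?card_ord ?card_full_shadow.
  by rewrite -(full_shadow_phi b0 xi) (full_shadow_phi b0 xj).
- exact: bigcup_sup.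
- move=> ed /bigcupP[i _ edi]; split; first exact: full_edges_card edi.
  by apply: subset_trans (full_edges_sub edi) _; apply: bigcup_sup.
- move=> ed /bigcupP[i _ /full_edgesP[x [y [xy ->]]]].
  have [c hc] := energy_adjP (full_pairs_adj (deficit_le i) xy).
  exists [set x i0; y i0]; last by have [_ -> _ _] := hc i; have [_ -> _ _] := hc i0.
  apply/full_edgesP; exists x, y; split=> //.
  by case: xy => [?|[j jt]]; [left|right; exists j => //; apply: leq_trans jt (imax i)].
rewrite card_bigcup_disjoint => [|i j ed edi edj]; last first.
  have /card_gt0P[x xe] : 0 < #|ed| by rewrite (full_edges_card edi).
  rewrite -(full_shadow_phi b0 (subsetP (full_edges_sub edi) _ xe)).
  by rewrite (full_shadow_phi b0 (subsetP (full_edges_sub edj) _ xe)).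
rewrite (bigD1 i0) //= addnC leq_add2l.
have -> : (r - 1) * (s + 2 * b - 3) = \sum_(i < r | i != i0) (s + 2 * b - 3).
  rewrite sum_nat_const; congr (_ * _).
  by have := cardC1 i0; rewrite card_ord subn1 => <-; apply: eq_card => i; rewrite !inE.
by apply: leq_sum => i _; rewrite leq_subLR [3 + _]addnC card_full_edges.
Qed.

End Padding.
End Core.
End Energy.

(** * Colourings of complete graphs *)

Lemma card2_ends (T : finType) (x0 : T) (ed : {set T}) : #|ed| = 2 ->
  ed = [set nth x0 (enum ed) 0; nth x0 (enum ed) 1].
Proof.
move=> h; have sz : size (enum ed) = 2 by rewrite -cardE.
apply/setP => z; rewrite -mem_enum !inE.
by case: (enum ed) sz => [|a [|b []]] //= _; rewrite !inE.
Qed.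

Lemma average_witness (I : finType) (F : I -> nat) G : 0 < #|I| ->
  #|I| * G <= \sum_i F i -> exists i, G <= F i.
Proof.
move=> I0 h; apply/existsP; apply/contraT; rewrite negb_exists => /forallP hF.
have /card_gt0P[i0 _] := I0.
have : \sum_i (F i).+1 <= \sum_(i : I) G by apply: leq_sum => i _; rewrite ltnNge hF.
under eq_bigr => i _ do rewrite -addn1.
have E n : \sum_(i : I) n = #|I| * n by rewrite sum_nat_const.
by rewrite big_split /= !E; move: h I0; clear; lia.
Qed.

(** * Monochromatic tuples of edges and labellings of the vertices *)

Section Labelling.
Variables (T K : finType) (col : {set T} -> K) (M : {set {set T}}) (r : nat).
Hypothesis M2 : forall ed, ed \in M -> #|ed| = 2.
Hypothesis M_matching : forall ed ed' x, ed \in M -> ed' \in M -> col ed = col ed' ->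
  x \in ed -> x \in ed' -> ed = ed'.
Hypothesis r_gt0 : 0 < r.

(** To make the first vertex of each leg new in every coordinate, the avoided set contains all
    neighbours of a leaf that reuse an old coordinate. By [energy_proper] each choice of leaf,
    coordinate and old value gives at most one such neighbour, so the set is bounded. *)
Lemma spider_rich_repetition (phi : T -> 'I_r) b l s (u : 'I_3 -> {ffun 'I_r -> T}) :
  0 < b -> 1 < l -> s = 3 + b * (3 * l.-1 + 1) ->
  (forall a a', a != a' -> ~~ energy_conf (u a) (u a')) ->
  spider_rich (energy_adj col M phi) l (3 * r * (3 + (b + s) * (3 * l.+1))) u ->
  exists (S : {set T}) (Om Om0 : {set {set T}}),
  [/\ #|S| = r * s, Om0 \subset Om, (forall ed, ed \in Om -> #|ed| = 2 /\ ed \subset S),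
      (forall ed, ed \in Om -> exists2 ed0, ed0 \in Om0 & col ed = col ed0) &
      (r - 1) * (s + 2 * b - 3) + #|Om0| <= #|Om|].
Proof.
move=> b0 l1 s_def u_conf rich; pose U : finType := {ffun 'I_r -> T}.
pose p0 : legs_fun U := fun a _ => u a.
pose tu (ps : seq (legs_fun U)) : {set U} := [set u a | a : 'I_3] :|: legs_union l p0 ps.
pose X (ps : seq (legs_fun U)) : {set U} := \bigcup_(x : 'I_3 * 'I_r)
  [set q | energy_adj col M phi (u x.1) q & q x.2 \in [set z x.2 | z : U in tu ps]].
have l0 : 0 < l := ltnW l1.
have [ps hps|ps sps hps] := greedy_spiders l0 (X := X) p0 (B := b + s) rich.
  apply: leq_trans (card_bigcup_le _ _) _.
  have -> : 3 * r = #|{: 'I_3 * 'I_r}| by rewrite card_prod !card_ord.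
  rewrite -sum_nat_const; apply: leq_sum => -[a i] _ /=.
  apply: leq_trans (_ : #|[set z i | z : U in tu ps]| <= _); last first.
    apply: leq_trans (leq_imset_card _ _) _; apply: leq_trans (cardsU_le _ _) _.
    apply: leq_add; first by apply: leq_trans (leq_imset_card _ _) _; rewrite ?cardsT card_ord.
    by apply: leq_trans (card_legs_union _ _ _) _; rewrite leq_mul2r ltnW ?orbT.
  set Y := [set q | _ & _]; rewrite -(@card_in_imset _ _ (fun q : U => q i) Y).
    by apply: subset_leq_card; apply/subsetP => z /imsetP[q]; rewrite inE => /andP[_ ?] ->.
  move=> q q'; rewrite !inE => /andP[h _] /andP[h' _] E.
  exact: (energy_proper M_matching h h' E).
pose p j := nth p0 ps j.
apply: (@energy_core T K col M r phi M2 M_matching l (b + s) u p (fun j => X (take j ps)) l1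
  u_conf hps _ b s s_def) => //.
move=> j a i jB; have [pj0 _ padj _ pX] := hps j jB.
have [+ _] := pX a 1 l0; apply: contra => /shadowP h.
apply/bigcupP; exists (a, i) => //=; rewrite inE.
have := padj a 0 l0; rewrite pj0 => -> /=.
apply/imsetP; case: h => [[a' ->]|[j' [a' [m [jj ml ->]]]]].
  by exists (u a') => //; apply/setUP; left; apply: imset_f.
exists (p j' a' m) => //; apply/setUP; right; exact: legs_unionP sps jB jj ml.
Qed.

Definition color_class (c : K) := [set ed in M | col ed == c].

Definition mono_tuples : {set {ffun 'I_r -> {set T}}} :=
  \bigcup_(c : K) [set f : {ffun 'I_r -> {set T}} |
     (f \in ffun_on (mem (color_class c))) && injectiveb f].

Lemma card_mono_tuples : #|mono_tuples| = \sum_c #|color_class c| ^_ r.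
Proof.
rewrite card_bigcup_disjoint => [|c c' f].
  apply: eq_bigr => c _; rewrite cardsE -[X in _ ^_ X]card_ord -card_inj_ffuns_on.
  by apply: eq_card => f; rewrite !inE.
rewrite !inE => /andP[/ffun_onP/(_ (Ordinal r_gt0)) + _] /andP[/ffun_onP/(_ (Ordinal r_gt0)) + _].
by rewrite !inE => /andP[_ /eqP<-] /andP[_ /eqP<-].
Qed.

Lemma mono_tupleP f : f \in mono_tuples -> exists c, [/\ forall i, f i \in M,
  forall i, col (f i) = c & forall i j x, x \in f i -> x \in f j -> i = j].
Proof.
move=> /bigcupP[c _]; rewrite inE => /andP[/ffun_onP fM /injectiveP finj]; exists c.
have h i : f i \in M /\ col (f i) = c by have := fM i; rewrite !inE => /andP[? /eqP].
split=> [i|i|i j x xi xj]; [by case: (h i)|by case: (h i)|].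
have [Mi ci] := h i; have [Mj cj] := h j.
by apply: finj; apply: M_matching xi xj => //; rewrite ci cj.
Qed.

Definition labelled_by (f : {ffun 'I_r -> {set T}}) (phi : {ffun T -> 'I_r}) :=
  [forall i, [forall (x | x \in f i), phi x == i]].

(** Overwrite a labelling correctly on the [2 * r] ends of the edges of [f], which are disjoint. The
    original is recovered from the result and the overwritten labels, for which there are
    [(r * r) ^ r] possibilities. *)
Lemma card_labelled_by (x0 : T) f : f \in mono_tuples ->
  #|{: {ffun T -> 'I_r}}| <= #|[set phi | labelled_by f phi]| * (r * r) ^ r.
Proof.
move=> /mono_tupleP[c [fM _ fdis]].
pose over (phi : {ffun T -> 'I_r}) : {ffun T -> 'I_r} :=
  [ffun z => if [pick i | z \in f i] is Some i then i else phi z].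
pose en (i : 'I_r) := (nth x0 (enum (f i)) 0, nth x0 (enum (f i)) 1).
have fE i : f i = [set (en i).1; (en i).2] by apply: card2_ends; apply: M2.
pose h phi := (over phi, [ffun i => (phi (en i).1, phi (en i).2)] : {ffun 'I_r -> 'I_r * 'I_r}).
have hinj : injective h.
  move=> phi phi' [E1 E2]; apply/ffunP => z.
  have := congr1 (fun g : {ffun T -> 'I_r} => g z) E1; rewrite !ffunE.
  case: pickP => [i zi _|//].
  have := congr1 (fun g : {ffun 'I_r -> 'I_r * 'I_r} => g i) E2; rewrite !ffunE => -[e1 e2].
  by move: zi; rewrite fE !inE => /orP[]/eqP->.
rewrite -cardsT -(card_imset _ hinj).
apply: leq_trans (_ : #|setX [set phi | labelled_by f phi] [set: {ffun 'I_r -> 'I_r * 'I_r}]| <= _).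
  apply: subset_leq_card; apply/subsetP => x /imsetP[phi _ ->]; rewrite !inE andbT /=.
  apply/forallP => i; apply/forall_inP => z zi; rewrite ffunE.
  by case: pickP => [j zj|/(_ i)]; [rewrite (fdis j i z)|rewrite zi].
by rewrite cardsX cardsT card_ffun card_prod !card_ord.
Qed.

(* Averaging over all labellings: a monochromatic tuple of edges is labelled
   correctly by a proportion at least [r ^ (-2r)] of them. *)
Lemma good_labelling (x0 : T) : exists phi : T -> 'I_r,
  \sum_c #|color_class c| ^_ r <= (r * r) ^ r * arcs (energy_adj col M phi) setT setT.
Proof.
pose g (phi : {ffun T -> 'I_r}) := #|[set f in mono_tuples | labelled_by f phi]|.
have [||phi hphi] := @average_witness {ffun T -> 'I_r} (fun phi => (r * r) ^ r * g phi) #|mono_tuples|.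
- by rewrite card_ffun card_ord expn_gt0 r_gt0.
- rewrite -big_distrr /=.
  have -> : \sum_phi g phi = \sum_(f in mono_tuples) #|[set phi | labelled_by f phi]|.
    rewrite (eq_bigr (fun phi => \sum_(f in mono_tuples) (labelled_by f phi : nat))); last first.
      move=> phi _; rewrite /g -sum1dep_card big_mkcondr /=.
      by apply: eq_bigr => f _; case: labelled_by.
    rewrite exchange_big /=; apply: eq_bigr => f _; rewrite -sum1dep_card [RHS]big_mkcond /=.
    by apply: eq_bigr => phi _; case: labelled_by.
  rewrite big_distrr /= mulnC -sum_nat_const; apply: leq_sum => f fm.
  by rewrite mulnC; apply: card_labelled_by.
exists phi; rewrite -card_mono_tuples; apply: leq_trans hphi _; rewrite leq_mul2l; apply/orP; right.
rewrite card_arcs.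
pose en (f : {ffun 'I_r -> {set T}}) : {ffun 'I_r -> T} * {ffun 'I_r -> T} :=
  ([ffun i => nth x0 (enum (f i)) 0], [ffun i => nth x0 (enum (f i)) 1]).
have enE f i : f \in mono_tuples -> f i = [set (en f).1 i; (en f).2 i].
  by move=> /mono_tupleP[c [fM _ _]]; rewrite !ffunE; apply/card2_ends/M2.
rewrite /g -(@card_in_imset _ _ en) => [|f f']; last first.
  move=> /setIdP[fm _] /setIdP[fm' _] E; apply/ffunP => i.
  by rewrite (enE f) // (enE f') // E.
apply: subset_leq_card; apply/subsetP => x /imsetP[f /setIdP[fm /forallP fl] ->].
have [c [fM fc _]] := mono_tupleP fm.
rewrite inE; apply/existsP; exists c; apply/forallP => i; rewrite -enE // fM fc eqxx /=.
have /forall_inP hl := fl i.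
by rewrite !hl // (enE f i fm) ?set21 ?set22.
Qed.

End Labelling.

Lemma ffact_ge m r : 2 * r <= m -> m ^ r <= 2 ^ r * m ^_ r.
Proof.
elim: r => [//|r IH] h; rewrite expnSr ffactnSr expnSr mulnACA leq_mul //.
  by apply: IH; move: h; clear; lia.
by move: h; clear; lia.
Qed.

(** Convexity for falling factorials. Colours with at least half the average number of edges carry
    at least half of all edges; for them [m_ c >= 2 * r], so the falling factorial is comparable to
    the power. *)
Lemma sum_ffact_ge (K : finType) (m_ : K -> nat) r : 0 < r ->
  4 * r * #|K| <= \sum_c m_ c ->
  (\sum_c m_ c) ^ r <= 4 ^ r * #|K| ^ (r - 1) * \sum_c m_ c ^_ r.
Proof.
case: r => // r _; rewrite subn1 /=; set m := \sum_c m_ c => hm.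
have [K0|K0] := posnP #|K|.
  have -> : m = 0 by apply: big1 => c; have := fintype0 c; rewrite K0 => /(_ erefl).
  by rewrite exp0n.
pose big c := m <= 2 * #|K| * m_ c.
have hbig : m <= 2 * \sum_(c | big c) m_ c.
  rewrite -(leq_pmul2l K0).
  have hs : \sum_(c | ~~ big c) 2 * #|K| * m_ c <= #|K| * m.
    apply: leq_trans (_ : \sum_(c : K) m <= _); last by rewrite sum_nat_const.
    rewrite big_mkcond /=; apply: leq_sum => c _; case: ifP => //.
    by rewrite -ltnNge => /ltnW.
  have E : m = \sum_(c | big c) m_ c + \sum_(c | ~~ big c) m_ c by rewrite /m (bigID big).
  move: hs E; rewrite -big_distrr /=.
  move: (\sum_(c | big c) m_ c) (\sum_(c | ~~ big c) m_ c) #|K| (m) => x y z w; clear => h E; subst w.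
  rewrite mulnDr [z * (2 * x)]mulnCA; move: h; rewrite mulnDr -mulnA.
  by move: (z * x) (z * y); clear; lia.
apply: leq_trans (_ : 2 * (\sum_(c | big c) m_ c) * m ^ r <= _).
  by rewrite expnS leq_mul2r hbig orbT.
rewrite -mulnA big_distrl /=.
apply: leq_trans (_ : 2 * \sum_(c | big c) (2 * #|K|) ^ r * (2 ^ r.+1 * m_ c ^_ r.+1) <= _).
  rewrite leq_mul2l; apply: leq_sum => c bc.
  apply: leq_trans (_ : m_ c * (2 * #|K| * m_ c) ^ r <= _).
    rewrite leq_mul2l; apply/orP; right.
    by case: (posnP r) => [->|r0]; [|rewrite leq_exp2r].
  rewrite expnMn mulnCA -expnS leq_mul2l; apply/orP; right; apply: ffact_ge.
  rewrite -(leq_pmul2l K0) ; move: bc hm; rewrite /big.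
  by move: (m) (m_ c) #|K| => x y z; clear => h1 h2; nia.
rewrite -big_distrr /= -big_distrr /=.
have -> : 4 ^ r.+1 * #|K| ^ r = 2 * (2 * #|K|) ^ r * 2 ^ r.+1.
  by rewrite (_ : 4 = 2 * 2) // !expnMn [2 ^ r.+1]expnS; move: (2 ^ r) (_ ^ r) => x y; clear; lia.
rewrite -!mulnA !leq_mul2l; do 3!(apply/orP; right).
by rewrite [X in _ <= X](bigID big) /= leq_addr.
Qed.

(** Take a largest family that is a matching within each colour. Every edge then meets a member of
    its own colour, and one member is met by at most [2 * d] edges of that colour. *)
Lemma color_matching (T K : finType) (col : {set T} -> K) d :
  (forall x c, #|[set y | y != x & col [set x; y] == c]| <= d) ->
  exists M : {set {set T}}, [/\ forall ed, ed \in M -> #|ed| = 2,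
    forall ed ed' x, ed \in M -> ed' \in M -> col ed = col ed' -> x \in ed -> x \in ed' -> ed = ed' &
    'C(#|T|, 2) <= 2 * d * #|M|].
Proof.
move=> hd.
pose matching (M : {set {set T}}) := [forall ed in M, #|ed| == 2] &&
  [forall ed in M, forall ed' in M, (col ed == col ed') ==> (ed != ed') ==> [disjoint ed & ed']].
have m0 : matching set0.
  by apply/andP; split; apply/forall_inP => ed; rewrite inE.
case: (@arg_maxnP _ set0 matching (fun M : {set {set T}} => #|M|) m0) => M mM Mmax0.
have {Mmax0} Mmax (M' : {set {set T}}) : matching M' -> #|M'| <= #|M| := Mmax0 M'.
have /andP[/forall_inP M2 /forall_inP Md] := mM.
have M2' ed : ed \in M -> #|ed| = 2 by move=> /M2/eqP.
have Mdis ed ed' : ed \in M -> ed' \in M -> col ed = col ed' -> ed != ed' -> [disjoint ed & ed'].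
  by move=> h1 h2 h3 h4; have /forall_inP/(_ ed' h2) := Md ed h1; rewrite h3 eqxx h4.
exists M; split=> //.
  move=> ed ed' x h1 h2 h3 x1 x2; apply/eqP/contraT => h4.
  by have := disjointFr (Mdis _ _ h1 h2 h3 h4) x1; rewrite x2.
pose N x c := [set y | y != x & col [set x; y] == c].
pose near (ed : {set T}) := \bigcup_(x | x \in ed) [set [set x; y] | y in N x (col ed)].
have -> : 'C(#|T|, 2) = #|[set A : {set T} | A \subset [set: T] & #|A| == 2]|.
  by rewrite cards_draws cardsT.
apply: leq_trans (_ : #|\bigcup_(ed | ed \in M) near ed| <= _); last first.
  apply: leq_trans (card_bigcup_le _ _) _; rewrite mulnC -sum_nat_const.
  apply: leq_sum => ed /M2' ed2; apply: leq_trans (card_bigcup_le _ _) _.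
  rewrite -ed2 -sum_nat_const; apply: leq_sum => x _.
  by apply: leq_trans (leq_imset_card _ _) (hd x (col ed)).
apply: subset_leq_card; apply/subsetP => f; rewrite inE => /andP[_ /eqP f2].
suff [ed [edM ce [x xe xf]]] : exists ed, [/\ ed \in M, col ed = col f &
    exists2 x, x \in ed & x \in f].
  apply/bigcupP; exists ed => //; apply/bigcupP; exists x => //.
  have [y yx fE] : exists2 y, y != x & f = [set x; y].
    have /cards1P[y Ey] : #|f :\ x| == 1 by have := cardsD1 x f; rewrite xf f2; lia.
    have yf : y \in f :\ x by rewrite Ey set11.
    exists y; first by move: yf; rewrite !inE => /andP[].
    by rewrite -(setD1K xf) Ey.
  by apply/imsetP; exists y => //; rewrite inE yx -fE ce eqxx.
have [fM|fM] := boolP (f \in M).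
  have /card_gt0P[x xf] : 0 < #|f| by rewrite f2.
  by exists f; split=> //; exists x.
have nm : ~~ matching (f |: M).
  by apply/negP => /Mmax; rewrite cardsU1 fM add1n ltnn.
have [ed /and3P[edM /eqP ce nd]|no] := pickP [pred ed | [&& ed \in M, col ed == col f & ~~ [disjoint ed & f]]].
  exists ed; split=> //; move: nd; rewrite -setI_eq0 => /set0Pn[x]; rewrite inE => /andP[x1 x2].
  by exists x.
case/negP: nm; apply/andP; split.
  by apply/forall_inP => ed /setU1P[->|/M2' ->]; rewrite ?f2.
have nof ed : ed \in M -> col ed = col f -> [disjoint ed & f].
  by move=> edM ce; have := no ed; rewrite /= edM ce eqxx => /negbFE.
apply/forall_inP => ed h1; apply/forall_inP => ed' h2; apply/implyP => /eqP h3; apply/implyP => h4.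
case/setU1P: h1 h3 h4 => [->|h1]; case/setU1P: h2 => [->|h2] h3 h4.
- by rewrite eqxx in h4.
- by rewrite disjoint_sym; apply: nof.
- exact: nof.
- exact: Mdis.
Qed.

(** * Limits on colour repetitions in a coloring *)

Section Coloring.
Variables (n p q k : nat) (c : {ffun Kedge n -> 'I_k}).
Hypothesis c_pq : pq_coloring p q c.
Variable col : {set 'I_n} -> 'I_k.
Hypothesis col_c : forall ed : Kedge n, col (val ed) = c ed.

Lemma pq_repetition (S : {set 'I_n}) (Om Om0 : {set {set 'I_n}}) :
  #|S| = p -> Om0 \subset Om -> (forall ed, ed \in Om -> #|ed| = 2 /\ ed \subset S) ->
  (forall ed, ed \in Om -> exists2 ed0, ed0 \in Om0 & col ed = col ed0) ->
  q + #|Om| <= 'C(p, 2) + #|Om0|.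
Proof.
move=> Sp O0 OS Oc.
have hq : q <= #|[set c ed | ed : Kedge n & val ed \subset S]|.
  by have /forallP/(_ S) := c_pq; rewrite Sp eqxx.
pose P := [set A : {set 'I_n} | A \subset S & #|A| == 2].
have cP : #|P| = 'C(p, 2) by rewrite cards_draws Sp.
have OP : Om \subset P.
  by apply/subsetP => ed /OS[h1 h2]; rewrite inE h2 h1.
have h : #|[set c ed | ed : Kedge n & val ed \subset S]| <= #|P :\: Om| + #|Om0|.
  apply: leq_trans (cardsU_le _ _); apply: leq_trans (leq_imset_card col _).
  apply: subset_leq_card; apply/subsetP => x /imsetP[ed]; rewrite inE => edS ->.
  rewrite -col_c; have [eO|eO] := boolP (val ed \in Om).
    have [ed0 e0 ->] := Oc _ eO; apply: imset_f; by rewrite inE e0 orbT.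
  by apply: imset_f; rewrite !inE eO edS (valP ed).
have := cardsID Om P; rewrite (setIidPr OP) cP.
by move: hq h; move: #|[set c ed | ed : Kedge n & _]| #|_ :\: _| #|Om0| #|Om| => a1 a2 a3 a4; clear; lia.
Qed.

(** A monochromatic star with [p - 1] edges has [p] vertices and repeats its colour [p - 2 >= D]
    times, one more than the coloring allows. *)
Lemma color_degree_le D x ct : q = 'C(p, 2) - D + 1 -> D <= 'C(p, 2) -> D + 2 <= p ->
  #|[set y | y != x & col [set x; y] == ct]| <= p.
Proof.
move=> qE DC Dp; rewrite leqNgt; apply/negP => hY.
(* The weight 0 only serves to extract a subset of prescribed size. *)
have [|Y [YA Yp _]] := heavy_subset (fun _ => 0) (A := [set y | y != x & col [set x; y] == ct]) (h := p - 1).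
  by move: hY Dp; clear; lia.
have Yx y : y \in Y -> y != x /\ col [set x; y] = ct.
  by move=> /(subsetP YA); rewrite inE => /andP[? /eqP].
have [y0 y0Y] : exists y, y \in Y by apply/card_gt0P; rewrite Yp; move: Dp; clear; lia.
have := @pq_repetition (x |: Y) [set [set x; y] | y in Y] [set [set x; y0]].
rewrite cards1 card_imset; last by move=> y y' /set2_inj.
rewrite Yp; move=> h.
suff : q + (p - 1) <= 'C(p, 2) + 1 by rewrite qE; move: DC Dp; clear; lia.
apply: h.
- rewrite cardsU1 Yp; have -> : x \notin Y by apply/negP => /Yx[]; rewrite eqxx.
  by move: Dp; clear; lia.
- by rewrite sub1set; apply/imsetP; exists y0.
- move=> ed /imsetP[y yY ->]; have [yx _] := Yx y yY; split; first by rewrite cards2 eq_sym yx.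
  by apply/subsetP => z; rewrite !inE => /orP[]/eqP->; rewrite ?eqxx ?yY ?orbT.
- move=> ed /imsetP[y yY ->]; exists [set x; y0]; first by rewrite set11.
  by rewrite (Yx y yY).2 (Yx y0 y0Y).2.
Qed.

End Coloring.

(** Two bounds on the number [A] of arcs of the energy graph meet:
    [n ^ (2 * r) <= C1 * k ^ (r - 1) * A] from convexity, and
    [A ^ (3 * l) < C * (n ^ r) ^ (3 * l + 2)] because a denser energy graph would produce too many
    repetitions. *)
Theorem pq_colors_bound b l r s : 0 < b -> 1 < l -> 1 < r -> 2 * r < 3 * l ->
  s = 3 + b + 3 * (l - 1) * b ->
  exists C, 0 < C /\ forall n k, 1 < n ->
    pq_colorable n (r * s) ('C(r * s, 2) - (r - 1) * (3 * b * l) + 1) k ->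
    n ^ (r * (3 * l - 2)) <= C * k ^ (3 * l * (r - 1)).
Proof.
move=> b0 l1 r1 rl sE; set p := r * s; set D := (r - 1) * (3 * b * l).
have r0 : 0 < r := ltnW r1.
have sE' : s = 3 + b * (3 * l.-1 + 1).
  by rewrite sE -subn1; move: (l - 1) => x; clear; lia.
have s3 : 3 <= s by rewrite sE'.
have EE : s + 2 * b - 3 = 3 * b * l.
  by rewrite sE; move: l1; clear; case: l => // l _; rewrite subn1 /=; lia.
(* The difference [p - D] equals [3 * r + b * (3 * l - 2 * r)]; this is where [2 * r < 3 * l]
   enters. *)
have Dp : D + 2 <= p.
  rewrite /D /p sE; move: l1 r1 rl; clear; case: r => // r; case: l => // l _ _ rl.
  have h : b * (2 * r) <= b * (3 * l) by rewrite leq_mul2l; apply/orP; right; lia.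
  by rewrite !subn1 /=; nia.
have DC : D <= 'C(p, 2).
  have p6 : 4 <= p by rewrite /p; move: r1 s3; clear; nia.
  apply: leq_trans (_ : p <= _); first by move: Dp; clear; lia.
  rewrite bin2 -divn2 leq_divRL //.
  by rewrite leq_mul2l; apply/orP; right; move: p6; clear; lia.
have l0 : 0 < l.-1 by move: l1; clear; lia.
have [C [C0 hC]] := dense_spider_rich r (3 * r * (3 + (b + s) * (3 * l.+1))) l0.
have El : l.-1.+1 = l by move: l1; clear; lia.
rewrite El in hC.
pose C1 := (8 * p) ^ r * 4 ^ r * (r * r) ^ r.
pose C2 := 8 * p * (4 * r).
exists (C1 ^ (3 * l) * C + C2 ^ (3 * l * (r - 1))); split.
  have s0 : 0 < s by apply: leq_trans s3.
  by rewrite addn_gt0 muln_gt0 C0 expn_gt0 /C1 !muln_gt0 !expn_gt0 !muln_gt0 s0 r0.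
move=> n k n1 /existsP[c cpq].
have x0 : 'I_n := Ordinal (ltnW n1).
have e0 : Kedge n.
  exists [set Ordinal (ltnW n1); Ordinal n1]; by rewrite cards2.
pose col (ed : {set 'I_n}) : 'I_k := if insub ed is Some ed' then c ed' else c e0.
have colE (ed : Kedge n) : col (val ed) = c ed by rewrite /col valK.
have deg x ct := color_degree_le cpq colE x ct erefl DC Dp.
have [M [M2 Mm cM]] := color_matching deg; rewrite card_ord in cM.
have n2 : n ^ 2 <= 8 * p * #|M|.
  apply: leq_trans (_ : 4 * 'C(n, 2) <= _); last by move: cM; clear; nia.
  rewrite bin2 -divn2.
  have := divn_eq (n * n.-1) 2; rewrite modn2 oddM.
  have -> : odd n && odd n.-1 = false.
    by rewrite -[in odd n](prednK (ltnW n1)) /=; case: (odd n.-1).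
  rewrite addn0 => E; have -> : 4 * (n * n.-1 %/ 2) = 2 * (n * n.-1) by rewrite [in RHS]E; clear; lia.
  rewrite -mulnn mulnCA leq_mul2l; apply/orP; right; move: n1; clear; lia.
have cMs : #|M| = \sum_ct #|color_class col M ct|.
  rewrite -sum1_card (partition_big col xpredT) //=.
  by apply: eq_bigr => ct _; rewrite sum1dep_card.
have big0 : r * (3 * l - 2) <= 2 * (3 * l * (r - 1)).
  apply: leq_trans (leq_mul (leqnn r) (leq_subr 2 (3 * l))) _.
  by move: r1; clear; case: r => // -[//|r] _; rewrite subn1 /=; move: (3 * l); clear; nia.
(* With so few matching edges per colour, [k] is already of order [n ^ 2], more than needed by
   [big0]. *)
have [small|large] := ltnP #|M| (4 * r * k).
  have h : n ^ 2 <= C2 * k.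
    by apply: leq_trans n2 _; rewrite /C2 -[X in _ <= X]mulnA leq_mul2l ltnW ?orbT.
  apply: leq_trans (_ : (C2 * k) ^ (3 * l * (r - 1)) <= _).
    apply: leq_trans (_ : (n ^ 2) ^ (3 * l * (r - 1)) <= _).
      by rewrite -expnM leq_exp2l.
    by rewrite leq_exp2r // !muln_gt0 subn_gt0 r1 (ltnW l1).
  by rewrite expnMn leq_mul2r leq_addl orbT.
have [phi hphi] := good_labelling M2 Mm r0 x0.
set A := arcs _ _ _ in hphi.
have cK : #|{: 'I_k}| = k by rewrite card_ord.
have := @sum_ffact_ge _ (fun ct => #|color_class col M ct|) r r0.
rewrite -cMs cK => /(_ large) hM.
have nA : n ^ (2 * r) <= C1 * k ^ (r - 1) * A.
  rewrite expnM; apply: leq_trans (_ : (8 * p * #|M|) ^ r <= _); first by rewrite leq_exp2r.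
  rewrite expnMn; apply: leq_trans (leq_mul (leqnn _) (leq_trans hM (leq_mul (leqnn _) hphi))) _.
  by rewrite /C1; move: ((8 * p) ^ r) (4 ^ r) (k ^ _) ((r * r) ^ r) => a1 a2 a3 a4; clear; lia.
have Alt : A ^ (3 * l) < C * (n ^ r) ^ (3 * l + 2).
  rewrite ltnNge; apply/negP => hA.
  have cU : #|{: {ffun 'I_r -> 'I_n}}| = n ^ r by rewrite card_ffun !card_ord.
  have [||||||u [u1 u2]] := hC {ffun 'I_r -> 'I_n} (energy_adj col M phi) (@energy_conf _ r).
  - exact: energy_adj_sym.
  - exact: energy_conf_sym.
  - exact: energy_conf_refl.
  - exact: energy_conf_le.
  - by rewrite cU expn_gt0 ltnW.
  - by rewrite cU.
  have [S [Om [Om0 [hS O0 OS Oc cO]]]] := spider_rich_repetition M2 Mm r0 b0 l1 sE' u1 u2.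
  have := pq_repetition cpq colE hS O0 OS Oc.
  by move: cO DC; rewrite EE -/D; clear; lia.
have nr0 : 0 < n ^ (r * (3 * l + 2)) by rewrite expn_gt0 ltnW.
rewrite -(leq_pmul2r nr0) -expnD -mulnDr.
have -> : 3 * l - 2 + (3 * l + 2) = 2 * (3 * l) by move: l1; clear; lia.
rewrite mulnCA mulnA expnM.
have k3 : 0 < 3 * l by move: l1; clear; lia.
apply: leq_trans (_ : (C1 * k ^ (r - 1) * A) ^ (3 * l) <= _); first by rewrite leq_exp2r.
rewrite expnMn [(C1 * _) ^ _]expnMn; apply: leq_trans (leq_mul (leqnn _) (ltnW Alt)) _.
rewrite -!expnM [(r - 1) * _]mulnC mulnDl mulnDl.
apply: leq_trans (leq_addr _ _).
by move: (C1 ^ (3 * l)) (k ^ _) (n ^ _) => a1 a2 a3; clear; lia.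
Qed.

(** * Asymptotic form *)

From mathcomp Require Import all_classical all_reals all_analysis.
Import numFieldNormedType.Exports.
Local Open Scope classical_set_scope.
Local Open Scope ring_scope.

Section Asymptotics.
Variable R : realType.

Lemma eqO_nat (f g : nat -> R) (C : R) : 0 < C ->
  (forall n, (1 < n)%N -> `|f n| <= C * `|g n|) -> f =O_\oo g.
Proof.
move=> C0 h; apply/eqO_exP; exists C => //.
by near=> n; apply: h; near: n; exists 2%N.
Unshelve. all: by end_near. Qed.

Lemma eqOmega_nat (f g : nat -> R) (C : R) : 0 < C ->
  (forall n, (1 < n)%N -> `|g n| <= C * `|f n|) -> f =Omega_\oo g.
Proof. by move=> C0 h; rewrite eqOmegaE eqOmegaO; apply: eqO_nat C0 h. Qed.

Lemma root_bound (x y C : R) a b : 0 <= x -> 0 <= y -> 0 <= C -> (0 < a)%N ->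
  x ^+ a <= C * y ^+ b -> x <= C `^ (a%:R^-1) * y `^ (b%:R / a%:R).
Proof.
move=> x0 y0 C0 a0 h.
have aR : a%:R != 0 :> R by rewrite pnatr_eq0 -lt0n.
have -> : x = (x ^+ a) `^ (a%:R^-1) by rewrite -powR_mulrn // -powRrM divff // powRr1.
rewrite powRrM powR_mulrn // -powRM ?exprn_ge0 //.
by apply: ge0_ler_powR => //; rewrite ?invr_ge0 ?nnegrE ?mulr_ge0 ?exprn_ge0.
Qed.

Lemma ex_Ksub_bigO b l : (1 < l)%N ->
  (fun n => (ex n (Ksub 3 b l))%:R : R) =O_\oo
  (fun n => n%:R `^ (2 - (1 - 2 / (3 * l%:R)))).
Proof.
move=> l1; have [C hC] := ex_Ksub_bound b l1.
have l0 : (0 < 3 * l)%N by lia.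
have l0R : l%:R != 0 :> R by rewrite pnatr_eq0 -lt0n; lia.
(* [C.+1] instead of [C] makes the constant positive. *)
apply: (@eqO_nat _ _ (C.+1%:R `^ ((3 * l)%:R^-1))); first by rewrite powR_gt0.
move=> n n1; rewrite normr_nat (ger0_norm (powR_ge0 _ _)).
have -> : 2 - (1 - 2 / (3 * l%:R)) = (3 * l + 2)%:R / (3 * l)%:R :> R.
  by rewrite natrD natrM; field.
apply: root_bound => //; rewrite -!natrX -natrM ler_nat.
by apply: leq_trans (hC n (ltnW n1)) _; rewrite leq_mul2r leqnSn orbT.
Qed.

Lemma f_pq_Ksub_bigOmega b l r s (e : R) : (0 < b)%N -> (1 < l)%N -> (1 < r)%N ->
  (2 * r < 3 * l)%N -> s = (3 + b + 3 * (l - 1) * b)%N ->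
  e = r%:R / (r%:R - 1) * (1 - 2 / (3 * l%:R)) ->
  (fun n => (f_pq n (r * s) ('C(r * s, 2) - (r - 1) * (3 * b * l) + 1))%:R : R)
    =Omega_\oo (fun n => n%:R `^ e).
Proof.
move=> b0 l1 r1 rl sE eE; have [C [C0 hC]] := pq_colors_bound b0 l1 r1 rl sE.
pose a := (3 * l * (r - 1))%N.
have a0 : (0 < a)%N by rewrite !muln_gt0 subn_gt0 r1 (ltnW l1).
have aR : a%:R != 0 :> R by rewrite pnatr_eq0 -lt0n.
apply: (@eqOmega_nat _ _ (C%:R `^ (a%:R^-1))); first by rewrite powR_gt0 // ltr0n.
move=> n n1; rewrite normr_nat (ger0_norm (powR_ge0 _ _)).
set f := f_pq _ _ _.
have hf : (n ^ (r * (3 * l - 2)) <= C * f ^ a)%N.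
  apply: hC n1 _; apply: (proj1 (f_pqP _ _)).
  have p2 : (2 <= r * s)%N by rewrite sE; nia.
  have c0 : (0 < 'C(r * s, 2))%N by rewrite bin_gt0.
  have d0 : (0 < (r - 1) * (3 * b * l))%N by rewrite !muln_gt0 subn_gt0 r1 b0 (ltnW l1).
  by move: c0 d0; clear; lia.
(* The trivial exponent [a / a] brings the goal into the shape of [root_bound]; [e * a] is then the
   natural number [r * (3 * l - 2)]. *)
have -> : f%:R = f%:R `^ (a%:R / a%:R) :> R by rewrite divff // powRr1.
apply: root_bound => //; rewrite ?powR_ge0 //.
rewrite -powR_mulrn ?powR_ge0 // -powRrM.
have -> : e * a%:R = (r * (3 * l - 2))%:R.
  have l0R : l%:R != 0 :> R by rewrite pnatr_eq0 -lt0n ltnW.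
  have r0R : r%:R - 1 != 0 :> R by rewrite subr_eq0 (eqr_nat R r 1); move: r1; clear; lia.
  rewrite eE /a !natrM !natrB ?natrM; [by field; apply/andP|lia|lia].
by rewrite powR_mulrn // -!natrX -natrM ler_nat.
Qed.

End Asymptotics.

Theorem theorem4p2 (R : realType) (b l r : nat) (hb : (3 <= b)%N)
    (hl : (2 <= l)%N) (hr : (2 <= r <= 6)%N)
    (hrl : r%:R < 3 / 2 * l%:R :> R) :
  nice r (1 - 2 / (3 * l%:R) : R) (Ksub 3 b l) /\
  let s := (3 + b + 3 * (l - 1) * b)%N in
  [/\ #|vert (Ksub 3 b l)| = s,
      #|edges (Ksub 3 b l)| = (3 * b * l)%N &
      (fun n => (f_pq n (r * s) ('C(r * s, 2) - 3 * (r - 1) * b * l + 1))%:R : R)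
        =Omega_\oo
      (fun n => n%:R `^ (r%:R / (r%:R - 1) * (1 - 2 / (3 * l%:R))))].
Proof.
case/andP: hr => r1 _.
have rl : (2 * r < 3 * l)%N by rewrite -(ltr_nat R) !natrM; lra.
have b0 : (0 < b)%N by apply: leq_trans hb.
have vE : #|vert (Ksub 3 b l)| = (3 + b + 3 * (l - 1) * b)%N.
  by rewrite card_Ksub_vert -subn1 mulnAC.
have eE := card_Ksub_edges 3 b hl.
split; last first.
  split=> //; have -> : (3 * (r - 1) * b * l = (r - 1) * (3 * b * l))%N by clear; lia.
  exact: f_pq_Ksub_bigOmega.
split=> //.
- exact: Ksub_bipartite.
- have l0 : 2 <= l%:R :> R by rewrite (ler_nat R 2).
  by rewrite subr_gt0 ltr_pdivrMr; lra.
- exact: ex_Ksub_bigO.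
rewrite vE eE; apply: f_pq_Ksub_bigOmega => //.
by rewrite -mulrA mulrC.
Qed.
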